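(* $\mathcal{T}_{h+1}$-Free Edge Deletion on an $n$-vertex, $m$-edge graph of neighborhood diversity $t$ can be solved in time $\mathcal{O}\left(f(t,h)\cdot(\log n)^2+n+m\right)$, where $f(t,h)=t\cdot\binom{h+t}{t}^{2.5\binom{h+t}{t}+o\left(\binom{h+t}{t}\right)}$.
   Context: $\mathcal{T}_{h+1}$-Free Edge Deletion: given a simple undirected graph $G$ and positive integers $k,h$, decide whether there is $F\subseteq E(G)$ with $|F|\le k$ such that every connected component of $G\setminus F$ has at most $h$ vertices. Two distinct vertices $u,v$ are twins if $N[u]=N[v]$ or $N(u)=N(v)$. $G$ has neighborhood diversity at most $t$ if $V(G)$ can be partitioned into at most $t$ sets such that any two vertices in the same set are twins. *)

(* Defs.v *)
From mathcomp Require Import all_boot all_order all_algebra.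
From mathcomp Require Import all_classical all_reals all_analysis.

Set Implicit Arguments.
Unset Strict Implicit.
Unset Printing Implicit Defensive.

Import Order.TTheory GRing.Theory Num.Theory.
Import numFieldNormedType.Exports.

Local Open Scope nat_scope.

Record sgraph (n : nat) := SGraph {
  edges : {set {set 'I_n}};
  edges_card2 : forall e, e \in edges -> #|e| = 2
}.

Section Graphs.
Variable n : nat.
Implicit Types (G : sgraph n) (E F : {set {set 'I_n}}) (u v : 'I_n).

Definition adj E : rel 'I_n := [rel u v | [set u; v] \in E].

Definition component E u : {set 'I_n} := [set v | connect (adj E) u v].

(* A yes-instance (G, k, h); G \ F keeps all vertices of G. *)
Definition T_free_edge_deletion G (k h : nat) : Prop :=
  exists F, [/\ F \subset edges G, #|F| <= k &
    forall u, #|component (edges G :\: F) u| <= h].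

Definition open_nbh G u : {set 'I_n} := [set v | adj (edges G) u v].
Definition closed_nbh G u : {set 'I_n} := u |: open_nbh G u.

Definition twins G u v : Prop :=
  u <> v /\ (closed_nbh G u = closed_nbh G v \/ open_nbh G u = open_nbh G v).

Definition nbh_diversity_at_most G (t : nat) : Prop :=
  exists P : {set {set 'I_n}},
    [/\ finset.partition P [set: 'I_n], #|P| <= t &
      forall A, A \in P ->
        forall u v, u \in A -> v \in A -> u <> v -> twins G u v].

(* [s] lists every edge of G exactly once, in any order, and with the two
   endpoints of each edge in either order. *)
Definition edge_listing G (s : seq ('I_n * 'I_n)) : Prop :=
  perm_eq [seq [set p.1; p.2] | p <- s] (enum (edges G)).

End Graphs.

(* A structured word RAM: a fixed program uses finitely many registers and an
   array of memory cells with indirect addressing.  Registers and cells hold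
   natural numbers; with word length [w], every value computed or read must be
   smaller than [2 ^ w], and an evaluation that violates this is stuck (there
   is no wrap-around).  Every node of an evaluated expression and every
   executed assignment, store or test costs one step. *)

Inductive binop := OpAdd | OpSub | OpMul | OpDiv | OpMod | OpLt | OpEq.

(* [OpSub] is truncated at 0, and division by 0 gives 0 (remainder: the
   dividend). *)
Definition binop_sem (o : binop) (a b : nat) : nat :=
  match o with
  | OpAdd => a + b
  | OpSub => a - b
  | OpMul => a * b
  | OpDiv => a %/ b
  | OpMod => a %% b
  | OpLt => (a < b)
  | OpEq => (a == b)
  end.

Inductive expr :=
| Const of nat
| Reg of nat
| Fetch of expr
| Bin of binop & expr & expr.

Inductive cmd :=
| Skip
| Set_reg of nat & expr
| Store of expr & expr
| Seq of cmd & cmd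
| If of expr & cmd & cmd
| While of expr & cmd.

Record state := State { regs : nat -> nat; cells : nat -> nat }.

Definition word (w v : nat) : option nat := if v < 2 ^ w then Some v else None.

Fixpoint eval (w : nat) (s : state) (e : expr) : option nat :=
  match e with
  | Const v => word w v
  | Reg r => word w (regs s r)
  | Fetch e1 => if eval w s e1 is Some a then word w (cells s a) else None
  | Bin o e1 e2 =>
      match eval w s e1, eval w s e2 with
      | Some a, Some b => word w (binop_sem o a b)
      | _, _ => None
      end
  end.

Fixpoint ecost (e : expr) : nat :=
  match e with
  | Const _ | Reg _ => 1
  | Fetch e1 => (ecost e1).+1
  | Bin _ e1 e2 => (ecost e1 + ecost e2).+1
  end.

Definition set_reg (s : state) (r v : nat) : state :=
  State [eta regs s with r |-> v] (cells s).
Definition set_mem (s : state) (a v : nat) : state :=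
  State (regs s) [eta cells s with a |-> v].

(* [exec w s c T s']: with word length [w], command [c] started in [s] halts
   in [s'] after [T] steps.  The relation is deterministic, so that exhibiting
   a run says that the program halts without overflow. *)
Inductive exec (w : nat) : state -> cmd -> nat -> state -> Prop :=
| ExecSkip s : exec w s Skip 1 s
| ExecSet s r e v :
    eval w s e = Some v ->
    exec w s (Set_reg r e) (ecost e).+1 (set_reg s r v)
| ExecStore s e1 e2 a v :
    eval w s e1 = Some a -> eval w s e2 = Some v ->
    exec w s (Store e1 e2) (ecost e1 + ecost e2).+1 (set_mem s a v)
| ExecSeq s1 s2 s3 c1 c2 T1 T2 :
    exec w s1 c1 T1 s2 -> exec w s2 c2 T2 s3 ->
    exec w s1 (Seq c1 c2) (T1 + T2) s3
| ExecIf s s' e v c1 c2 T :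
    eval w s e = Some v ->
    exec w s (if v != 0 then c1 else c2) T s' ->
    exec w s (If e c1 c2) (ecost e + T).+1 s'
| ExecWhileFalse s e c :
    eval w s e = Some 0 ->
    exec w s (While e c) (ecost e).+1 s
| ExecWhileTrue s1 s2 s3 e v c T1 T2 :
    eval w s1 e = Some v -> v != 0 ->
    exec w s1 c T1 s2 -> exec w s2 (While e c) T2 s3 ->
    exec w s1 (While e c) (ecost e + T1 + T2).+1 s3.

(* Registers 0, 1, 2, 3 hold n, m, k, h; cells 2i and 2i+1 hold the endpoints
   of the i-th listed edge; every other register and cell holds 0. *)
Definition input (n : nat) (s : seq ('I_n * 'I_n)) (k h : nat) : state :=
  State (nth 0 [:: n; size s; k; h])
        (nth 0 (flatten [seq [:: val p.1; val p.2] | p <- s])).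

Definition accepts (s : state) : Prop := regs s 0 != 0.

Section Bounds.
Variable R : realType.
Local Open Scope ring_scope.

Definition param_factor (g : nat -> R) (t h : nat) : R :=
  let N := 'C(h + t, t) in
  t%:R * N%:R `^ (5 / 2 * N%:R + g N).

Definition time_bound (C : R) (g : nat -> R) (t h n m : nat) : R :=
  C * (param_factor g t h * ln n%:R ^+ 2 + n%:R + m%:R).

(* Word length O(log(n + m + k + h + T)): a word can hold every input number
   and the address of any cell that a run of about T steps may need. *)
Definition word_length_ok (c T : R) (n m k h w : nat) : Prop :=
  w%:R <= c * ln (n%:R + m%:R + k%:R + h%:R + T).

End Bounds.

(* Main.v *)
(* Deleting edges so that all components have at most [h] vertices amounts to
   partitioning the vertices into blocks of size at most [h] and keeping the
   edges inside blocks.  With [t] twin classes, only the type of a block matters: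
   the vector in [nat^t], of sum at most [h], counting its vertices of each
   class.  There are [N = 'C(h + t, t)] types, so the problem is an integer
   program with one variable [x a] per type [a] and only [t] equality constraints
   [\sum_a x a * a = b], where [b] lists the class sizes.  It is solved bit by
   bit, from the top: writing [d_j] for [b / 2^j - \sum_a (x a / 2^j) * a] (with
   rounding down), one has [0 <= d_j <= N h] in every coordinate, so a table
   indexed by [d_j] of size [(4 N h + 4)^t] carries the best value, and the next
   bit of each [x a] is decided by one pass over the table per type [a].  Each of
   the [O(log n)] bits thus costs [O(N (4 N h + 4)^t)] steps, and since
   [t, h < N] we have [N^2 (4 N h + 4)^t <= 4^N N^(2 N) <= 4^16 N^(5/2 N)], so no
   [o(N)] term is needed in the exponent.
   The twin classes are found in linear time by inserting every open and every
   closed neighbourhood into a trie. *)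

Require Import Defs.
From mathcomp Require Import all_boot zify.

Set Implicit Arguments.
Unset Strict Implicit.
Unset Printing Implicit Defensive.

(** * A loop language over registers and arrays *)

(** The algorithm is written in a small loop language, where time and value bounds follow from
    Hoare-style rules, and is compiled once to the RAM at the price of a constant factor. Assigned
    values stay below a bound [M] polynomial in the input numbers and the table size; an expression
    of fixed shape then evaluates below a fixed power of [M], so logarithmic words suffice.
    Zero-initialised memory makes large sparse structures affordable: neither the child tables of
    the tries, with up to [n] cells for each of about [n + 2m] nodes, nor a new table window for
    every bit has to be cleared. The program never sees [t]. It computes the number of twin classes,
    which is at most every admissible [t]. The table is not shown to hold exact optima. Two
    one-sided facts suffice: each nonzero entry is realised by some multiset of types, and each
    solution of the integer program is dominated by the entries at its own truncations. At the last
    bit these two facts decide the instance. *)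

Inductive aexpr :=
| Cst of nat
| Rd of nat
| Get of nat & aexpr
| Op of binop & aexpr & aexpr.

(* [AFor r l c] runs [c] with register [r] set to 0, 1, ... below the value of
   register [l], so that every program terminates. *)
Inductive acmd :=
| ANop
| ASet of nat & aexpr
| APut of nat & aexpr & aexpr
| ASeq of acmd & acmd
| AIf of aexpr & acmd & acmd
| AFor of nat & nat & acmd.

Record astate := AState { rg : nat -> nat; ar : nat -> nat -> nat }.

Definition upd T (f : nat -> T) i v : nat -> T := fun x => if x == i then v else f x.
Definition setr s r v := AState (upd (rg s) r v) (ar s).
Definition seta s j i v := AState (rg s) (upd (ar s) j (upd (ar s j) i v)).

Fixpoint ev (s : astate) (e : aexpr) : nat :=
  match e with
  | Cst v => v
  | Rd r => rg s r
  | Get j e1 => ar s j (ev s e1)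
  | Op o e1 e2 => binop_sem o (ev s e1) (ev s e2)
  end.

Fixpoint run (c : acmd) (s : astate) : astate :=
  match c with
  | ANop => s
  | ASet r e => setr s r (ev s e)
  | APut j e1 e2 => seta s j (ev s e1) (ev s e2)
  | ASeq c1 c2 => run c2 (run c1 s)
  | AIf e c1 c2 => if ev s e != 0 then run c1 s else run c2 s
  | AFor r l c1 =>
      setr (iteri (rg s l) (fun i s1 => run c1 (setr s1 r i)) s) r (rg s l)
  end.

(** The start state of round [i] of a loop, with the counter already set; when [i] is the loop bound
    it is the final state. *)
Definition turn (r : nat) (c : acmd) (i : nat) (s : astate) : astate :=
  setr (iteri i (fun i s1 => run c (setr s1 r i)) s) r i.

Fixpoint cost (c : acmd) (s : astate) : nat :=
  match c with
  | ASeq c1 c2 => cost c1 s + cost c2 (run c1 s)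
  | AIf e c1 c2 => (if ev s e != 0 then cost c1 s else cost c2 s).+1
  | AFor r l c1 => (\sum_(i < rg s l) (cost c1 (turn r c1 i s)).+1).+1
  | _ => 1
  end.

(* Every value assigned during the run is at most [M]; intermediate values of
   expressions may be larger. *)
Fixpoint within (M : nat) (c : acmd) (s : astate) : Prop :=
  match c with
  | ANop => True
  | ASet r e => ev s e <= M
  | APut j e1 e2 => ev s e2 <= M
  | ASeq c1 c2 => within M c1 s /\ within M c2 (run c1 s)
  | AIf e c1 c2 => if ev s e != 0 then within M c1 s else within M c2 s
  | AFor r l c1 => forall i, i < rg s l -> within M c1 (turn r c1 i s)
  end.

Definition small M s := (forall r, rg s r <= M) /\ (forall j i, ar s j i <= M).

Fixpoint wreg (c : acmd) (r : nat) : bool :=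
  match c with
  | ASet r1 _ => r == r1
  | ASeq c1 c2 | AIf _ c1 c2 => wreg c1 r || wreg c2 r
  | AFor r1 _ c1 => (r == r1) || wreg c1 r
  | _ => false
  end.

Fixpoint warr (c : acmd) (j : nat) : bool :=
  match c with
  | APut j1 _ _ => j == j1
  | ASeq c1 c2 | AIf _ c1 c2 => warr c1 j || warr c2 j
  | AFor _ _ c1 => warr c1 j
  | _ => false
  end.

Definition same_outside c s s' :=
  (forall r, ~~ wreg c r -> rg s' r = rg s r) /\
  (forall j, ~~ warr c j -> ar s' j = ar s j).

Lemma iteri_turn r c i s :
  iteri i.+1 (fun i s1 => run c (setr s1 r i)) s = run c (turn r c i s).
Proof. by []. Qed.

Lemma run_same_outside c s : same_outside c s (run c s).
Proof.
elim: c s => [|r e|j e1 e2|c1 IH1 c2 IH2|e c1 IH1 c2 IH2|r l c IH] s /=.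
- by split.
- by split=> //= r1 /negPf; rewrite /upd => ->.
- by split=> //= j1 /negPf; rewrite /upd => ->.
- split=> x /norP[h1 h2].
    by rewrite (IH2 _).1 // (IH1 _).1.
  by rewrite (IH2 _).2 // (IH1 _).2.
- by case: ifP => _; split=> x /norP[h1 h2];
    rewrite ?((IH1 _).1 x) ?((IH1 _).2 x) ?((IH2 _).1 x) ?((IH2 _).2 x).
- have H n : same_outside (AFor r l c) s
      (iteri n (fun i s1 => run c (setr s1 r i)) s).
    elim: n => [|n [IHr IHa]]; first by split.
    rewrite iteri_turn; split=> x hx.
      case/norP: (hx) => /negPf h1 h2.
      by rewrite (IH _).1 //= /upd h1 IHr.
    by rewrite (IH _).2 //= IHa.
  split=> x hx /=; last by rewrite (H _).2.
  by case/norP: (hx) => /negPf h1 _; rewrite /upd h1 (H _).1.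
Qed.

Lemma small_setr M s r v : small M s -> v <= M -> small M (setr s r v).
Proof.
by move=> [hr ha] hv; split=> [x|j i] //=; rewrite /upd; case: ifP.
Qed.

Lemma small_seta M s j i v : small M s -> v <= M -> small M (seta s j i v).
Proof.
move=> [hr ha] hv; split=> [x|j1 i1] //=; rewrite /upd; case: ifP => // _.
by case: ifP.
Qed.

Lemma small_run M c s : small M s -> within M c s -> small M (run c s).
Proof.
elim: c s => [|r e|j e1 e2|c1 IH1 c2 IH2|e c1 IH1 c2 IH2|r l c IH] s //= hs.
- exact: small_setr.
- exact: small_seta.
- by case=> /(IH1 _ hs) h1 /(IH2 _ h1).
- by case: ifP => _; [apply: IH1 | apply: IH2].
- move=> H; apply: small_setr; last by case: hs.
  have: rg s l <= rg s l by [].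
  elim: {-2}(rg s l) => // n IHn hn; rewrite iteri_turn.
  apply: IH; last exact: H.
  by apply: small_setr; [apply/IHn/ltnW | apply/(leq_trans (ltnW hn)); case: hs].
Qed.

(** * Hoare triples that also bound the running time and the assigned values *)

Definition triple M c s T (Q : astate -> Prop) :=
  [/\ within M c s, cost c s <= T & Q (run c s)].

Lemma triple_weaken M c s T T' (Q Q' : astate -> Prop) :
  T <= T' -> (forall s', Q s' -> Q' s') ->
  triple M c s T Q -> triple M c s T' Q'.
Proof. by move=> hT hQ [? hc ?]; split; [|apply: leq_trans hT|apply: hQ]. Qed.

(* Besides [Q1], the second command may use that its start state is small and
   agrees with [s] outside the registers and arrays that [c1] assigns. *)
Lemma triple_seq M c1 c2 s T T1 T2 (Q1 Q : astate -> Prop) :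
  small M s -> T1 + T2 <= T -> triple M c1 s T1 Q1 ->
  (forall s', small M s' -> same_outside c1 s s' -> Q1 s' ->
     triple M c2 s' T2 Q) ->
  triple M (ASeq c1 c2) s T Q.
Proof.
move=> hs hT [w1 k1 q1] H.
have [w2 k2 q2] := H _ (small_run hs w1) (run_same_outside _ _) q1.
by split=> //=; apply: leq_trans hT; apply: leq_add.
Qed.

Lemma triple_if M e c1 c2 s T Q :
  (ev s e != 0 -> triple M c1 s T Q) -> (ev s e = 0 -> triple M c2 s T Q) ->
  triple M (AIf e c1 c2) s T.+1 Q.
Proof.
rewrite /triple /=; case: eqP => [he _ /(_ he)|he /(_ isT)] //.
Qed.

(** The invariant has to be insensitive to the loop register, because the loop resets it between two
    rounds. The cost [f i] may vary with the round, which is what gives linear time for nested loops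
    over rows. *)
Lemma triple_for M r l c s T (I : nat -> astate -> Prop) (f : nat -> nat)
    (Q : astate -> Prop) :
  small M s ->
  (\sum_(i < rg s l) (f i).+1).+1 <= T ->
  I 0 s ->
  (forall i s' v, I i s' -> I i (setr s' r v)) ->
  (forall i s', i < rg s l -> small M s' -> rg s' r = i ->
     same_outside (AFor r l c) s s' -> I i s' ->
     triple M c s' (f i) (I i.+1)) ->
  (forall s', same_outside (AFor r l c) s s' -> I (rg s l) s' -> Q s') ->
  triple M (AFor r l c) s T Q.
Proof.
move=> hs hT I0 Iset step IQ.
pose st i := iteri i (fun i s1 => run c (setr s1 r i)) s.
have H i : i <= rg s l ->
    [/\ small M (st i), same_outside (AFor r l c) s (st i), I i (st i) &
      forall j, j < i -> triple M c (turn r c j s) (f j) (I j.+1)].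
  elim: i => [_|i IH hi]; first by split.
  have [h1 [h2 h2'] h3 h4] := IH (ltnW hi).
  have hiM : i <= M by apply: leq_trans (ltnW hi) _; case: hs.
  have t1 : triple M c (turn r c i s) (f i) (I i.+1).
    apply: step => //; [exact: small_setr|by rewrite /= /upd eqxx| |exact: Iset].
    split=> x hx /=; last by rewrite h2'.
    by case/norP: (hx) => /negPf hx' _; rewrite /upd hx' h2.
  split.
  - by apply: small_run; [apply: small_setr|case: t1].
  - have [f1 f2] := run_same_outside c (turn r c i s).
    split=> x hx.
      by case/norP: (hx) => /negPf hx' hc; rewrite /st iteri_turn f1 //= /upd hx' h2.
    by rewrite /st iteri_turn f2 //= h2'.
  - by case: t1.
  - by move=> j; rewrite ltnS leq_eqVlt => /predU1P[->//|]; apply: h4.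
have [h1 h2 h3 h4] := H _ (leqnn _).
split=> /=.
- by move=> i /h4[].
- apply: leq_trans hT; rewrite ltnS; apply: leq_sum => i _.
  by rewrite ltnS; have [] := h4 i (ltn_ord i).
- by apply: IQ (Iset _ _ _ h3); apply: (run_same_outside (AFor r l c) s).
Qed.

Fixpoint flat_cost (c : acmd) : nat :=
  match c with
  | ASeq c1 c2 => flat_cost c1 + flat_cost c2
  | AIf _ c1 c2 => (flat_cost c1 + flat_cost c2).+1
  | _ => 1
  end.

Fixpoint loop_free (c : acmd) : bool :=
  match c with
  | ASeq c1 c2 | AIf _ c1 c2 => loop_free c1 && loop_free c2
  | AFor _ _ _ => false
  | _ => true
  end.

Lemma cost_flat c s : loop_free c -> cost c s <= flat_cost c.
Proof.
elim: c s => [|r e|j e1 e2|c1 IH1 c2 IH2|e c1 IH1 c2 IH2|r l c IH] s //=.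
- by move=> /andP[h1 h2]; apply: leq_add; [apply: IH1|apply: IH2].
- move=> /andP[h1 h2]; rewrite ltnS; case: ifP => _.
    by apply: leq_trans (IH1 _ h1) (leq_addr _ _).
  by apply: leq_trans (IH2 _ h2) (leq_addl _ _).
Qed.

Lemma triple_flat M c s T (Q : astate -> Prop) :
  loop_free c -> flat_cost c <= T -> within M c s -> Q (run c s) ->
  triple M c s T Q.
Proof. by move=> lf hT w q; split=> //; apply: leq_trans (cost_flat s lf) hT. Qed.

(* Concrete syntax, and the registers and arrays of the program *)
Declare Scope aexpr_scope.
Delimit Scope aexpr_scope with A.
Bind Scope aexpr_scope with aexpr.
Notation "# c" := (Cst c) (at level 1, format "# c") : aexpr_scope.
Notation "a + b" := (Op OpAdd a b) : aexpr_scope.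
Notation "a - b" := (Op OpSub a b) : aexpr_scope.
Notation "a * b" := (Op OpMul a b) : aexpr_scope.
Notation "a %/ b" := (Op OpDiv a b) : aexpr_scope.
Notation "a %% b" := (Op OpMod a b) : aexpr_scope.
Notation "a < b" := (Op OpLt a b) : aexpr_scope.
Notation "a == b" := (Op OpEq a b) : aexpr_scope.
Notation "a @[ e ]" := (Get a e) (at level 2, e at level 200, format "a @[ e ]") : aexpr_scope.
Coercion Rd : nat >-> aexpr.

Declare Scope acmd_scope.
Delimit Scope acmd_scope with C.
Bind Scope acmd_scope with acmd.
Notation "r <-- e" := (ASet r e%A) (at level 90) : acmd_scope.
Notation "a ~[ i ] <-- e" := (APut a i%A e%A) (at level 90, i at level 200) : acmd_scope.
Notation "c1 ;; c2" := (ASeq c1 c2) (at level 91, right associativity) : acmd_scope.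

Notation Rn := 0 (only parsing).
Notation Rm := 1 (only parsing).
Notation Rk := 2 (only parsing).
Notation Rh := 3 (only parsing).
Notation Rq := 4 (only parsing).
Notation Rt := 5 (only parsing).
Notation RN := 6 (only parsing).
Notation RK := 7 (only parsing).
Notation RD := 8 (only parsing).
Notation RP := 9 (only parsing).
Notation Rpw := 10 (only parsing).
Notation RL := 11 (only parsing).
Notation Ri := 12 (only parsing).
Notation Rj := 13 (only parsing).
Notation Rl := 14 (only parsing).
Notation Ra := 15 (only parsing).
Notation Rb := 16 (only parsing).
Notation Rc := 17 (only parsing).

Notation aIn := 0 (only parsing).
Notation aAdj := 1 (only parsing).
Notation aDeg := 2 (only parsing).
Notation aTy := 3 (only parsing).
Notation aSz := 4 (only parsing).
Notation aTadj := 5 (only parsing).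
Notation aPw := 6 (only parsing).
Notation aVal := 7 (only parsing).
Notation aDs := 8 (only parsing).
Notation aWt := 9 (only parsing).
Notation aT := 10 (only parsing).
Notation aTrieO := 11 (only parsing).
Notation aTrieC := 12 (only parsing).
Notation aLabO := 13 (only parsing).
Notation aLabC := 14 (only parsing).
Notation aIdO := 15 (only parsing).
Notation aIdC := 16 (only parsing).

Ltac simp := rewrite /= /upd /=.

(** * Adjacency rows *)

Lemma pair_index_inj q u k u' k' : k < q -> k' < q ->
  u * q + k = u' * q + k' -> u = u' /\ k = k'.
Proof.
move=> hk hk' e; have q0 : 0 < q by apply: leq_ltn_trans hk.
have : (u * q + k) %/ q = (u' * q + k') %/ q by rewrite e.
have : (u * q + k) %% q = (u' * q + k') %% q by rewrite e.
by rewrite !modnMDl !modn_small // !divnMDl // !divn_small // !addn0.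
Qed.

Section Rows.

Definition input_array (es : seq (nat * nat)) : nat -> nat :=
  nth 0 (flatten [seq [:: p.1; p.2] | p <- es]).

Lemma input_arrayE es i :
  (input_array es (2 * i) = (nth (0, 0) es i).1) *
  (input_array es (2 * i + 1) = (nth (0, 0) es i).2).
Proof.
rewrite /input_array; elim: es i => [|p es IH] [|i] //.
by rewrite mulnS -addnA /= !IH.
Qed.

Definition nbrs (u : nat) (p : nat * nat) : seq nat :=
  (if p.1 == u then [:: p.2] else [::]) ++ (if p.2 == u then [:: p.1] else [::]).

(** The vertex heads its own row, so the row lists the closed neighbourhood and its tail the open
    one. *)
Definition row (es : seq (nat * nat)) (u : nat) : seq nat :=
  u :: flatten [seq nbrs u p | p <- es].

Definition rows_ok q n (R : nat -> seq nat) s :=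
  forall u, u < n -> ar s aDeg u = size (R u) /\
    forall k, k < size (R u) -> ar s aAdj (u * q + k) = nth 0 (R u) k.

Definition push (x y : aexpr) : acmd :=
  (aAdj~[x * Rq + aDeg@[x]] <-- y ;; aDeg~[x] <-- aDeg@[x] + #1)%C.

Lemma push_rows x y q n R s u v :
  rg s Rq = q -> rg s x = u -> rg s y = v -> u < n ->
  size (R u) < q -> (forall w, w < n -> size (R w) <= q) -> rows_ok q n R s ->
  rows_ok q n (upd R u (rcons (R u) v)) (run (push x y) s).
Proof.
move=> hq hx hy hu hsz hR H w hw; simp; rewrite hx hy hq (H _ hu).1.
have [Hd Ha] := H _ hw; case: eqP => [->|nwu].
  rewrite size_rcons addn1; split=> // k hk; rewrite nth_rcons.
  rewrite eqn_add2l; case: ltngtP => [hk'|hk'|//].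
    by rewrite (H _ hu).2.
  by lia.
split=> // k hk; case: eqP => [e|_]; last exact: Ha.
by have [] := pair_index_inj (leq_trans hk (hR _ hw)) hsz e.
Qed.

Lemma eq_rows_ok q n R R' s : (forall u, u < n -> R u = R' u) ->
  rows_ok q n R s -> rows_ok q n R' s.
Proof. by move=> e H u hu; rewrite -e //; apply: H. Qed.

(** The stride [2 * m + 2] exceeds the length of every row: the vertex itself and at most two
    entries per edge. *)
Definition build_rows : acmd :=
  (Rq <-- #2 * Rm + #2 ;;
   AFor Ri Rn (aAdj~[Ri * Rq] <-- Ri ;; aDeg~[Ri] <-- #1) ;;
   AFor Ri Rm (Ra <-- aIn@[#2 * Ri] ;; Rb <-- aIn@[#2 * Ri + #1] ;;
               push Ra Rb ;; push Rb Ra))%C.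

Variables (M n m : nat) (es : seq (nat * nat)).
Hypothesis es_size : size es = m.
Hypothesis es_lt : forall p, p \in es -> p.1 < n /\ p.2 < n.
Hypothesis M_big : 2 * m + n + 2 <= M.

Lemma size_row u s : size (row s u) <= 2 * size s + 1.
Proof.
rewrite /row /= addn1 ltnS; elim: s => //= p s IH.
rewrite size_cat mulnS leq_add // /nbrs size_cat.
by do 2!case: ifP.
Qed.

Lemma row_take u i : i < m ->
  row (take i.+1 es) u = row (take i es) u ++ nbrs u (nth (0, 0) es i).
Proof.
move=> hi; rewrite /row (take_nth (0, 0)) ?es_size // map_rcons flatten_rcons.
by rewrite cat_cons.
Qed.

Lemma build_rows_spec s : small M s ->
  rg s Rn = n -> rg s Rm = m -> ar s aIn = input_array es ->
  triple M build_rows s (2 + 3 * n + 7 * m + 2)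
    (fun s' => rg s' Rq = 2 * m + 2 /\ rows_ok (2 * m + 2) n (row es) s').
Proof.
move=> sm hn hm hin.
apply: (@triple_seq _ _ _ _ _ 1 (1 + 3 * n + 7 * m + 2)
  (fun s' => rg s' Rq = 2 * m + 2)) => //; try lia.
  by apply: triple_flat => //; simp; rewrite hm; lia.
move=> s1 sm1 [fr1 fa1] hq1.
have {fr1}hr1 r : r != Rq -> rg s1 r = rg s r by move=> hr; apply: fr1.
apply: (@triple_seq _ _ _ _ _ (1 + 3 * n) (7 * m + 2)
  (fun s' => rows_ok (2 * m + 2) n (row [::]) s')) => //; try lia.
  apply: (@triple_for _ _ _ _ _ _
    (fun i s' => rows_ok (2 * m + 2) i (row [::]) s') (fun=> 2)) => //.
  - by rewrite sum_nat_const card_ord hr1 // hn; lia.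
  - move=> i s2; rewrite hr1 // hn => hi sm2 hi2 [fr2 _] H.
    have hq2 : rg s2 Rq = 2 * m + 2 by rewrite fr2.
    apply: triple_flat => //; simp; first by rewrite hi2; lia.
    rewrite hi2 hq2 => u; rewrite ltnS leq_eqVlt => /predU1P[->|hu] /=.
      simp; rewrite eqxx; split=> // -[|//] _; simp.
      by rewrite addn0 eqxx.
    have [Hd Ha] := H _ hu; simp.
    rewrite ltn_eqF //; split=> // k hk; case: eqP => [e|_]; last exact: Ha.
    rewrite -[RHS]addn0 in e; move/pair_index_inj: e => []; try lia.
  - by move=> s' _; rewrite hr1 // hn.
move=> s2 sm2 [fr2 fa2] H2.
apply: (@triple_for _ _ _ _ _ _
    (fun i s' => rows_ok (2 * m + 2) n (row (take i es)) s') (fun=> 6)) => //.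
- by rewrite sum_nat_const card_ord fr2 // hr1 // hm; lia.
- by rewrite take0.
- move=> i s3; rewrite fr2 // hr1 // hm => hi sm3 hi3 [fr3 fa3] H3.
  have hq3 : rg s3 Rq = 2 * m + 2 by rewrite fr3 // fr2.
  have hin3 : ar s3 aIn = input_array es by rewrite fa3 // fa2 // fa1.
  have [lt1 lt2] : (nth (0, 0) es i).1 < n /\ (nth (0, 0) es i).2 < n.
    by apply: es_lt; apply: mem_nth; rewrite es_size.
  have sz u : size (row (take i es) u) <= 2 * m.
    have := size_row u (take i es); rewrite size_take es_size hi; lia.
  have szlt u : u < n -> ar s3 aDeg u <= 2 * m.
    by move=> hu; rewrite (H3 _ hu).1 (leq_trans (sz _)).
  set s4 := run (Rb <-- aIn@[#2 * Ri + #1])%C (run (Ra <-- aIn@[#2 * Ri])%C s3).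
  have ra4 : rg s4 Ra = (nth (0, 0) es i).1.
    by rewrite /s4; simp; rewrite hin3 hi3 input_arrayE.
  have rb4 : rg s4 Rb = (nth (0, 0) es i).2.
    by rewrite /s4; simp; rewrite hin3 hi3 input_arrayE.
  have H4 : rows_ok (2 * m + 2) n (row (take i es)) s4 by [].
  set s5 := run (push Ra Rb) s4.
  have lt3 : size (row (take i es) (nth (0, 0) es i).1) < 2 * m + 2.
    by have := sz (nth (0, 0) es i).1; lia.
  have H5 := push_rows (hq3 : rg s4 Rq = _) ra4 rb4 lt1 lt3
    (fun w _ => leq_trans (sz w) (leq_addr _ _)) H4.
  set R5 := upd _ _ _ in H5.
  have sz5 u : size (R5 u) < 2 * m + 2.
    rewrite /R5 /upd; case: ifP => _; rewrite ?size_rcons; have := sz u; try lia.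
    by have := sz (nth (0, 0) es i).1; lia.
  have H6 := push_rows (hq3 : rg s5 Rq = _) rb4 ra4 lt2 (sz5 _)
    (fun w _ => ltnW (sz5 w)) H5.
  apply: triple_flat => //.
    have := szlt _ lt1; have := szlt _ lt2.
    by simp; rewrite hin3 hi3 !input_arrayE; repeat split; try lia; case: ifP; lia.
  apply: eq_rows_ok H6 => u hu; rewrite row_take // /R5 /upd /nbrs.
  case: (nth _ _ _) => x y /=; rewrite -!cats1 ![_ == u]eq_sym.
  case: (eqVneq u y) => [<-|ne]; case: (eqVneq u x) => [<-|ne'];
    by rewrite ?catA ?cats0.
- move=> s' [fr _]; rewrite fr2 // hr1 // hm take_oversize ?es_size //.
  by rewrite fr // fr2.
Qed.

End Rows.

(** * Linear-time comparison of neighbourhoods *)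

Section Trie.

(** A pair [(w, u)] in [es] records that [w] was appended to the word of [u]; this is the word spelt
    so far. *)
Definition history (es : seq (nat * nat)) (u : nat) : seq nat :=
  [seq e.1 | e <- es & e.2 == u].

(* Node [l] of the trie stands for the word [H l]; entry [l * n + w] of [ch] is
   the child of [l] along [w], with 0 for a missing child. *)
Definition trie_ok n es fresh (ch lab : nat -> nat) (H : nat -> seq nat) : Prop :=
  [/\ 0 < fresh /\ H 0 = [::],
      forall u, lab u < fresh /\ H (lab u) = history es u,
      forall l l', l < fresh -> l' < fresh -> H l = H l' -> l = l',
      forall l w, l < fresh -> w < n ->
        if ch (l * n + w) == 0 then forall l', l' < fresh -> H l' <> rcons (H l) w
        else ch (l * n + w) < fresh /\ H (ch (l * n + w)) = rcons (H l) w
    & (forall x, fresh * n <= x -> ch x = 0) /\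
      forall l x w, l < fresh -> H l = rcons x w -> exists2 l', l' < fresh & H l' = x].

Lemma history_rcons es w u v :
  history (rcons es (w, u)) v =
  if v == u then rcons (history es v) w else history es v.
Proof.
rewrite /history filter_rcons /= eq_sym; case: eqP => // _.
by rewrite map_rcons.
Qed.

Lemma trie_old n es fresh ch lab H w u :
  trie_ok n es fresh ch lab H -> w < n -> ch (lab u * n + w) != 0 ->
  trie_ok n (rcons es (w, u)) fresh ch (upd lab u (ch (lab u * n + w))) H.
Proof.
move=> [h1 h2 h3 h4 h5] hw hc; split=> // v; rewrite history_rcons /upd.
have [hl hH] := h2 u; have := h4 _ _ hl hw; rewrite (negPf hc) => -[c1 c2].
by case: (v =P u) => [->|_] //; split; rewrite // c2 hH.
Qed.

(** The word of the new node is new because [lab u] had no child along [w]. The new node is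
    correctly left without children by prefix closure: an older node for an extension of the new
    word would have required a node for the word itself. *)
Lemma trie_new n es fresh ch lab H w u :
  trie_ok n es fresh ch lab H -> w < n -> ch (lab u * n + w) = 0 ->
  trie_ok n (rcons es (w, u)) fresh.+1 (upd ch (lab u * n + w) fresh)
    (upd lab u fresh) (upd H fresh (rcons (H (lab u)) w)).
Proof.
move=> [[h0 h1] h2 h3 h4 [h5 h6]] hw hc.
have [hl hH] := h2 u; have := h4 _ _ hl hw; rewrite hc eqxx => hnew.
set H' := upd H _ _.
have Hlt l : l < fresh -> H' l = H l by move=> hl'; rewrite /H' /upd ltn_eqF.
have Hf : H' fresh = rcons (H (lab u)) w by rewrite /H' /upd eqxx.
move: H' Hlt Hf => H' Hlt Hf.
have lt_ix l v : l < fresh -> v < n -> l * n + v < fresh * n by nia.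
split.
- by rewrite Hlt.
- move=> v; rewrite history_rcons /upd; case: (v =P u) => [->|_].
    by rewrite Hf hH.
  by have [hv <-] := h2 v; rewrite Hlt // ltnS ltnW.
- move=> l l'; rewrite !ltnS (leq_eqVlt l) (leq_eqVlt l').
  case/predU1P=> [->|hl1]; case/predU1P=> [->|hl2] //; rewrite ?Hf ?Hlt //.
  + by move=> e; case: (hnew _ hl2).
  + by move=> e; case: (hnew _ hl1).
  + exact: h3.
- move=> l v; rewrite ltnS leq_eqVlt => /predU1P[->|hl1] hv;
    [rewrite Hf | rewrite (Hlt _ hl1)].
    have ne : (fresh * n + v == lab u * n + w) = false.
      by have := lt_ix _ _ hl hw; lia.
    rewrite {1}/upd ne h5 ?leq_addr // eqxx => l'.
    rewrite ltnS leq_eqVlt => /predU1P[->|hl2]; rewrite ?Hf ?Hlt //.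
      by move/(congr1 size); rewrite !size_rcons; lia.
    move=> e; have [l2 hl3 e3] := h6 _ _ _ hl2 e.
    exact: hnew hl3 e3.
  rewrite /upd; case: (_ =P lab u * n + w) => [e|ne].
    have [-> ->] := pair_index_inj hv hw e.
    by rewrite gtn_eqF // ltnSn Hf.
  have := h4 _ _ hl1 hv; case: ifP => _.
    move=> hno l'; rewrite ltnS leq_eqVlt => /predU1P[->|hl2]; rewrite ?Hf ?Hlt //.
      move=> /rcons_inj[e1 e2]; apply: ne.
      by rewrite e2 (h3 _ _ hl hl1 e1).
    exact: hno.
  by move=> [c1 c2]; rewrite ltnS ltnW // Hlt.
- split=> [x hx|l x v].
    rewrite /upd; case: eqP => [e|_]; last by apply: h5; lia.
    by have := lt_ix _ _ hl hw; lia.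
  rewrite ltnS leq_eqVlt => /predU1P[->|hl1]; rewrite ?Hf ?Hlt //.
    by move=> /rcons_inj[<- _]; exists (lab u); rewrite ?ltnS 1?ltnW ?Hlt.
  by move=> /(h6 _ _ _ hl1)[l' hl2 e]; exists l'; rewrite ?ltnS 1?ltnW ?Hlt.
Qed.

Lemma trie0 n ch lab : (forall x, ch x = 0) -> (forall x, lab x = 0) ->
  trie_ok n [::] 1 ch lab (fun=> [::]).
Proof.
move=> hc hl; split=> //; first by move=> u; rewrite hl.
- by move=> [|l] [|l'].
- by move=> l w _ _; rewrite hc eqxx => l' _; case: l'.
- by split=> // l [|? ?] w _.
Qed.

(** The offset [o] is 1 for open and 0 for closed neighbourhoods. Rows are read in increasing order
    of their vertex, so every word is a neighbourhood in sorted order although nothing is sorted,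
    and equal neighbourhoods end at the same node. *)
Definition refine (o tr la : nat) : acmd :=
  (Rc <-- #1 ;;
   AFor Ri Rn
    (Rb <-- aDeg@[Ri] - #o ;;
     AFor Rj Rb
      (Ra <-- aAdj@[Ri * Rq + (Rj + #o)] ;;
       AIf (tr@[la@[Ra] * Rn + Ri] == #0)%A
         (tr~[la@[Ra] * Rn + Ri] <-- Rc ;; Rc <-- Rc + #1)
         ANop ;;
       la~[Ra] <-- tr@[la@[Ra] * Rn + Ri])))%C.

Definition visits o (R : nat -> seq nat) w : seq (nat * nat) :=
  flatten [seq [seq (v, u) | u <- drop o (R v)] | v <- iota 0 w].

Lemma visitsS o R w :
  visits o R w.+1 = visits o R w ++ [seq (w, u) | u <- drop o (R w)].
Proof. by rewrite /visits -addn1 iotaD map_cat flatten_cat /= cats0. Qed.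

Lemma size_visits o R w : size (visits o R w) <= \sum_(v < w) size (R v).
Proof.
elim: w => [|w IH]; first by rewrite big_ord0.
rewrite visitsS size_cat big_ord_recr /= size_map size_drop.
by rewrite leq_add // leq_subr.
Qed.

Variables (M n q o tr la : nat) (R : nat -> seq nat).
Hypotheses (tr_la : tr != la) (tr_adj : tr != aAdj) (tr_deg : tr != aDeg).
Hypotheses (la_adj : la != aAdj) (la_deg : la != aDeg).
Hypothesis M_big : \sum_(v < n) size (R v) + n + 2 <= M.

Lemma refine_spec s : small M s -> rg s Rn = n -> rg s Rq = q ->
  rows_ok q n R s -> (forall x, ar s tr x = 0) -> (forall x, ar s la x = 0) ->
  triple M (refine o tr la) s (2 + \sum_(v < n) (3 + 7 * size (R v)))
    (fun s' => exists fresh H, trie_ok n (visits o R n) fresh (ar s' tr) (ar s' la) H).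
Proof.
move=> sm hn hq hR htr hla.
apply: (@triple_seq _ _ _ _ _ 1 (1 + \sum_(v < n) (3 + 7 * size (R v)))
  (fun s' => rg s' Rc = 1)) => //.
  by apply: triple_flat => //; simp; lia.
move=> s1 sm1 [fr1 fa1] hc1.
pose I es s' := rg s' Rc <= (size es).+1 /\
  exists H, trie_ok n es (rg s' Rc) (ar s' tr) (ar s' la) H.
apply: (@triple_for _ _ _ _ _ _ (fun i s' => I (visits o R i) s')
   (fun v => 2 + 7 * size (R v))) => //.
- by rewrite fr1 // hn.
- split; first by rewrite hc1.
  by exists (fun=> [::]); rewrite hc1; apply: trie0 => x; rewrite fa1.
- move=> w s2; rewrite fr1 // hn => hw sm2 hw2 [fr2 fa2] I2.
  have hd2 : ar s2 aDeg w = size (R w).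
    by rewrite fa2 ?fa1 //= ?(hR _ hw).1 // !(eq_sym aDeg) (negPf tr_deg) (negPf la_deg).
  apply: (@triple_seq _ _ _ _ _ 1 (1 + 7 * size (R w))
    (fun s' => rg s' Rb = size (R w) - o)) => //.
    apply: triple_flat => //; simp; rewrite hw2 hd2 //.
    by apply: leq_trans (leq_subr _ _) _; rewrite -hd2; case: sm2.
  move=> s3 sm3 [fr3 fa3] hb3.
  apply: (@triple_for _ _ _ _ _ _
    (fun k s' => I (visits o R w ++ take k [seq (w, u) | u <- drop o (R w)]) s')
    (fun=> 6)) => //.
  + by rewrite sum_nat_const card_ord hb3 add1n ltnS mulnC leq_mul2l leq_subr orbT.
  + by rewrite take0 cats0 /I fr3 // !fa3.
  + move=> k s4; rewrite hb3 => hk sm4 hk4 [fr4 fa4] [c4 [H I4]].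
    have hi4 : rg s4 Ri = w by rewrite fr4 // fr3.
    have hn4 : rg s4 Rn = n by rewrite fr4 // fr3 // fr2 // fr1.
    have hq4 : rg s4 Rq = q by rewrite fr4 // fr3 // fr2 // fr1.
    have ha4 : ar s4 aAdj (w * q + (k + o)) = nth 0 (R w) (k + o).
      rewrite fa4 ?fa3 ?fa2 ?fa1 /= ?(hR _ hw).2 //; first by lia.
        by rewrite !(eq_sym aAdj) (negPf tr_adj) (negPf la_adj).
      by rewrite !(eq_sym aAdj) (negPf tr_adj) (negPf la_adj).
    set u := nth 0 (R w) (k + o) in ha4.
    have tk : take k.+1 [seq (w, u) | u <- drop o (R w)] =
       rcons (take k [seq (w, u) | u <- drop o (R w)]) (w, u).
      rewrite (take_nth (0, 0)) ?size_map ?size_drop // (nth_map 0) ?size_drop //.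
      by rewrite nth_drop addnC.
    rewrite /I tk -rcons_cat.
    set es := _ ++ _ in c4 I4 *.
    (* Nodes are numbered by visits, so this bounds the fresh node number. *)
    have ses : size es <= \sum_(v < n) size (R v).
      apply: (@leq_trans (size (visits o R w.+1))).
        by rewrite visitsS !size_cat leq_add2l size_take_min geq_minr.
      apply: leq_trans (size_visits _ _ _) _.
      rewrite -!(big_mkord xpredT (fun v => size (R v))).
      by rewrite [X in _ <= X](big_cat_nat (n := w.+1)) //= leq_addr.
    have uM : u <= M by rewrite -ha4; case: sm4.
    have chM : ar s4 tr (ar s4 la u * n + w) <= M by case: sm4.
    have rewr := (hi4, hn4, hq4, hk4, ha4, (negPf tr_la), eqxx).
    case hch : (ar s4 tr (ar s4 la u * n + w) == 0).
      apply: triple_flat => //.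
        by do 3! (simp; rewrite ?rewr ?hch ?(eq_sym la) ?rewr); repeat split; lia.
      simp; rewrite ?rewr ?hch; simp; rewrite ?rewr ?(eq_sym la) ?rewr.
      split; first by rewrite size_rcons addn1.
      exists (upd H (rg s4 Rc) (rcons (H (ar s4 la u)) w)); rewrite addn1.
      by apply: trie_new => //; apply/eqP.
    apply: triple_flat => //.
      by simp; rewrite ?rewr ?hch ; simp; rewrite ?rewr; repeat split.
    simp; rewrite ?rewr ?hch; simp; rewrite ?rewr ?(eq_sym la) ?rewr.
    split; first by rewrite size_rcons leqW.
    by exists H; apply: trie_old; rewrite ?hch.
  + by move=> s4 _; rewrite hb3 take_oversize ?size_map ?size_drop // visitsS.
- by move=> s' _; rewrite fr1 // hn => -[_ [H IH]]; exists (rg s' Rc), H.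
Qed.

Lemma history_visits u w : history (visits o R w) u =
  flatten [seq nseq (count_mem u (drop o (R v))) v | v <- iota 0 w].
Proof.
elim: w => // w IH; rewrite visitsS /history filter_cat map_cat -/(history _ _) IH.
rewrite -[in RHS]addn1 iotaD map_cat flatten_cat /= cats0 add0n; congr (_ ++ _).
by elim: (drop o (R w)) => //= x r; rewrite -/(count_mem _ _); case: eqP => //= _ ->.
Qed.

(** Rows have no duplicates, so the history of [u] is the increasing list of the rows containing
    [u], and a label determines its word and conversely. *)
Lemma trie_labels ch lab H fresh :
  trie_ok n (visits o R n) fresh ch lab H ->
  (forall w, w < n -> uniq (drop o (R w))) ->
  forall u v, lab u = lab v <->
    forall w, w < n -> (u \in drop o (R w)) = (v \in drop o (R w)).
Proof.
move=> [_ hlab hinj _ _] hu u v.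
have hE x : history (visits o R n) x = [seq w <- iota 0 n | x \in drop o (R w)].
  rewrite history_visits; have: {subset iota 0 n <= gtn n}.
    by move=> w; rewrite mem_iota add0n.
  elim: (iota 0 n) => //= w r IH hr; rewrite IH; last by move=> y hy; apply: hr; rewrite inE hy orbT.
  rewrite count_uniq_mem; last by apply/hu/hr; rewrite inE eqxx.
  by case: ifP.
split=> [e w hw|e].
  have := (hlab v).2; rewrite -e (hlab u).2 !hE => /(congr1 (fun r => w \in r)).
  by rewrite !mem_filter mem_iota hw !andbT.
apply: hinj; rewrite ?(hlab _).1 // !(hlab _).2 !hE; apply: eq_in_filter => w.
by rewrite mem_iota => /e.
Qed.

End Trie.

(** * Twin classes *)

Section Classes.

Variables (n : nat) (lo lc : nat -> nat).

Definition same_label u v := (lc u == lc v) || (lo u == lo v).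

Hypothesis same_label_trans : forall u v w, u < n -> v < n -> w < n ->
  same_label u v -> same_label v w -> same_label u w.

(** [ido] and [idc] hold class numbers plus one, with 0 for a label not met so far. *)
Record classes_ok i t (ty ido idc sz : nat -> nat) : Prop := ClassesOk {
  classes_count : t <= i;
  classes_lt : forall u, u < i -> ty u < t;
  classes_eq : forall u v, u < i -> v < i -> (ty u == ty v) = same_label u v;
  classes_ids : forall u, u < i -> ido (lo u) = (ty u).+1 /\ idc (lc u) = (ty u).+1;
  classes_ido : forall l, ido l != 0 -> exists2 u, u < i & lo u = l;
  classes_idc : forall l, idc l != 0 -> exists2 u, u < i & lc u = l;
  classes_onto : forall j, j < t -> exists2 u, u < i & ty u = j;
  classes_size : forall j, sz j = \sum_(u < i) (ty u == j)
}.

Lemma same_label_sym u v : same_label u v = same_label v u.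
Proof. by rewrite /same_label eq_sym (eq_sym (lo _)). Qed.

Lemma same_label_refl u : same_label u u.
Proof. by rewrite /same_label eqxx. Qed.

(** A class found through one label must contain every earlier vertex sharing either label with [i].
    This rests on transitivity of [same_label], which a union of two equivalences need not have; it
    also makes overwriting both identifier tables with [x] consistent with the earlier vertices. *)
Lemma classes_step i t t' x ty ido idc sz : classes_ok i t ty ido idc sz -> i < n ->
  (x, t') = (if idc (lc i) != 0 then (idc (lc i), t)
             else if ido (lo i) != 0 then (ido (lo i), t) else (t.+1, t.+1)) ->
  [/\ classes_ok i.+1 t' (upd ty i (x - 1)) (upd ido (lo i) x) (upd idc (lc i) x)
       (upd sz (x - 1) (sz (x - 1) + 1)), t' <= t.+1, x <= t' & sz (x - 1) <= i].
Proof.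
move=> [c1 c2 c3 c4 c5 c6 c7 c8] hi ext.
have szi j : sz j <= i.
  rewrite c8 -[X in _ <= X]mul1n -[X in _ <= _ * X]card_ord mulnC -sum_nat_const.
  by apply: leq_sum => u _; apply: leq_b1.
have key : [/\ t <= t', t' <= t.+1, 0 < x, x <= t' &
   (forall u, u < i -> (ty u == x - 1) = same_label u i) /\
   (forall j, j < t' -> (exists2 u, u < i & ty u = j) \/ j = x - 1)].
  have old u0 : u0 < i -> same_label u0 i -> forall u, u < i -> (ty u == ty u0) = same_label u i.
    move=> h0 hs u hu; rewrite c3 //; apply/idP/idP => h.
      by apply: same_label_trans h hs => //; apply: ltn_trans hi.
    rewrite same_label_sym in hs.
    by apply: same_label_trans h hs => //; apply: ltn_trans hi.
  case: ifP ext => [h1 [-> ->]|/negbFE/eqP h1].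
    have [u0 h0 e0] := c6 _ h1; have [_ e] := c4 _ h0; rewrite -e0 e.
    split=> //; first exact: c2.
    rewrite subn1 /=; split=> [|j /c7]; last by left.
    by apply: old => //; rewrite /same_label e0 eqxx.
  case: ifP => [h2 [-> ->]|/negbFE/eqP h2 [-> ->]].
    have [u0 h0 e0] := c5 _ h2; have [e _] := c4 _ h0; rewrite -e0 e.
    split=> //; first exact: c2.
    rewrite subn1 /=; split=> [|j /c7]; last by left.
    by apply: old => //; rewrite /same_label e0 eqxx orbT.
  split=> //; rewrite subn1 /=; split=> [u hu|j]; last first.
    by rewrite ltnS leq_eqVlt => /predU1P[->|/c7]; [right|left].
  rewrite ltn_eqF ?c2 //; symmetry; apply/negbTE/negP => /orP[]/eqP e.
    by have [_] := c4 _ hu; rewrite e h1.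
  by have [] := c4 _ hu; rewrite e h2.
have [k1 k2 k3 k4 [k5 k6]] := key; split=> //.
have updi u : u < i -> upd ty i (x - 1) u = ty u by move=> hu; rewrite /upd ltn_eqF.
have updii : upd ty i (x - 1) i = x - 1 by rewrite /upd eqxx.
move: (upd ty i _) updi updii => ty' updi updii.
split.
- by apply: leq_trans k2 _.
- move=> u; rewrite ltnS leq_eqVlt => /predU1P[->|hu].
    by rewrite updii; lia.
  by rewrite updi //; apply: leq_trans (c2 _ hu) k1.
- move=> u v; rewrite !ltnS (leq_eqVlt u) (leq_eqVlt v).
  case/predU1P=> [->|hu]; case/predU1P=> [->|hv]; rewrite ?updii ?updi //.
  + by rewrite !eqxx same_label_refl.
  + by rewrite eq_sym k5 // same_label_sym.
  + exact: k5.
  + exact: c3.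
- move=> u; rewrite ltnS leq_eqVlt => /predU1P[->|hu].
    by rewrite updii /upd !eqxx; lia.
  rewrite updi // /upd; have [d1 d2] := c4 _ hu.
  split; case: eqP => // e; have := k5 _ hu; rewrite /same_label e eqxx ?orbT.
    by move/eqP->; lia.
  by move/eqP->; lia.
- move=> l; rewrite /upd; case: (l =P _) => [-> _|_ /c5[u hu <-]]; first by exists i.
  by exists u; rewrite // ltnW.
- move=> l; rewrite /upd; case: (l =P _) => [-> _|_ /c6[u hu <-]]; first by exists i.
  by exists u; rewrite // ltnW.
- move=> j /k6[[u hu <-]|->]; last by exists i.
  by exists u; rewrite ?updi // ltnW.
- move=> j; rewrite big_ord_recr /= updii /upd.
  under eq_bigr => u _ do rewrite updi //.
  rewrite -c8 eq_sym; case: eqP => [->|]; first by rewrite ?addn1.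
  by rewrite addn0.
Qed.

(* A vertex joins the class of an earlier vertex with the same closed, or else
   the same open, neighbourhood. *)
Definition classify : acmd :=
  (Rt <-- #0 ;;
   AFor Ri Rn
    (Ra <-- aIdC@[aLabC@[Ri]] ;; Rb <-- aIdO@[aLabO@[Ri]] ;;
     AIf Ra (Rc <-- Ra) (AIf Rb (Rc <-- Rb) (Rt <-- Rt + #1 ;; Rc <-- Rt)) ;;
     aIdC~[aLabC@[Ri]] <-- Rc ;; aIdO~[aLabO@[Ri]] <-- Rc ;;
     aTy~[Ri] <-- Rc - #1 ;; aSz~[Rc - #1] <-- aSz@[Rc - #1] + #1))%C.

Lemma classify_spec M s : small M s -> rg s Rn = n -> n + 1 <= M ->
  ar s aLabO = lo -> ar s aLabC = lc ->
  (forall x, ar s aIdO x = 0) -> (forall x, ar s aIdC x = 0) ->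
  (forall x, ar s aSz x = 0) ->
  triple M classify s (2 + 13 * n)
    (fun s' => exists ido idc, classes_ok n (rg s' Rt) (ar s' aTy) ido idc (ar s' aSz)).
Proof.
move=> sm hn Mn hlo hlc h0 h1 hsz.
apply: (@triple_seq _ _ _ _ _ 1 (1 + 13 * n) (fun s' => rg s' Rt = 0)) => //.
move=> s1 sm1 [fr1 fa1] ht1.
apply: (@triple_for _ _ _ _ _ _ (fun i s' => classes_ok i (rg s' Rt) (ar s' aTy)
   (ar s' aIdO) (ar s' aIdC) (ar s' aSz)) (fun=> 12)) => //.
- by rewrite sum_nat_const card_ord fr1 // hn; lia.
- rewrite ht1 !fa1 //; split=> //.
  + by move=> l; rewrite h0.
  + by move=> l; rewrite h1.
  + by move=> j; rewrite hsz big_ord0.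
- move=> i s2; rewrite fr1 // hn => hi sm2 hi2 [fr2 fa2] I2.
  have l0 : ar s2 aLabO = lo by rewrite fa2 // fa1.
  have l1 : ar s2 aLabC = lc by rewrite fa2 // fa1.
  rewrite /= in l0 l1.
  have B j x : ar s2 j x <= M by case: sm2.
  have := fun x t' => @classes_step i (rg s2 Rt) t' x _ _ _ _ I2 hi.
  have c1 := classes_count I2.
  case e1 : (ar s2 aIdC (lc i) == 0); rewrite /= in e1.
    case e2 : (ar s2 aIdO (lo i) == 0); rewrite /= in e2; rewrite /= ?e1 ?e2 /=.
      move=> /(_ _ _ erefl)[H1 H2 H3 H4].
      apply: triple_flat => //;
        do 5! (simp; rewrite ?hi2 ?l0 ?l1 ?e1 ?e2 //).
        by move: H4; rewrite ?addn1; repeat split; lia.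
      by rewrite (addn1 (rg s2 Rt)).
    move=> /(_ _ _ erefl)[H1 H2 H3 H4].
    apply: triple_flat => //;
        do 5! (simp; rewrite ?hi2 ?l0 ?l1 ?e1 ?e2 //).
    by repeat split => //; have := B 16 (lc i); have := B 15 (lo i); lia.
  rewrite /= => /(_ _ _ erefl)[H1 H2 H3 H4].
  apply: triple_flat => //;
      do 5! (simp; rewrite ?hi2 ?l0 ?l1 ?e1 ?e2 //).
  by repeat split => //; have := B 16 (lc i); have := B 15 (lo i); lia.
- by move=> s' _; rewrite fr1 // hn => H; exists (ar s' aIdO), (ar s' aIdC).
Qed.

End Classes.

(** * Adjacency between twin classes *)

Section TypeAdjacency.

Definition type_edge (ty : nat -> nat) (es : seq (nat * nat)) i j :=
  has (fun p => (ty p.1 == i) && (ty p.2 == j) || (ty p.2 == i) && (ty p.1 == j)) es.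

Definition link_types : acmd :=
  AFor Ri Rm
   (Ra <-- aTy@[aIn@[#2 * Ri]] ;; Rb <-- aTy@[aIn@[#2 * Ri + #1]] ;;
    aTadj~[Ra * Rn + Rb] <-- #1 ;; aTadj~[Rb * Rn + Ra] <-- #1)%C.

Lemma link_types_spec M n (es : seq (nat * nat)) s : small M s -> 1 <= M ->
  rg s Rn = n -> rg s Rm = size es -> ar s aIn = input_array es ->
  (forall p, p \in es -> ar s aTy p.1 < n /\ ar s aTy p.2 < n) ->
  (forall x, ar s aTadj x = 0) ->
  triple M link_types s (1 + 5 * size es)
    (fun s' => forall i j, i < n -> j < n ->
       ar s' aTadj (i * n + j) = type_edge (ar s aTy) es i j).
Proof.
move=> sm M1 hn hm hin hlt h0.
apply: (@triple_for _ _ _ _ _ _ (fun e s' => forall i j, i < n -> j < n ->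
       ar s' aTadj (i * n + j) = type_edge (ar s aTy) (take e es) i j) (fun=> 4)) => //.
- by rewrite sum_nat_const card_ord hm; lia.
- by move=> i j _ _; rewrite h0 take0.
- move=> e s1; rewrite hm => he sm1 he1 [fr fa] H.
  have hin1 : ar s1 aIn = input_array es by rewrite fa.
  have hn1 : rg s1 Rn = n by rewrite fr.
  have hty1 : ar s1 aTy = ar s aTy by rewrite fa.
  have [lt1 lt2] := hlt _ (mem_nth (0, 0) he).
  have B x : ar s aTy x <= M by case: sm.
  apply: triple_flat => //; simp;
    rewrite ?hin1 ?he1 ?hn1 ?hty1 ?input_arrayE //.
  move=> i j hi hj.
  rewrite (take_nth (0, 0)) // /type_edge has_rcons -/(type_edge _ _ _ _).
  rewrite H //; set x := ar s aTy _ in lt1 *; set y := ar s aTy _ in lt2 *.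
  have eqE a b : a < n -> b < n -> (i * n + j == a * n + b) = (a == i) && (b == j).
    move=> ha hb; apply/eqP/andP => [/(pair_index_inj hj hb)[-> ->]|[/eqP-> /eqP->]] //.
  rewrite !eqE //.
  by case: (x == i); case: (y == j); case: (y == i); case: (x == j); rewrite /= ?orbT ?orbF.
- by move=> s' _; rewrite hm take_size.
Qed.

End TypeAdjacency.

(** * Vectors as numbers in base D *)

Section Digits.

Variable D : nat.
Hypothesis D_gt1 : 1 < D.

Definition dig i c := (c %/ D ^ i) %% D.
Definition enc t (d : nat -> nat) := \sum_(i < t) d i * D ^ i.
Definition digsum t c := \sum_(i < t) dig i c.

Let D_gt0 : 0 < D. Proof. exact: ltnW. Qed.

Lemma dig_lt i c : dig i c < D. Proof. exact: ltn_pmod. Qed.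

Lemma dig0 c : dig 0 c = c %% D. Proof. by rewrite /dig expn0 divn1. Qed.

Lemma digS i c : dig i.+1 c = dig i (c %/ D).
Proof. by rewrite /dig expnS divnMA. Qed.

Lemma dig_big t c : c < D ^ t -> dig t c = 0.
Proof. by move=> hc; rewrite /dig divn_small // mod0n. Qed.

Lemma encS t d : enc t.+1 d = enc t d + d t * D ^ t.
Proof. by rewrite /enc big_ord_recr. Qed.

Lemma eq_enc t d d' : (forall i, i < t -> d i = d' i) -> enc t d = enc t d'.
Proof. by move=> e; apply: eq_bigr => i _; rewrite e. Qed.

Lemma encD t d d' : enc t (fun i => d i + d' i) = enc t d + enc t d'.
Proof. by rewrite /enc -big_split; apply: eq_bigr => i _ /=; rewrite mulnDl. Qed.

Lemma encM t k d : enc t (fun i => k * d i) = k * enc t d.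
Proof. by rewrite /enc big_distrr; apply: eq_bigr => i _ /=; rewrite mulnA. Qed.

Lemma enc_lt t d : (forall i, i < t -> d i < D) -> enc t d < D ^ t.
Proof.
elim: t => [|t IH] h; first by rewrite /enc big_ord0.
have := IH (fun i hi => h i (ltnW hi)); have := h t (ltnSn t).
rewrite encS expnS; nia.
Qed.

Lemma dig_high i t q r : i < t -> dig i (q * D ^ t + r) = dig i r.
Proof.
move=> hi; rewrite /dig.
have -> : q * D ^ t = q * D ^ (t - i.+1) * D * D ^ i.
  by rewrite -!mulnA -expnS -expnD subnK.
by rewrite divnMDl ?expn_gt0 ?D_gt0 // modnMDl.
Qed.

Lemma dig_enc t d i : (forall j, j < t -> d j < D) -> i < t -> dig i (enc t d) = d i.
Proof.
elim: t => // t IH h; rewrite ltnS leq_eqVlt encS addnC => /predU1P[->|hi].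
  have lt := enc_lt (fun i hi => h i (ltnW hi)).
  by rewrite /dig divnMDl ?expn_gt0 ?D_gt0 // divn_small // addn0 modn_small ?h.
by rewrite dig_high // IH // => j hj; apply/h/ltnW.
Qed.

Lemma enc_dig t c : c < D ^ t -> enc t (dig^~ c) = c.
Proof.
elim: t c => [|t IH] c hc; first by rewrite /enc big_ord0; case: c hc.
have Dt : 0 < D ^ t by rewrite expn_gt0 D_gt0.
rewrite encS {3}(divn_eq c (D ^ t)) addnC; congr (_ + _).
  by rewrite /dig modn_small // ltn_divLR // -expnS.
rewrite -[RHS]IH ?ltn_pmod //; apply: eq_enc => i hi.
by rewrite {1}(divn_eq c (D ^ t)) dig_high.
Qed.

(** There are no carries, so adding codes adds vectors. *)
Lemma dig_add t c a i : c < D ^ t -> a < D ^ t ->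
  (forall j, j < t -> dig j c + dig j a < D) ->
  c + a < D ^ t /\ (i < t -> dig i (c + a) = dig i c + dig i a).
Proof.
move=> hc ha h.
have -> : c + a = enc t (fun j => dig j c + dig j a) by rewrite encD !enc_dig.
by split; [apply: enc_lt | apply: dig_enc].
Qed.

(** Lets the digit sums be tabulated in increasing order of [c], with one table look-up each. *)
Lemma digsum_rec t c : c < D ^ t -> digsum t c = digsum t (c %/ D) + c %% D.
Proof.
rewrite /digsum => hc; have := dig_big hc; case: t hc => [|t] hc.
  by rewrite !big_ord0; case: c hc => // _ _; rewrite mod0n.
rewrite digS => h0; rewrite big_ord_recl dig0 addnC; congr (_ + _).
rewrite big_ord_recr /= h0 addn0.
by apply: eq_bigr => i _; rewrite /= -digS.
Qed.

Definition digits_lt K t c := [forall i : 'I_t, dig i c < K].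

Lemma digits_ltP K t c : reflect (forall i, i < t -> dig i c < K) (digits_lt K t c).
Proof.
apply: (iffP forallP) => [h i hi|h i]; last exact: h.
exact: (h (Ordinal hi)).
Qed.

Lemma digits_lt_rec K t c : 0 < K -> c < D ^ t ->
  digits_lt K t c = digits_lt K t (c %/ D) && (c %% D < K).
Proof.
move=> K0 hc; have h0 := dig_big hc; apply/digits_ltP/andP.
  move=> h; split; last first.
    case: t hc h {h0} => [|t] hc h; last by rewrite -dig0 h.
    by case: c hc h => // _ _; rewrite mod0n.
  apply/digits_ltP => i hi; rewrite -digS.
  by move: hi; rewrite leq_eqVlt => /predU1P[->|/h]; rewrite ?h0.
by move=> [/digits_ltP h1 h2] [|i] hi; rewrite ?dig0 // digS h1 // ltnW.
Qed.

Lemma dig_le_digsum t i c : i < t -> dig i c <= digsum t c.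
Proof. by move=> hi; rewrite /digsum (bigD1 (Ordinal hi)) //= leq_addr. Qed.

Lemma sum_mul_split (F : nat -> nat) m q :
  \sum_(c < q * m) F c = \sum_(i < q) \sum_(r < m) F (i * m + r).
Proof.
elim: q => [|q IH]; first by rewrite !big_ord0.
rewrite big_ord_recr /= -IH -!(big_mkord xpredT F) mulSn addnC.
rewrite (big_cat_nat (n := q * m)) ?leq_addr //=; congr (_ + _).
rewrite -{1}[q * m]add0n big_addn addKn big_mkord.
by apply: eq_bigr => r _; rewrite addnC.
Qed.

(** The hockey-stick identity, which gives the induction on the dimension when types are counted. *)
Lemma sum_bin_diag t h : \sum_(q < h.+1) 'C(q + t, t) = 'C(h + t.+1, t.+1).
Proof.
elim: h => [|h IH]; first by rewrite big_ord_recr big_ord0 /= !binn.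
by rewrite big_ord_recr IH /= [in RHS]addSn binS addnS.
Qed.

(* The block types are the vectors of sum at most [h]. *)
Lemma count_digsum t h : h < D ->
  \sum_(a < D ^ t) (digsum t a <= h) = 'C(h + t, t).
Proof.
elim: t h => [|t IH] h hD.
  by rewrite expn0 big_ord_recr big_ord0 /= /digsum big_ord0 bin0.
rewrite expnS (sum_mul_split (fun a => digsum t.+1 a <= h)) -sum_bin_diag.
have dsE i (r : 'I_(D ^ t)) : i < D -> digsum t.+1 (i * D ^ t + r) = digsum t r + i.
  move=> hi; rewrite /digsum big_ord_recr /=; congr (_ + _).
    by apply: eq_bigr => j _; rewrite dig_high.
  by rewrite /dig divnMDl ?expn_gt0 ?D_gt0 // divn_small // addn0 modn_small.
(* Types are sorted by their top digit [i]; the other digits then sum to at most [h - i]. *)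
transitivity (\sum_(i < D) (if i < h.+1 then 'C(h - i + t, t) else 0)).
  apply: eq_bigr => i _; under eq_bigr => r _ do rewrite dsE //.
  case: ifP => hi.
    rewrite -IH; last by apply: leq_ltn_trans hD; apply: leq_subr.
    by apply: eq_bigr => r _; congr nat_of_bool; lia.
  by apply: big1 => r _; apply/eqP; rewrite eqb0; lia.
rewrite -big_mkcond -(big_ord_widen _ (fun i => 'C(h - i + t, t)) hD).
rewrite (reindex_inj rev_ord_inj) /=; apply: eq_bigr => i _.
by congr 'C(_ + _, _); have := ltn_ord i; lia.
Qed.

End Digits.

(** * The dynamic program *)

Section Table.

Variables (D K h t : nat) (b wt : nat -> nat).
Hypothesis D_gt1 : 1 < D.
Hypothesis KD : 2 * K <= D.
Hypothesis hK : h < K.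

Definition is_type a := (a < D ^ t) && (digsum D t a <= h).

Lemma type_dig a i : is_type a -> i < t -> dig D i a <= h.
Proof.
by move=> /andP[_ ha] hi; apply: leq_trans ha; apply: dig_le_digsum.
Qed.

(* Some multiset of block types has total weight [v] and falls short of the
   demand, scaled down by [pw], by exactly the vector encoded by [c]. *)
Definition attains pw c v := exists l : seq nat,
  [/\ all is_type l,
      forall i, i < t -> \sum_(a <- l) dig D i a + dig D i c = b i %/ pw
    & \sum_(a <- l) wt a = v].

(* A table entry is 0 for an unreachable vector, and one more than the value
   otherwise. *)
Definition sound pw (T : nat -> nat) := forall c, c < D ^ t -> T c != 0 ->
  digits_lt D K t c /\ attains pw c (T c - 1).

Definition bits pw := enc D t (fun i => b i %/ pw %% 2).

Lemma div_double q pw : q %/ pw = 2 * (q %/ (2 * pw)) + q %/ pw %% 2.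
Proof. by rewrite {1}(divn_eq (q %/ pw) 2) -divnMA mulnC (mulnC pw). Qed.

Lemma dig_double pw c : c < D ^ t -> digits_lt D K t c ->
  2 * c + bits pw < D ^ t /\
  forall i, i < t -> dig D i (2 * c + bits pw) = 2 * dig D i c + b i %/ pw %% 2.
Proof.
move=> hc /digits_ltP hcK.
have -> : 2 * c + bits pw = enc D t (fun i => 2 * dig D i c + b i %/ pw %% 2).
  by rewrite encD encM enc_dig.
have lt i : i < t -> 2 * dig D i c + b i %/ pw %% 2 < D.
  by move=> hi; have := hcK _ hi; have := ltn_pmod (b i %/ pw) (isT : 0 < 2); lia.
by split; [apply: enc_lt | move=> i hi; apply: dig_enc].
Qed.

(** Every block is taken twice; the new low bits of the demand are not met by these copies and join
    the residue. *)
Lemma attains_double pw c v : c < D ^ t -> digits_lt D K t c ->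
  attains (2 * pw) c v -> attains pw (2 * c + bits pw) (2 * v).
Proof.
move=> hc hcK [l [l1 l2 l3]]; exists (l ++ l); split.
- by rewrite all_cat l1.
- move=> i hi; rewrite big_cat /= (dig_double pw hc hcK).2 // [RHS]div_double -l2 //.
  by rewrite addnn -mul2n mulnDr addnA.
- by rewrite big_cat /= l3 addnn mul2n.
Qed.

Lemma dig_shift c a : c < D ^ t -> digits_lt D K t c -> is_type a ->
  c + a < D ^ t /\ forall i, i < t -> dig D i (c + a) = dig D i c + dig D i a.
Proof.
move=> hc /digits_ltP hcK ha; have /andP[ha1 _] := ha.
have lt j : j < t -> dig D j c + dig D j a < D.
  by move=> hj; have := hcK _ hj; have := type_dig ha hj; lia.
split=> [|i]; first by have [] := @dig_add _ D_gt1 _ _ _ 0 hc ha1 lt.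
by have [] := @dig_add _ D_gt1 _ _ _ i hc ha1 lt.
Qed.

Lemma attains_shift pw c a v : c < D ^ t -> digits_lt D K t c -> is_type a ->
  attains pw (c + a) v -> attains pw c (v + wt a).
Proof.
move=> hc hcK ha [l [l1 l2 l3]]; exists (a :: l); split.
- by rewrite /= ha.
- by move=> i hi; rewrite big_cons -l2 // (dig_shift hc hcK ha).2 //; lia.
- by rewrite big_cons l3 addnC.
Qed.

(** A realised multiset stays within the demand, whose coordinates sum to at most [n]. This is what
    keeps table entries within a word. *)
Lemma attains_le pw c v n : (forall a, is_type a -> wt a <= h * digsum D t a) ->
  \sum_(i < t) b i <= n -> attains pw c v -> v <= h * n.
Proof.
move=> hw hn [l [l1 l2 <-]].
apply: (@leq_trans (h * \sum_(a <- l) digsum D t a)).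
  rewrite big_distrr /= !big_seq; apply: leq_sum => a hal; apply: hw.
  exact: (allP l1).
rewrite leq_mul2l; apply/orP; right; apply: leq_trans hn.
rewrite exchange_big /=; apply: leq_sum => i _.
by apply: leq_trans (leq_div _ pw); rewrite -l2 // leq_addr.
Qed.

Definition demand (y : nat -> nat) i := \sum_(a < D ^ t | is_type a) y a * dig D i a.
Definition worth (y : nat -> nat) := \sum_(a < D ^ t | is_type a) y a * wt a.
Definition residue pw y i := b i %/ pw - demand y i.

(** The inequality is strict because of the shift by one in table entries: the entry is nonzero and
    its value is at least the worth of [y]. *)
Definition covers pw (T : nat -> nat) y := worth y < T (enc D t (residue pw y)).

Lemma demand_double y i : demand (fun a => 2 * y a) i = 2 * demand y i.
Proof. by rewrite /demand big_distrr; apply: eq_bigr => a _; rewrite /= mulnA. Qed.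

Lemma worth_double y : worth (fun a => 2 * y a) = 2 * worth y.
Proof. by rewrite /worth big_distrr; apply: eq_bigr => a _; rewrite /= mulnA. Qed.

Lemma demand_add1 y a0 i : is_type a0 ->
  demand (upd y a0 (y a0).+1) i = demand y i + dig D i a0.
Proof.
move=> h0; have /andP[h1 _] := h0.
rewrite /demand !(bigD1 (Ordinal h1) h0) /= {1}/upd eqxx mulSn -addnA addnC.
congr (_ + _); congr (_ + _); apply: eq_bigr => a /andP[_].
by rewrite -val_eqE /= /upd => /negPf->.
Qed.

Lemma worth_add1 y a0 : is_type a0 -> worth (upd y a0 (y a0).+1) = worth y + wt a0.
Proof.
move=> h0; have /andP[h1 _] := h0.
rewrite /worth !(bigD1 (Ordinal h1) h0) /= {1}/upd eqxx mulSn -addnA addnC.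
congr (_ + _); congr (_ + _); apply: eq_bigr => a /andP[_].
by rewrite -val_eqE /= /upd => /negPf->.
Qed.

Lemma eq_covers pw T y y' : (forall a, is_type a -> y a = y' a) ->
  covers pw T y -> covers pw T y'.
Proof.
move=> e; rewrite /covers.
have -> : worth y = worth y' by apply: eq_bigr => a ha; rewrite e.
congr (_ < T _); apply: eq_enc => i hi; congr (_ - _).
by apply: eq_bigr => a ha; rewrite e.
Qed.

Variable x : nat -> nat.
Hypothesis x_demand : forall i, i < t -> demand x i = b i.
Hypothesis K_big : 2 * (h * \sum_(a < D ^ t) (digsum D t a <= h)) + 2 <= K.

Lemma demand_le y y' i : (forall a, y a <= y' a) -> demand y i <= demand y' i.
Proof. by move=> hy; apply: leq_sum => a _; rewrite leq_mul2r hy orbT. Qed.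

(** Rounding drops fewer than [pw] blocks of each type, and a block has at most [h] vertices in one
    class. Hence less than [pw * h] per type is lost before division by [pw]. *)
Lemma demand_div pw i : 0 < pw -> i < t ->
  demand (fun a => x a %/ pw) i <= b i %/ pw <=
  demand (fun a => x a %/ pw) i + h * \sum_(a < D ^ t) (digsum D t a <= h).
Proof.
move=> pw0 hi; rewrite -x_demand //.
have e : demand x i = demand (fun a => x a %/ pw) i * pw + demand (fun a => x a %% pw) i.
  rewrite /demand big_distrl -big_split; apply: eq_bigr => a _ /=.
  by rewrite {1}(divn_eq (x a) pw) mulnDl mulnAC.
rewrite e divnMDl // leq_addr leq_add2l /=.
apply: (@leq_trans (pw * (h * \sum_(a < D ^ t) (digsum D t a <= h)) %/ pw)); last first.
  by rewrite mulKn.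
apply: leq_div2r.
rewrite !big_distrr /= /demand big_mkcond /=; apply: leq_sum => a _.
rewrite /is_type ltn_ord /=; case: ifP => // ha; rewrite ?muln1.
apply: leq_mul; first by rewrite ltnW ?ltn_pmod.
by apply: leq_trans ha; apply: dig_le_digsum.
Qed.

(* The partial solution after doubling at scale [pw], when the new lowest bit has
   been decided for the types below [a0]. *)
Definition stage pw a0 a := if a < a0 then x a %/ pw else 2 * (x a %/ (2 * pw)).

(** A stage lies between the doubled old truncation and the new one. Its residue is therefore at
    most twice the residue at scale [2 * pw] plus a bit, that is at most [2 * N * h + 1] for [N]
    types, which is below [K]. *)
Lemma stage_residue pw a0 i : 0 < pw -> i < t ->
  demand (stage pw a0) i <= b i %/ pw /\ residue pw (stage pw a0) i < K.
Proof.
move=> pw0 hi.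
have hlo : demand (fun a => 2 * (x a %/ (2 * pw))) i <= demand (stage pw a0) i.
  apply: demand_le => a; rewrite /stage; case: ifP => // _.
  by rewrite [X in _ <= X]div_double leq_addr.
have hup : demand (stage pw a0) i <= demand (fun a => x a %/ pw) i.
  apply: demand_le => a; rewrite /stage; case: ifP => // _.
  by rewrite [X in _ <= X]div_double leq_addr.
have /andP[h1 h2] := demand_div pw0 hi.
have pw2 : 0 < 2 * pw by lia.
have /andP[h3 h4] := demand_div pw2 hi.
split; first exact: leq_trans h1.
rewrite /residue; rewrite demand_double in hlo.
have := div_double (b i) pw; have := ltn_pmod (b i %/ pw) (isT : 0 < 2); lia.
Qed.

Lemma stage_last pw a : a < D ^ t -> stage pw (D ^ t) a = x a %/ pw.
Proof. by rewrite /stage => ->. Qed.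

Lemma stageS pw a a' :
  stage pw a.+1 a' = if a' == a then x a %/ pw else stage pw a a'.
Proof. by rewrite /stage ltnS (leq_eqVlt a'); case: (a' =P a) => [->|]. Qed.

Lemma stage_self pw a : stage pw a a = 2 * (x a %/ (2 * pw)).
Proof. by rewrite /stage ltnn. Qed.

(** A value [v] is stored as [v + 1], so doubling the value turns an entry [e] into [2 * e - 1]. The
    residue doubles and takes in the new bits of the demand, without carries. *)
Lemma covers_double pw T T' : 0 < pw ->
  (forall c, c < D ^ t -> digits_lt D K t c -> T c != 0 ->
     digits_lt D K t (2 * c + bits pw) -> T' (2 * c + bits pw) = 2 * T c - 1) ->
  covers (2 * pw) T (fun a => x a %/ (2 * pw)) -> covers pw T' (stage pw 0).
Proof.
move=> pw0 hT; rewrite /covers => hc.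
have pw2 : 0 < 2 * pw by lia.
set r := residue (2 * pw) _ in hc *.
have r1 i : i < t -> r i < K.
  by move=> hi; rewrite /r /residue; have := demand_div pw2 hi; lia.
have r2 i : i < t -> residue pw (stage pw 0) i = 2 * r i + b i %/ pw %% 2.
  move=> hi; rewrite /r /residue.
  have -> : demand (stage pw 0) i = 2 * demand (fun a => x a %/ (2 * pw)) i.
    by rewrite -demand_double.
  by have /andP[h1 _] := demand_div pw2 hi; rewrite (div_double (b i) pw); lia.
have rD i : i < t -> r i < D by move/r1; lia.
have e : enc D t (residue pw (stage pw 0)) = 2 * enc D t r + bits pw.
  by rewrite (eq_enc _ r2) encD encM.
have clt := enc_lt D_gt1 rD.
have cK : digits_lt D K t (enc D t r) by apply/digits_ltP => i hi; rewrite dig_enc ?r1.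
rewrite e hT //; first 1 last.
- by rewrite -lt0n; apply: leq_ltn_trans hc.
- apply/digits_ltP => i hi; rewrite -e dig_enc //; first exact: (stage_residue 0 pw0 hi).2.
  by move=> j hj; have := (stage_residue 0 pw0 hj).2; lia.
have -> : worth (stage pw 0) = 2 * worth (fun a => x a %/ (2 * pw)) by rewrite -worth_double.
by lia.
Qed.

(** If the bit of [x a] at this scale is 0, the stage does not change and entries only grow. If it
    is 1, one more block of type [a] moves the residue from [c + a] to [c], which is exactly the
    relaxation step. *)
Lemma covers_relax pw T T' a : 0 < pw -> is_type a ->
  (forall c, T c <= T' c) ->
  (forall c, c < D ^ t -> digits_lt D K t c -> T (c + a) != 0 ->
     T (c + a) + wt a <= T' c) ->
  covers pw T (stage pw a) -> covers pw T' (stage pw a.+1).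
Proof.
move=> pw0 ha hle hrel hc.
have := ltn_pmod (x a %/ pw) (isT : 0 < 2).
case e : (x a %/ pw %% 2) => [|[|//]] _.
  have := leq_trans hc (hle _); apply: eq_covers => a' _.
  rewrite stageS; case: (a' =P a) => [->|] //=.
  by rewrite stage_self (div_double (x a) pw) e addn0.
have st a' : upd (stage pw a) a (stage pw a a).+1 a' = stage pw a.+1 a'.
  rewrite /upd stageS; case: (a' =P a) => [_|] //=.
  by rewrite stage_self (div_double (x a) pw) e addn1.
apply: (eq_covers (fun a' _ => st a')).
have dem i : demand (stage pw a.+1) i = demand (stage pw a) i + dig D i a.
  by rewrite -demand_add1 //; apply: eq_bigr => a' _; rewrite st.
have rE i : i < t -> residue pw (stage pw a) i = residue pw (stage pw a.+1) i + dig D i a.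
  by move=> hi; have [] := stage_residue a.+1 pw0 hi; rewrite /residue dem; lia.
rewrite /covers worth_add1 //.
have -> : enc D t (residue pw (upd (stage pw a) a (stage pw a a).+1)) =
          enc D t (residue pw (stage pw a.+1)).
  by apply: eq_enc => i hi; rewrite /residue demand_add1 // dem.
set c := enc D t _.
have lt i : i < t -> residue pw (stage pw a.+1) i < D.
  by move=> hi; have := (stage_residue a.+1 pw0 hi).2; lia.
have /andP[ha1 _] := ha.
have ce : enc D t (residue pw (stage pw a)) = c + a.
  by rewrite (eq_enc _ rE) encD enc_dig.
have cK : digits_lt D K t c.
  apply/digits_ltP => i hi; rewrite dig_enc //; exact: (stage_residue a.+1 pw0 hi).2.
rewrite /covers ce in hc.
have := hrel _ (enc_lt D_gt1 lt) cK.
by rewrite -/c -lt0n (leq_ltn_trans _ hc) // => /(_ isT); lia.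
Qed.

Lemma covers_skip pw T a : ~~ is_type a ->
  covers pw T (stage pw a) -> covers pw T (stage pw a.+1).
Proof.
move=> ha; apply: eq_covers => a' ha'.
rewrite stageS; case: (a' =P a) => [e|] //=.
by move: ha; rewrite -e ha'.
Qed.

End Table.

(** * Tables filled before the dynamic program: radix, digits, weights and the top scale *)

Section Solver.

Definition binomial_loop : acmd :=
  (RN <-- #1 ;; AFor Ri Rt (RN <-- RN * (Rh + Ri + #1) %/ (Ri + #1)))%C.

Definition radix_setup : acmd :=
  (RK <-- #2 * (RN * Rh) + #2 ;; RD <-- #2 * RK ;; RP <-- #1 ;;
   AFor Ri Rt (aPw~[Ri] <-- RP ;; RP <-- RP * RD))%C.

(** Entry 0 of [aVal] is preset, since in round 0 the recurrence reads the entry it is about to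
    write. *)
Definition digit_tables : acmd :=
  (aVal~[#0] <-- #1 ;;
   AFor Rj RP (aVal~[Rj] <-- aVal@[Rj %/ RD] * (Rj %% RD < RK) ;;
               aDs~[Rj] <-- aDs@[Rj %/ RD] + Rj %% RD))%C.

Definition weight_table : acmd :=
  (AFor Rj RP
    (AIf (aDs@[Rj] < Rh + #1)%A
      (Ra <-- #0 ;;
       AFor Ri Rt
        (AFor Rl Rt
          (Ra <-- Ra + aTadj@[Ri * Rn + Rl] *
            (Rj %/ aPw@[Ri] %% RD * (Rj %/ aPw@[Rl] %% RD - (Ri == Rl))))) ;;
       aWt~[Rj] <-- Ra)
      ANop))%C.

(** Finds the least power of two above [n]. As every loop is bounded, it runs for [n] rounds, which
    is enough because [n < 2 ^ n]. *)
Definition scale_loop : acmd :=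
  (Rpw <-- #1 ;; RL <-- #0 ;;
   AFor Ri Rn (AIf (Rpw < Rn + #1)%A (Rpw <-- #2 * Rpw ;; RL <-- RL + #1) ANop))%C.

Variables (M n t h : nat).

Lemma binomial_loop_spec s : small M s -> rg s Rt = t -> rg s Rh = h ->
  (forall i, i <= t -> 'C(h + i, i) <= M) ->
  triple M binomial_loop s (2 + 2 * t) (fun s' => rg s' RN = 'C(h + t, t)).
Proof.
move=> sm ht hh hM.
apply: (@triple_seq _ _ _ _ _ 1 (1 + 2 * t) (fun s' => rg s' RN = 1)) => //.
  by apply: triple_flat => //; simp; have := hM 0 isT; rewrite bin0.
move=> s1 sm1 [fr1 fa1] h1.
apply: (@triple_for _ _ _ _ _ _ (fun i s' => rg s' RN = 'C(h + i, i)) (fun=> 1)) => //.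
- by rewrite sum_nat_const card_ord fr1 // ht; lia.
- by rewrite h1 bin0.
- move=> i s2; rewrite fr1 // ht => hi sm2 hi2 [fr2 fa2] H.
  (* The division is exact: [(i + 1) * 'C(h + i + 1, i + 1)] equals [(h + i + 1) * 'C(h + i, i)]. *)
  have e : 'C(h + i, i) * (h + i + 1) %/ (i + 1) = 'C(h + i.+1, i.+1).
    by rewrite !addn1 addnS mulnC (mul_bin_diag (h + i).+1) mulKn.
  by apply: triple_flat => //; simp; rewrite ?hi2 H ?fr2 ?fr1 // hh e // hM.
- by move=> s' _; rewrite fr1 // ht.
Qed.

Lemma scale_loop_spec s : small M s -> rg s Rn = n -> 2 * n + 1 <= M ->
  triple M scale_loop s (3 + 4 * n)
    (fun s' => exists2 L, [/\ rg s' Rpw = 2 ^ L, rg s' RL = L & n < 2 ^ L] &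
        L <= n /\ (0 < L -> 2 ^ L.-1 <= n)).
Proof.
move=> sm hn hM.
apply: (@triple_seq _ _ _ _ _ 1 (2 + 4 * n) (fun s' => rg s' Rpw = 1)) => //.
  by apply: triple_flat => //; simp; lia.
move=> s1 sm1 [fr1 fa1] h1.
apply: (@triple_seq _ _ _ _ _ 1 (1 + 4 * n) (fun s' => rg s' RL = 0)) => //.
move=> s2 sm2 [fr2 fa2] h2.
have hn2 : rg s2 Rn = n by rewrite fr2 // fr1.
apply: (@triple_for _ _ _ _ _ _ (fun i s' => exists2 L,
   [/\ rg s' Rpw = 2 ^ L, rg s' RL = L & (n < 2 ^ L) || (L == i)] &
        L <= i /\ (0 < L -> 2 ^ L.-1 <= n)) (fun=> 3)) => //.
- by rewrite sum_nat_const card_ord hn2; lia.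
- by exists 0 => //; rewrite fr2 // h1 h2 orbT.
- move=> i s3; rewrite hn2 => hi sm3 hi3 [fr3 fa3] [L [H1 H2 H3] [H4 H5]].
  apply: triple_if; rewrite /= H1 fr3 // hn2 addn1 ltnS => hL.
    have hL' : 2 ^ L <= n by move: hL; case: leq.
    apply: triple_flat => //; simp; rewrite H1 ?H2 -?expnS.
      by rewrite expnS; split; lia.
    exists L.+1; last by split.
    by split=> //; rewrite ?addn1 //; move: H3; rewrite ltnNge hL' /= eqSS => ->; rewrite orbT.
  have {}hL : n < 2 ^ L by rewrite ltnNge; move: hL; case: leq.
  by apply: triple_flat => //; exists L; rewrite ?hL // leqW.
- move=> s' _; rewrite hn2 => -[L [H1 H2 H3] H4]; exists L => //; split=> //.
  by case/orP: H3 => // /eqP->; apply: ltn_expl.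
Qed.

Variable N : nat.
(** Residues reach at most [2 * N * h + 1] within a level, which is [K - 1]. The radix is twice [K]
    so that neither doubling a vector and adding bits nor adding a type causes a carry. *)
Let K := 2 * (N * h) + 2.
Let D := 2 * K.
Let P := D ^ t.

Lemma D_gt1 : 1 < D. Proof. by rewrite /D /K; lia. Qed.

Lemma radix_setup_spec s : small M s -> rg s Rt = t -> rg s Rh = h -> rg s RN = N ->
  D <= M -> P <= M ->
  triple M radix_setup s (4 + 3 * t)
    (fun s' => [/\ rg s' RK = K, rg s' RD = D, rg s' RP = P &
                 forall i, i < t -> ar s' aPw i = D ^ i]).
Proof.
move=> sm ht hh hN hD hP.
have D1 := D_gt1.
apply: (@triple_seq _ _ _ _ _ 1 (3 + 3 * t) (fun s' => rg s' RK = K)) => //.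
  by apply: triple_flat => //; simp; rewrite hN hh // -/K; rewrite /D in hD; lia.
move=> s1 sm1 [fr1 fa1] h1.
apply: (@triple_seq _ _ _ _ _ 1 (2 + 3 * t) (fun s' => rg s' RD = D)) => //.
  by apply: triple_flat => //; simp; rewrite h1.
move=> s2 sm2 [fr2 fa2] h2.
apply: (@triple_seq _ _ _ _ _ 1 (1 + 3 * t) (fun s' => rg s' RP = 1)) => //.
  by apply: triple_flat => //; simp; lia.
move=> s3 sm3 [fr3 fa3] h3.
have ht3 : rg s3 Rt = t by rewrite fr3 // fr2 // fr1.
have hD3 : rg s3 RD = D by rewrite fr3.
apply: (@triple_for _ _ _ _ _ _ (fun i s' => rg s' RP = D ^ i /\
   forall j, j < i -> ar s' aPw j = D ^ j) (fun=> 2)) => //.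
- by rewrite sum_nat_const card_ord ht3; lia.
- move=> i s4; rewrite ht3 => hi sm4 hi4 [fr4 fa4] [H1 H2].
  have le : D ^ i.+1 <= M by apply: leq_trans hP; rewrite leq_pexp2l //; lia.
  have le' : D ^ i <= M by apply: leq_trans le; rewrite leq_pexp2l //; lia.
  apply: triple_flat => //; simp; rewrite ?hi4 H1 fr4 // hD3 -expnSr //.
  split=> // j; rewrite ltnS (leq_eqVlt j).
  by case: (j =P i) => [->|_] //= /H2.
- move=> s' [fr _]; rewrite ht3 => -[H1 H2]; split=> //.
    by rewrite fr // fr3 // fr2.
  by rewrite fr.
Qed.

Lemma digit_tables_spec s : small M s -> rg s RK = K -> rg s RD = D -> rg s RP = P ->
  (forall x, ar s aVal x = 0) -> (forall x, ar s aDs x = 0) -> 1 <= M -> t * D <= M ->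
  triple M digit_tables s (2 + 3 * P)
    (fun s' => forall c, c < P ->
       ar s' aVal c = digits_lt D K t c /\ ar s' aDs c = digsum D t c).
Proof.
move=> sm hK hD hP hv hd M1 tD.
have D1 := D_gt1.
apply: (@triple_seq _ _ _ _ _ 1 (1 + 3 * P) (fun s' => ar s' aVal 0 = 1)) => //.
move=> s1 sm1 [fr1 fa1] h1.
have hP1 : rg s1 RP = P by rewrite fr1.
apply: (@triple_for _ _ _ _ _ _ (fun c0 s' =>
   ((c0 = 0) -> ar s' aVal 0 = 1 /\ ar s' aDs 0 = 0) /\
   forall c, c < c0 -> ar s' aVal c = digits_lt D K t c /\ ar s' aDs c = digsum D t c)
   (fun=> 2)) => //.
- by rewrite sum_nat_const card_ord hP1; lia.
- by split=> // _; rewrite h1 fa1.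
- move=> c s2; rewrite hP1 => hc sm2 hc2 [fr2 fa2] [H0 H].
  have hK2 : rg s2 RK = K by rewrite fr2 // fr1.
  have hD2 : rg s2 RD = D by rewrite fr2 // fr1.
  have K0 : 0 < K by rewrite /K; lia.
  have valE : ar s2 aVal (c %/ D) * (c %% D < K) = digits_lt D K t c.
    have rec := digits_lt_rec K0 hc; case: (posnP c) => [c0|c0].
      have v1 := (H0 c0).1; rewrite c0 in rec * => {H0 H hc c0 hc2}.
      rewrite div0n mod0n v1 K0; suff -> : digits_lt D K t 0 by [].
      by apply/digits_ltP => // i _; rewrite /dig div0n mod0n.
    by rewrite (H _ (ltn_Pdiv D1 c0)).1 rec mulnb.
  have dsE : ar s2 aDs (c %/ D) + c %% D = digsum D t c.
    have rec := digsum_rec hc; case: (posnP c) => [c0|c0].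
      rewrite rec c0 div0n mod0n !addn0 (H0 c0).2.
      by symmetry; apply: big1 => i _; rewrite /dig div0n mod0n.
    by rewrite (H _ (ltn_Pdiv D1 c0)).2 rec.
  have dsM : digsum D t c <= M.
    apply: leq_trans tD; rewrite -[t in t * _]card_ord -sum_nat_const.
    by apply: leq_sum => i _; apply/ltnW/dig_lt.
  apply: triple_flat => //; simp; rewrite ?hc2 ?hD2 ?hK2 valE dsE.
    by split=> //; case: digits_lt.
  split=> // c'; rewrite ltnS (leq_eqVlt c').
  by case: (c' =P c) => [->|_] //= /H.
- by move=> s' _; rewrite hP1 => -[].
Qed.

Section Weights.

Variable adj : nat -> nat.

Definition weight c := \sum_(i < t) \sum_(l < t)
  adj (i * n + l) * (dig D i c * (dig D l c - (i == l))).

Hypothesis adj_le1 : forall i l, i < t -> l < t -> adj (i * n + l) <= 1.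

Lemma weight_le_digsum c : weight c <= digsum D t c * digsum D t c.
Proof.
rewrite /weight {1}/digsum big_distrl; apply: leq_sum => i _ /=.
rewrite big_distrr; apply: leq_sum => l _ /=.
rewrite -[X in _ <= X]mul1n; apply: leq_mul; first exact: adj_le1.
by rewrite leq_mul2l leq_subr orbT.
Qed.

Lemma weight_table_spec s : small M s ->
  rg s Rn = n -> rg s Rt = t -> rg s Rh = h -> rg s RD = D -> rg s RP = P ->
  ar s aTadj = adj ->
  (forall i, i < t -> ar s aPw i = D ^ i) ->
  (forall c, c < P -> ar s aDs c = digsum D t c) ->
  t * t * (D * D) <= M ->
  triple M weight_table s (1 + (2 * t * t + 2 * t + 5) * P)
    (fun s' => forall c, c < P -> digsum D t c <= h -> ar s' aWt c = weight c).
Proof.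
move=> sm hn ht hh hD hP ha hpw hds hM.
have D1 := D_gt1.
apply: (@triple_for _ _ _ _ _ _ (fun c0 s' =>
   forall c, c < c0 -> digsum D t c <= h -> ar s' aWt c = weight c)
   (fun=> 2 * t * t + 2 * t + 4)) => //.
- by rewrite sum_nat_const card_ord hP; lia.
- move=> c s1; rewrite hP => hc sm1 hc1 [fr1 fa1] H.
  have hn1 : rg s1 Rn = n by rewrite fr1.
  have ht1 : rg s1 Rt = t by rewrite fr1.
  have hD1 : rg s1 RD = D by rewrite fr1.
  have ha1 : ar s1 aTadj = adj by rewrite fa1.
  have hpw1 i : i < t -> ar s1 aPw i = D ^ i by rewrite fa1 //; apply: hpw.
  have hh1 : rg s1 Rh = h by rewrite fr1.
  have hds1 : ar s1 aDs c = digsum D t c by rewrite fa1 // hds.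
  rewrite addn4; apply: triple_if; rewrite /= hc1 hds1 hh1 addn1 ltnS; last first.
    move=> hlt; apply: triple_flat => // c'; rewrite ltnS (leq_eqVlt c').
    case: (c' =P c) => [->|_] /=; last exact: H.
    by move=> _; move: hlt; case: leq.
  move=> _.
  apply: (@triple_seq _ _ _ _ _ 1 (2 * t * t + 2 * t + 2) (fun s' => rg s' Ra = 0)) => //; try lia.
  move=> s2 sm2 [fr2 fa2] h2.
  apply: (@triple_seq _ _ _ _ _ (2 * t * t + 2 * t + 1) 1
     (fun s' => rg s' Ra = weight c)) => //; try lia; last first.
    move=> s3 sm3 [fr3 fa3] h3.
    have hc3 : rg s3 Rj = c by rewrite fr3 // fr2.
    apply: triple_flat => //; simp; rewrite h3 ?hc3; first by rewrite -h3; case: sm3.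
    move=> c'; rewrite ltnS (leq_eqVlt c').
    case: (c' =P c) => [-> //|_] /= hc' hds'.
    by rewrite fa3 // fa2 // H.
  pose term i l := adj (i * n + l) * (dig D i c * (dig D l c - (i == l))).
  have term_le i l : i < t -> l < t -> term i l <= D * D.
    move=> hi hl; rewrite -[D * D]mul1n leq_mul ?adj_le1 //.
    have := dig_lt D1 i c; have := dig_lt D1 l c.
    by move=> h4 h5; apply: leq_mul; [exact: ltnW|apply/(leq_trans (leq_subr _ _))/ltnW].
  (* The accumulator is a partial sum of the weight, in lexicographic order of the pairs, each term
     being at most [D * D]. *)
  have sum_le i l : i < t -> l < t -> \sum_(j < i) \sum_(l' < t) term j l' +
      \sum_(l' < l) term i l' + term i l <= M.
    move=> hi hl; apply: leq_trans hM.
    apply: (@leq_trans (\sum_(j < i.+1) \sum_(l' < t) D * D)); last first.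
      by rewrite !sum_nat_const !card_ord mulnA leq_mul2r leq_mul2r hi !orbT.
    rewrite big_ord_recr /= -addnA leq_add //.
      apply: leq_sum => j _; apply: leq_sum => l' _; apply: term_le => //.
      by apply: ltn_trans hi.
    rewrite -(big_ord_recr l (fun l' => term i l')) /=.
    rewrite (big_ord_widen _ (fun l' => term i l') hl) big_mkcond /=.
    by apply: leq_sum => l' _; case: ifP => // _; apply: term_le.
  have fr2' r : r \notin [:: Ri; Rj; Rl; Ra] -> rg s2 r = rg s1 r.
    by rewrite !inE !negb_or => /and4P[? ? ? ?]; apply: fr2.
  apply: (@triple_for _ _ _ _ _ _ (fun i s' =>
    rg s' Ra = \sum_(j < i) \sum_(l < t) term j l) (fun=> 2 * t + 1)) => //.
  + by rewrite sum_nat_const card_ord fr2' // ht1; lia.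
  + by rewrite h2 big_ord0.
  + move=> i s3; rewrite fr2' // ht1 => hi sm3 hi3 [fr3 fa3] H3.
    apply: (@triple_for _ _ _ _ _ _ (fun l s' =>
      rg s' Ra = \sum_(j < i) \sum_(l < t) term j l + \sum_(l' < l) term i l') (fun=> 1)) => //.
    * by rewrite sum_nat_const card_ord fr3 // fr2' // ht1; lia.
    * by rewrite big_ord0 addn0.
    * move=> l s4; rewrite fr3 // fr2' // ht1 => hl sm4 hl4 [fr4 fa4] H4.
      have hi4 : rg s4 Ri = i by rewrite fr4.
      have hc4 : rg s4 Rj = c by rewrite fr4 // fr3 // fr2.
      have hn4 : rg s4 Rn = n by rewrite fr4 // fr3 // fr2'.
      have hD4 : rg s4 RD = D by rewrite fr4 // fr3 // fr2'.
      have ha4 : ar s4 aTadj = adj by rewrite fa4 // fa3 // fa2.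
      have hp4 : ar s4 aPw = ar s1 aPw by rewrite fa4 // fa3 // fa2.
      apply: triple_flat => //; simp;
        rewrite ?hi4 ?hl4 ?hc4 ?hn4 ?hD4 ha4 hp4 !hpw1 // H4 ?big_ord_recr /= ?addnA //.
      exact: (sum_le i l hi hl).
    * by move=> s4 _; rewrite fr3 // fr2' // ht1 => ->; rewrite big_ord_recr.
  + by move=> s' _; rewrite fr2' // ht1.
- by move=> s' _; rewrite hP.
Qed.

End Weights.

End Solver.

(** * Deciding the bits: doubling and relaxation *)

Section Levels.

Definition bits_loop : acmd :=
  (Rb <-- #0 ;;
   AFor Ri Rt (Rb <-- Rb + aSz@[Ri] %/ Rpw %% #2 * aPw@[Ri]))%C.

Definition double_loop : acmd :=
  (AFor Ri RP
    (Ra <-- aT@[Rl * RP + Ri] ;;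
     AIf Ra
      (AIf (aVal@[#2 * Ri + Rb])%A
        (aT~[(Rl + #1) * RP + (#2 * Ri + Rb)] <-- #2 * Ra - #1) ANop)
      ANop))%C.

(** Relaxation works in place. Meeting an entry that has already grown does no harm: soundness asks
    only for some multiset, and coverage only for a lower bound. *)
Definition relax_loop : acmd :=
  (AFor Ri RP
    (AIf (aVal@[Ri])%A
      (Ra <-- aT@[(Rl + #1) * RP + (Ri + Rj)] ;;
       AIf Ra
        (Ra <-- Ra + aWt@[Rj] ;;
         AIf (aT@[(Rl + #1) * RP + Ri] < Ra)%A
           (aT~[(Rl + #1) * RP + Ri] <-- Ra) ANop)
        ANop)
      ANop))%C.

Definition level : acmd :=
  (Rpw <-- Rpw %/ #2 ;; bits_loop ;; double_loop ;;
   AFor Rj RP (AIf (aDs@[Rj] < Rh + #1)%A relax_loop ANop))%C.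

(** Weights count ordered pairs, hence the factors 2. The final test is strict because the entry is
    one more than the value. *)
Definition dynamic_program : acmd :=
  (aT~[#0] <-- #1 ;; AFor Rl RL level ;;
   Rn <-- #2 * Rm < #2 * Rk + aT@[RL * RP])%C.

Variables (M n D K h t : nat) (b wt : nat -> nat).
Let P := D ^ t.
Hypothesis D_gt1 : 1 < D.
Hypothesis KD : 2 * K <= D.
Hypothesis hK : h < K.
Hypothesis K_big : 2 * (h * \sum_(a < D ^ t) (digsum D t a <= h)) + 2 <= K.
Hypothesis b_sum : \sum_(i < t) b i <= n.
Hypothesis wt_le : forall a, is_type D h t a -> wt a <= h * digsum D t a.
Hypothesis M_big : h * n + 1 <= M.
Hypothesis P_le : P <= M.

Record env (s : astate) : Prop := Env {
  env_t : rg s Rt = t;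
  env_h : rg s Rh = h;
  env_P : rg s RP = P;
  env_val : forall c, c < P -> ar s aVal c = digits_lt D K t c;
  env_ds : forall c, c < P -> ar s aDs c = digsum D t c;
  env_wt : forall c, is_type D h t c -> ar s aWt c = wt c;
  env_pw : forall i, i < t -> ar s aPw i = D ^ i;
  env_sz : forall i, i < t -> ar s aSz i = b i
}.

(** Decided by computation for each concrete command, so that [same_outside] yields preservation of
    all tables at once. *)
Definition keeps_env c :=
  ~~ (has (wreg c) [:: Rt; Rh; RP] || has (warr c) [:: aVal; aDs; aWt; aPw; aSz]).

Lemma env_same c s s' : keeps_env c -> same_outside c s s' -> env s -> env s'.
Proof.
rewrite /keeps_env /= !negb_or -!andbA => /and5P[r1 r2 r3 _ /and5P[a1 a2 a3 a4 /andP[a5 _]]].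
case=> fr fa [e1 e2 e3 e4 e5 e6 e7 e8].
by split; rewrite ?fr ?fa.
Qed.

Local Notation sound := (sound D K h t b wt).
Local Notation attains := (attains D h t b wt).
Local Notation bits := (bits D t b).
Local Notation covers := (covers D h t b wt).

(** Offsets from [P] on reach into later windows, so vanishing there says that the memory after
    window [l] is still blank. *)
Definition window l s e := ar s aT (l * P + e).

Lemma P_gt0 : 0 < P. Proof. by rewrite expn_gt0 ltnW. Qed.

Lemma bits_loop_spec s pw : small M s -> env s -> rg s Rpw = pw ->
  triple M bits_loop s (2 + 2 * t) (fun s' => rg s' Rb = bits pw).
Proof.
move=> sm es hpw.
apply: (@triple_seq _ _ _ _ _ 1 (1 + 2 * t) (fun s' => rg s' Rb = 0)) => //.
move=> s1 sm1 fr1 h1; have es1 : env s1 by apply: env_same fr1 es.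
have hpw1 : rg s1 Rpw = pw by rewrite fr1.1.
apply: (@triple_for _ _ _ _ _ _
  (fun i s' => rg s' Rb = enc D i (fun i => b i %/ pw %% 2)) (fun=> 1)) => //.
- by rewrite sum_nat_const card_ord env_t //; lia.
- by rewrite h1 /enc big_ord0.
- move=> i s2; rewrite env_t // => hi sm2 hi2 fr2 H.
  have es2 : env s2 by apply: env_same fr2 es1.
  apply: triple_flat => //; simp;
    rewrite H hi2 (env_pw es2) // (env_sz es2) // fr2.1 // hpw1 -encS //.
  have lt : enc D i.+1 (fun i => b i %/ pw %% 2) < D ^ i.+1.
    by apply: enc_lt => // j _; apply: leq_trans D_gt1; rewrite ltn_pmod.
  apply: leq_trans (ltnW lt) (leq_trans _ P_le).
  by rewrite leq_pexp2l // ltnW.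
- by move=> s' _; rewrite env_t.
Qed.

Lemma double_loop_spec s l pw : small M s -> env s ->
  rg s Rl = l -> rg s Rb = bits pw ->
  sound (2 * pw) (window l s) -> (forall e, P <= e -> window l s e = 0) ->
  triple M double_loop s (1 + 7 * P) (fun s' =>
    [/\ sound pw (window l.+1 s'), forall e, P <= e -> window l.+1 s' e = 0
      & forall c, c < P -> digits_lt D K t c -> window l s c != 0 ->
          digits_lt D K t (2 * c + bits pw) ->
          window l.+1 s' (2 * c + bits pw) = 2 * window l s c - 1]).
Proof.
move=> sm es hl hb snd zero.
pose T0 := window l s.
have zero' e : window l.+1 s e = 0.
  by rewrite -(zero (P + e)) ?leq_addr // /window mulSn addnA [P + _]addnC.
(* The vectors already copied before round [c]. Since [2 * c1 + bits pw] is injective in [c1], no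
   entry is written twice and no maximum has to be taken. *)
pose hit c c1 := [&& c1 < c, T0 c1 != 0 & digits_lt D K t (2 * c1 + bits pw)].
pose I c s' := [/\ forall e, e < P -> window l s' e = T0 e,
   forall e, window l.+1 s' e != 0 -> exists2 c1, hit c c1 &
     e = 2 * c1 + bits pw /\ window l.+1 s' e = 2 * T0 c1 - 1
   & forall c1, hit c c1 -> window l.+1 s' (2 * c1 + bits pw) = 2 * T0 c1 - 1].
apply: (@triple_for _ _ _ _ _ _ I (fun=> 6)) => //.
- by rewrite sum_nat_const card_ord (env_P es); lia.
- by split=> // e; rewrite zero'.
- move=> c s1; rewrite (env_P es) => hc sm1 hc1 fr1 [I1 I2 I3].
  have es1 : env s1 by apply: env_same fr1 es.
  have hl1 : rg s1 Rl = l by rewrite fr1.1.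
  have hb1 : rg s1 Rb = bits pw by rewrite fr1.1.
  have hP1 := env_P es1.
  have T0c : ar s1 aT (l * P + c) = T0 c by rewrite -(I1 _ hc).
  have TM : T0 c <= M by rewrite -T0c; case: sm1.
  have hitS c1 : hit c c1 -> hit c.+1 c1 by move=> /and3P[h1 h2 h3]; rewrite /hit ltnW ?h2.
  case e1 : (T0 c == 0).
    apply: triple_flat => //; do 2! (simp; rewrite ?hc1 ?hl1 ?hb1 ?hP1 ?T0c ?e1 //).
    split=> //.
    + by move=> e /I2[c1 /hitS h1 h2]; exists c1.
    + move=> c1 /and3P[]; rewrite ltnS leq_eqVlt => /predU1P[->|h1 h2 h3].
        by rewrite e1.
      by apply: I3; rewrite /hit h1 h2.
  have [vc [ats]] := snd _ hc (negbT e1).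
  move=> [a1 a2 a3].
  have [ltP _] := dig_double b D_gt1 KD hK pw hc vc.
  have val1 : ar s1 aVal (2 * c + bits pw) = digits_lt D K t (2 * c + bits pw).
    exact: (env_val es1 ltP).
  case e2 : (digits_lt D K t (2 * c + bits pw)); last first.
    apply: triple_flat => //;
      do 3! (simp; rewrite ?hc1 ?hl1 ?hb1 ?hP1 ?T0c ?e1 ?val1 ?e2 //).
    split=> //.
    + by move=> e /I2[c1 /hitS h1 h2]; exists c1.
    + move=> c1 /and3P[]; rewrite ltnS leq_eqVlt => /predU1P[->|h1 h2 h3].
        by rewrite e2.
      by apply: I3; rewrite /hit h1 h2.
  have at2 : attains pw (2 * c + bits pw) (2 * (T0 c - 1)).
    by apply: (attains_double D_gt1 KD hK hc vc); exists ats.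
  have := attains_le wt_le b_sum at2 => le2.
  have T0pos : 0 < T0 c by rewrite lt0n e1.
  apply: triple_flat => //;
    do 4! (simp; rewrite ?hc1 ?hl1 ?hb1 ?hP1 ?T0c ?e1 ?val1 ?e2 //).
    by split=> //; lia.
  have wE e : window l.+1
    (run (ASeq (Ra <-- aT@[Rl * RP + Ri])%C (aT~[(Rl + #1) * RP + (#2 * Ri + Rb)] <-- #2 * Ra - #1)%C) s1) e =
    if e == 2 * c + bits pw then 2 * T0 c - 1 else window l.+1 s1 e.
    by rewrite /window; simp; rewrite hc1 hl1 hb1 hP1 T0c addn1 eqn_add2l.
  split.
  + move=> e he; rewrite /window; simp; case: eqP => [ee|_]; last exact: I1.
    by rewrite mulnDl mul1n in ee; lia.
  + move=> e; have := wE e; rewrite /window; simp; rewrite ?hc1 ?hl1 ?hb1 ?hP1 ?T0c => ->.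
    case: (e =P _) => [-> _|_ /I2[c1 /hitS h1 h2]]; last by exists c1.
    by exists c; rewrite // /hit ltnSn e1.
  + move=> c1 hc1'; have := wE (2 * c1 + bits pw).
    rewrite /window; simp; rewrite ?hc1 ?hl1 ?hb1 ?hP1 ?T0c => ->.
    case: eqP => [e|ne]; first by have -> : c = c1 by lia.
    apply: I3; case/and3P: hc1' => h1 h2 h3; rewrite /hit h2 h3 !andbT.
    by move: h1; rewrite ltnS leq_eqVlt => /predU1P[e|//]; rewrite e in ne.
- move=> s'; rewrite (env_P es) => _ [I1 I2 I3]; split.
  + move=> c hc /[dup] hc0 /I2[c1 /and3P[h1 h2 h3] [e1 e2]].
    rewrite e1 in hc0 *; split=> //.
    have [vc1 at1] := snd _ h1 h2.
    have := attains_double D_gt1 KD hK h1 vc1 at1.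
    rewrite -e1 e2 -/(T0 _); congr (attains _ _ _).
    by move: h2; rewrite /T0; lia.
  + move=> e he; case: (eqVneq (window l.+1 s' e) 0) => // /I2[c1 /and3P[h1 h2 h3] [e1 _]].
    have [vc1 _] := snd _ h1 h2.
    by have [] := dig_double b D_gt1 KD hK pw h1 vc1; rewrite -e1 ltnNge he.
  + by move=> c hc vc h2 h3; apply: I3; rewrite /hit hc h2.
Qed.

Lemma relax_loop_spec s l pw a : small M s -> env s ->
  rg s Rl = l -> rg s Rj = a -> is_type D h t a ->
  sound pw (window l.+1 s) -> (forall e, P <= e -> window l.+1 s e = 0) ->
  triple M relax_loop s (1 + 10 * P) (fun s' =>
    [/\ sound pw (window l.+1 s'), forall e, P <= e -> window l.+1 s' e = 0,
        forall c, window l.+1 s c <= window l.+1 s' c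
      & forall c, c < P -> digits_lt D K t c -> window l.+1 s (c + a) != 0 ->
          window l.+1 s (c + a) + wt a <= window l.+1 s' c]).
Proof.
move=> sm es hl ha ta snd zero.
pose T1 := window l.+1 s.
pose I c0 s' := [/\ sound pw (window l.+1 s'), forall e, P <= e -> window l.+1 s' e = 0,
        forall c, T1 c <= window l.+1 s' c
      & forall c, c < c0 -> digits_lt D K t c -> T1 (c + a) != 0 ->
          T1 (c + a) + wt a <= window l.+1 s' c].
apply: (@triple_for _ _ _ _ _ _ I (fun=> 9)) => //; last first.
- by move=> s'; rewrite (env_P es).
- move=> c s1; rewrite (env_P es) => hc sm1 hc1 fr1 [I1 I2 I3 I4].
  have es1 : env s1 by apply: env_same fr1 es.
  have hl1 : rg s1 Rl = l by rewrite fr1.1.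
  have ha1 : rg s1 Rj = a by rewrite fr1.1.
  have hP1 := env_P es1.
  have val1 := env_val es1 hc.
  have wt1 := env_wt es1 ta.
  have IS c' : (c' = c -> digits_lt D K t c -> T1 (c + a) != 0 ->
       T1 (c + a) + wt a <= window l.+1 s1 c) -> c' < c.+1 ->
       digits_lt D K t c' -> T1 (c' + a) != 0 -> T1 (c' + a) + wt a <= window l.+1 s1 c'.
    by move=> hh; rewrite ltnS leq_eqVlt => /predU1P[e|/I4]; rewrite ?e //; apply: hh.
  case e1 : (digits_lt D K t c); last first.
    apply: triple_flat => //; do 2! (simp; rewrite ?hc1 ?val1 ?e1 //).
    by split=> // c'; apply: IS; rewrite e1.
  have wca : ar s1 aT ((l + 1) * P + (c + a)) = window l.+1 s1 (c + a) by rewrite addn1.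
  have wc : ar s1 aT ((l + 1) * P + c) = window l.+1 s1 c by rewrite addn1.
  have vM : window l.+1 s1 (c + a) <= M by rewrite -wca; case: sm1.
  case e2 : (window l.+1 s1 (c + a) == 0).
    apply: triple_flat => //;
      do 3! (simp; rewrite ?hc1 ?hl1 ?ha1 ?hP1 ?val1 ?e1 ?wca ?e2 //).
    split=> // c'; apply: IS => _ _; have := I3 (c + a); lia.
  have [ltca _] := dig_shift D_gt1 KD hK hc e1 ta.
  have [_ at1] := I1 _ ltca (negbT e2).
  have at2 := attains_shift D_gt1 KD hK hc e1 ta at1.
  have le2 := attains_le wt_le b_sum at2.
  have pos : 0 < window l.+1 s1 (c + a) by rewrite lt0n e2.
  (* The new value is at most [h * n], and its entry is one more. *)
  have sumM : window l.+1 s1 (c + a) + wt a <= M by lia.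
  case e3 : (window l.+1 s1 c < window l.+1 s1 (c + a) + wt a); last first.
    apply: triple_flat => //;
      do 5! (simp; rewrite ?hc1 ?hl1 ?ha1 ?hP1 ?val1 ?e1 ?wca ?e2 ?wt1 ?wc ?e3 //).
    split=> // c'; apply: IS => _ _ _; have := I3 (c + a); lia.
  apply: triple_flat => //;
    do 6! (simp; rewrite ?hc1 ?hl1 ?ha1 ?hP1 ?val1 ?e1 ?wca ?e2 ?wt1 ?wc ?e3 //).
  set s2 := seta _ _ _ _.
  have wE e : window l.+1 s2 e =
    if e == c then window l.+1 s1 (c + a) + wt a else window l.+1 s1 e.
    by rewrite /window /s2; simp; rewrite addn1 eqn_add2l.
  split.
  + move=> c' hc'; rewrite wE; case: (c' =P c) => [-> _|_]; last exact: I1.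
    split=> //; congr (attains _ _ _): at2; lia.
  + by move=> e he; rewrite wE; case: (e =P c) => [e'|_]; [lia|exact: I2].
  + by move=> c'; rewrite wE; case: (c' =P c) => [->|_]; [apply: leq_trans (I3 c) (ltnW e3)|].
  + move=> c'; rewrite ltnS leq_eqVlt wE => /predU1P[->|hlt].
      by rewrite eqxx leq_add2r => _ _; apply: I3.
    by rewrite (ltn_eqF hlt); apply: I4.
- by rewrite sum_nat_const card_ord (env_P es); lia.
Qed.

(** The bound by [n] makes all multiplicities vanish at the top scale, where the table knows only
    the empty solution. *)
Definition feasible x := (forall i, i < t -> demand D h t x i = b i) /\ forall a, x a <= n.

Lemma level_spec s l pw : small M s -> env s -> rg s Rl = l -> rg s Rpw = 2 * pw ->
  0 < pw -> sound (2 * pw) (window l s) -> (forall e, P <= e -> window l s e = 0) ->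
  (forall x, feasible x -> covers (2 * pw) (window l s) (fun a => x a %/ (2 * pw))) ->
  triple M level s (5 + 2 * t + 10 * P + \sum_(a < P) (digsum D t a <= h) * (1 + 10 * P))
    (fun s' => [/\ rg s' Rpw = pw, sound pw (window l.+1 s'),
       forall e, P <= e -> window l.+1 s' e = 0
     & forall x, feasible x -> covers pw (window l.+1 s') (fun a => x a %/ pw)]).
Proof.
move=> sm es hl hpw pw0 snd zero cov.
set S := \sum_(a < P) _.
apply: (@triple_seq _ _ _ _ _ 1 (4 + 2 * t + 10 * P + S) (fun s' => rg s' Rpw = pw)) => //; try lia.
  apply: triple_flat => //; simp; rewrite hpw ?mulKn //.
  by apply: leq_trans (sm.1 Rpw); rewrite hpw; lia.
move=> s1 sm1 fr1 hpw1; have es1 : env s1 by apply: env_same fr1 es.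
apply: (@triple_seq _ _ _ _ _ (2 + 2 * t) (2 + 10 * P + S) (fun s' => rg s' Rb = bits pw)) => //; try lia.
  exact: bits_loop_spec.
move=> s2 sm2 fr2 hb2; have es2 : env s2 by apply: env_same fr2 es1.
have hl2 : rg s2 Rl = l by rewrite fr2.1 // fr1.1.
have w2 : window l s2 = window l s by rewrite /window (fr2.2 aT) // (fr1.2 aT).
(* Coverage is stated for all solutions at once: the pass over the types runs through the stages of
   each of them simultaneously. *)
pose I a s' := [/\ sound pw (window l.+1 s'),
  forall e, P <= e -> window l.+1 s' e = 0 &
  forall x, feasible x -> covers pw (window l.+1 s') (stage x pw a)].
apply: (@triple_seq _ _ _ _ _ (1 + 7 * P) (1 + 3 * P + S) (I 0)) => //; try lia.
  rewrite -w2 in snd zero cov.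
  apply: triple_weaken (double_loop_spec sm2 es2 hl2 hb2 snd zero) => //.
  move=> s' [h1 h2 h3]; split=> // x fx.
  exact: (covers_double D_gt1 KD hK fx.1 K_big pw0 h3 (cov x fx)).
move=> s3 sm3 fr3 I3; have es3 : env s3 by apply: env_same fr3 es2.
have hl3 : rg s3 Rl = l by rewrite fr3.1.
have hpw3 : rg s3 Rpw = pw by rewrite fr3.1 // fr2.1.
apply: (@triple_for _ _ _ _ _ _ I (fun a => 2 + (digsum D t a <= h) * (1 + 10 * P))) => //.
- rewrite (env_P es3) -/P /S.
  have -> : \sum_(i < P) (2 + (digsum D t i <= h) * (1 + 10 * P)).+1 =
            \sum_(i < P) 3 + \sum_(i < P) (digsum D t i <= h) * (1 + 10 * P).
    by rewrite -big_split; apply: eq_bigr.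
  by rewrite sum_nat_const card_ord; lia.
- move=> a s4; rewrite (env_P es3) => ha sm4 ha4 fr4 I4.
  have es4 : env s4 by apply: env_same fr4 es3.
  have hl4 : rg s4 Rl = l by rewrite fr4.1.
  have [I4a I4b I4c] := I4.
  rewrite add2n; apply: triple_if; rewrite /= ha4 (env_ds es4) // (env_h es4) addn1 ltnS => hds.
    have hds' : digsum D t a <= h by move: hds; case: leq.
    have ta : is_type D h t a by rewrite /is_type ha.
    rewrite hds' mul1n.
    apply: triple_weaken (relax_loop_spec sm4 es4 hl4 ha4 ta I4a I4b) => //; try exact: leqnSn.
    move=> s' [h1 h2 h3 h4]; split=> // x fx.
    exact: (covers_relax D_gt1 KD hK fx.1 K_big pw0 ta h3 h4 (I4c x fx)).
  have nta : ~~ is_type D h t a by rewrite /is_type ha; move: hds; case: leq.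
  have hds' : (digsum D t a <= h) = false by move: hds; case: leq.
  rewrite hds' mul0n.
  by split=> //; split=> // x fx; apply: covers_skip nta (I4c x fx).
- move=> s' fr'; rewrite (env_P es3) => -[h1 h2 h3]; split=> //; first by rewrite fr'.1.
  move=> x fx; apply: eq_covers (h3 x fx) => a /andP[ha _].
  by rewrite stage_last.
Qed.

(** Passes between the two forms of a solution: lists of types, used for soundness, and
    multiplicities, used for coverage. *)
Lemma sum_count_types (l : seq nat) (f : nat -> nat) : all (is_type D h t) l ->
  \sum_(a < D ^ t | is_type D h t a) count_mem (a : nat) l * f a = \sum_(a <- l) f a.
Proof.
elim: l => [|a0 l IH] /=; first by rewrite big_nil big1.
move=> /andP[h0 hl]; rewrite big_cons -IH //.
have /andP[h1 _] := h0.
under eq_bigr => a _ do rewrite mulnDl.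
rewrite big_split /=; congr (_ + _).
rewrite (bigD1 (Ordinal h1)) //= eqxx mul1n big1 ?addn0 // => a /andP[_].
by rewrite -val_eqE /= eq_sym => /negPf->.
Qed.

Definition level_cost := 6 + 2 * t + 10 * P + 'C(h + t, t) * (1 + 10 * P).

Lemma dynamic_program_spec s L m k : small M s -> env s ->
  rg s Rm = m -> rg s Rk = k -> rg s RL = L -> rg s Rpw = 2 ^ L -> n < 2 ^ L ->
  (forall x, ar s aT x = 0) ->
  (exists l, [/\ all (is_type D h t) l, size l <= n &
      forall i, i < t -> \sum_(a <- l) dig D i a = b i]) ->
  triple M dynamic_program s (3 + L * level_cost)
    (fun s' =>
      (rg s' Rn != 0 -> exists l, [/\ all (is_type D h t) l,
         forall i, i < t -> \sum_(a <- l) dig D i a = b i &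
         2 * m <= 2 * k + \sum_(a <- l) wt a]) /\
      (forall l, all (is_type D h t) l -> size l <= n ->
         (forall i, i < t -> \sum_(a <- l) dig D i a = b i) ->
         2 * m <= 2 * k + \sum_(a <- l) wt a -> rg s' Rn != 0)).
Proof.
move=> sm es hm hk hL hpw nL zero ex0.
have hD : h < D by lia.
have cnt : \sum_(a < P) (digsum D t a <= h) * (1 + 10 * P) = 'C(h + t, t) * (1 + 10 * P).
  by rewrite -big_distrl /= (count_digsum D_gt1 t hD).
have b0 i : i < t -> b i %/ 2 ^ L = 0.
  move=> hi; rewrite divn_small //; apply: leq_ltn_trans nL; apply: leq_trans b_sum.
  by rewrite (bigD1 (Ordinal hi)) //= leq_addr.
pose I l s' := [/\ rg s' Rpw = 2 ^ (L - l), sound (2 ^ (L - l)) (window l s'),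
  forall e, P <= e -> window l s' e = 0 &
  forall x, feasible x -> covers (2 ^ (L - l)) (window l s') (fun a => x a %/ 2 ^ (L - l))].
apply: (@triple_seq _ _ _ _ _ 1 (2 + L * level_cost) (I 0)) => //.
  apply: triple_flat => //; first by rewrite /=; lia.
  have w0 e : window 0 (run (aT~[#0] <-- #1)%C s) e = (e == 0).
    by rewrite /window; simp; rewrite zero; case: eqP.
  (* At scale [2 ^ L], which exceeds [n], all demands and multiplicities round to 0, so the single
     entry 1 at the zero vector is both sound and covering. *)
  split; rewrite ?subn0 //.
  - move=> c hc; rewrite w0; case: (c =P 0) => // -> _.
    have d0 i : dig D i 0 = 0 by rewrite /dig div0n mod0n.
    split; first by apply/digits_ltP => i _; rewrite d0; lia.
    exists [::]; split=> //; last by rewrite big_nil.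
    by move=> i hi; rewrite big_nil d0 b0.
  - by move=> e he; rewrite w0; have := P_gt0; lia.
  - move=> x [_ fx]; rewrite /covers w0.
    have x0 a : x a %/ 2 ^ L = 0 by rewrite divn_small // (leq_ltn_trans (fx a)).
    have -> : worth D h t wt (fun a => x a %/ 2 ^ L) = 0.
      by apply: big1 => a _; rewrite x0.
    have -> : enc D t (residue D h t b (2 ^ L) (fun a => x a %/ 2 ^ L)) = 0.
      by apply: big1 => i _; rewrite /residue b0 ?sub0n.
    by [].
move=> s1 sm1 fr1 I1; have es1 : env s1 by apply: env_same fr1 es.
have hL1 : rg s1 RL = L by rewrite fr1.1.
apply: (@triple_seq _ _ _ _ _ (1 + L * level_cost) 1 (I L)) => //; try lia.
  apply: (@triple_for _ _ _ _ _ _ I (fun=> level_cost.-1)) => //.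
  - rewrite sum_nat_const card_ord hL1 prednK ?add1n // /level_cost; lia.
  - move=> l s2; rewrite hL1 => hl sm2 hl2 fr2 [h1 h2 h3 h4].
    have es2 : env s2 by apply: env_same fr2 es1.
    have e : 2 ^ (L - l) = 2 * 2 ^ (L - l.+1) by rewrite -expnS subnSK.
    rewrite e in h1 h2 h4.
    have pw0 : 0 < 2 ^ (L - l.+1) by rewrite expn_gt0.
    apply: triple_weaken (level_spec sm2 es2 hl2 h1 pw0 h2 h3 h4) => //.
    by rewrite cnt /level_cost; lia.
  - by move=> s' _; rewrite hL1.
move=> s2 sm2 fr2 [_ snd _ cov].
have hL2 : rg s2 RL = L by rewrite fr2.1.
have es2 : env s2 by apply: env_same fr2 es1.
have hm2 : rg s2 Rm = m by rewrite fr2.1 // fr1.1.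
have hk2 : rg s2 Rk = k by rewrite fr2.1 // fr1.1.
rewrite subnn expn0 in snd cov.
have wL : ar s2 aT (L * P) = window L s2 0 by rewrite /window addn0.
apply: triple_flat => //; simp; rewrite hm2 hk2 hL2 (env_P es2) wL.
  by apply: leq_trans M_big; case: (_ < _) => /=; rewrite ?addn1.
have key l : all (is_type D h t) l -> size l <= n ->
    (forall i, i < t -> \sum_(a <- l) dig D i a = b i) ->
    \sum_(a <- l) wt a < window L s2 0.
  move=> hl sl hb.
  have fx : feasible (fun a => count_mem a l).
    split=> [i hi|a]; first by rewrite -hb // -sum_count_types.
    by apply: leq_trans sl; apply: count_size.
  have := cov _ fx; rewrite /covers.
  have -> : worth D h t wt (fun a => count_mem a l %/ 1) = \sum_(a <- l) wt a.
    by rewrite -sum_count_types //; apply: eq_bigr => a _; rewrite divn1.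
  suff -> : enc D t (residue D h t b 1 (fun a => count_mem a l %/ 1)) = 0 by [].
  apply: big1 => i _; rewrite /residue divn1 -hb //.
  have -> : demand D h t (fun a => count_mem a l %/ 1) i = \sum_(a <- l) dig D i a.
    by rewrite -sum_count_types //; apply: eq_bigr => a _; rewrite divn1.
  by rewrite subnn.
split=> [|l hl sl hb hmk]; last first.
  by have := key l hl sl hb; case: ltnP => //; lia.
case: ltnP => // hlt _.
(* The solution [ex0] excludes the entry 0, on which the final test would compare only [2 * m] with
   [2 * k]. *)
have w0 : window L s2 0 != 0.
  by have [l0 [a1 a2 a3]] := ex0; have := key _ a1 a2 a3; lia.
have [_ [l [l1 l2 l3]]] := snd _ P_gt0 w0.
exists l; split=> //; last by rewrite l3; lia.
by move=> i hi; have := l2 _ hi; rewrite /dig div0n mod0n addn0 divn1.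
Qed.

End Levels.

(** * Blocks of a partition and their types *)

Section Blocks.

Variables (n : nat) (G : sgraph n) (D h t : nat) (ty : 'I_n -> nat) (M : nat -> nat -> bool).
Hypothesis D_gt1 : 1 < D.
Hypothesis hD : h < D.
Hypothesis ty_lt : forall v, ty v < t.
Hypothesis adjE : forall u v, u != v -> ([set u; v] \in edges G) = M (ty u) (ty v).

Definition of_type (B : {set 'I_n}) i := [set v in B | ty v == i].

(* The number of ordered pairs of adjacent vertices in a block of type [c]. *)
Definition block_weight c := \sum_(i < t) \sum_(l < t)
  M i l * (dig D i c * (dig D l c - (i == l))).

Lemma sum_by_type (B : {set 'I_n}) (F : nat -> nat) :
  \sum_(v in B) F (ty v) = \sum_(i < t) #|of_type B i| * F i.
Proof.
rewrite (partition_big (fun v => Ordinal (ty_lt v)) xpredT) //=.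
apply: eq_bigr => i _; rewrite (eq_bigr (fun=> F i)); last first.
  by move=> v /andP[_ /eqP<-].
by rewrite sum_nat_const; congr (_ * _); apply: eq_card => v; rewrite !inE.
Qed.

Lemma edge_irrefl u : [set u; u] \in edges G = false.
Proof. by apply/negP => /edges_card2; rewrite setUid cards1. Qed.

(** Adjacency of distinct vertices depends only on their classes; the factor lowered by one for
    [l = i] leaves out the vertex itself. *)
Lemma block_weightE (B : {set 'I_n}) a :
  (forall i, i < t -> dig D i a = #|of_type B i|) ->
  block_weight a = \sum_(u in B) \sum_(v in B) ([set u; v] \in edges G).
Proof.
move=> ha; rewrite /block_weight.
transitivity (\sum_(i < t) #|of_type B i| *
    \sum_(l < t) M i l * (#|of_type B l| - (i == l :> nat))).
  apply: eq_bigr => i _; rewrite big_distrr; apply: eq_bigr => l _ /=.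
  by rewrite !ha // mulnCA.
rewrite -(sum_by_type B (fun i =>
   \sum_(l < t) M i l * (#|of_type B l| - (i == l :> nat)))).
apply: eq_bigr => u uB.
rewrite (bigD1 u) //= edge_irrefl add0n.
transitivity (\sum_(v in B :\ u) (M (ty u) (ty v) : nat)); last first.
  apply: eq_big => v; first by rewrite !inE andbC.
  by rewrite !inE eq_sym => /andP[nuv _]; rewrite adjE.
rewrite (sum_by_type (B :\ u) (fun l => M (ty u) l)); apply: eq_bigr => l _.
rewrite mulnC; congr (_ * _).
have -> : of_type (B :\ u) l = of_type B l :\ u by apply/setP => v; rewrite !inE andbA.
by rewrite (cardsD1 u (of_type B l)) !inE uB /= addKn.
Qed.

Lemma card_by_type (B : {set 'I_n}) : #|B| = \sum_(i < t) #|of_type B i|.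
Proof.
rewrite -sum1_card (sum_by_type B (fun=> 1)).
by apply: eq_bigr => i _; rewrite muln1.
Qed.

Lemma sum_same_label (X : finType) (lab : 'I_n -> X) (F : 'I_n -> 'I_n -> nat) :
  \sum_(x in [set lab u | u in 'I_n]) \sum_(u in [set u | lab u == x])
     \sum_(v in [set v | lab v == x]) F u v =
  \sum_u \sum_v (lab u == lab v) * F u v.
Proof.
rewrite [RHS](partition_big lab (mem [set lab u | u in 'I_n])) /=; last first.
  by move=> u _; apply: imset_f.
apply: eq_bigr => x _; rewrite (eq_bigl (fun u => lab u == x)) => [|u]; last by rewrite inE.
apply: eq_bigr => u /eqP<-.
rewrite (eq_bigl (fun v => lab v == lab u)) => [|v]; last by rewrite inE.
by rewrite big_mkcond /=; apply: eq_bigr => v _; rewrite eq_sym; case: eqP; rewrite ?mul1n.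
Qed.

Definition within_labels (X : eqType) (lab : 'I_n -> X) :=
  [set e in edges G | [forall u in e, forall v in e, lab u == lab v]].

Lemma within_labelsE (X : eqType) (lab : 'I_n -> X) u v :
  ([set u; v] \in within_labels lab) = ([set u; v] \in edges G) && (lab u == lab v).
Proof.
rewrite inE; congr (_ && _); apply/idP/idP.
  by move=> /forall_inP/(_ u)/[!set21]/(_ isT)/forall_inP/(_ v); rewrite set22; apply.
move=> /eqP e; apply/forall_inP => x; rewrite !inE => hx.
apply/forall_inP => y; rewrite !inE => hy.
by move: hx hy => /orP[]/eqP-> /orP[]/eqP->; rewrite ?e.
Qed.

Lemma double_count (E : {set {set 'I_n}}) : E \subset edges G ->
  \sum_u \sum_v ([set u; v] \in E) = 2 * #|E|.
Proof.
move=> sE; have c2 e : e \in E -> #|e| = 2 by move=> /(subsetP sE)/edges_card2.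
transitivity (\sum_(e in E) \sum_u \sum_v ([set u; v] == e)).
  rewrite [RHS]exchange_big; apply: eq_bigr => u _ /=.
  rewrite [RHS]exchange_big; apply: eq_bigr => v _ /=.
  case: (boolP (_ \in E)) => h1; last first.
    by rewrite big1 // => e he; case: eqP => // e'; rewrite e' he in h1.
  rewrite (bigD1 _ h1) /= eqxx big1 ?addn0 // => e /andP[_].
  by rewrite eq_sym => /negPf->.
rewrite mulnC -sum_nat_const; apply: eq_bigr => e he; have e2 := c2 _ he.
rewrite -e2 -sum1_card [RHS]big_mkcond /=; apply: eq_bigr => u _.
transitivity (\sum_v ((u \in e) && (v \in e :\ u) : nat)).
  apply: eq_bigr => v _; congr nat_of_bool; apply/eqP/andP.
    move=> e'; rewrite -e' !inE !eqxx orbT andbT; split=> //.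
    by apply/eqP => uv; move: e2; rewrite -e' uv setUid cards1.
  move=> [ue ve]; have := cardsD1 u e; rewrite ue e2 => -[] /esym/eqP/cards1P[w hw].
  by rewrite -(setD1K ue) hw; move: ve; rewrite hw inE => /eqP->.
case: (boolP (u \in e)) => ue; last by rewrite big1.
have := cardsD1 u e; rewrite ue e2 => -[] ->.
by rewrite -sum1_card [RHS]big_mkcond /=; apply: eq_bigr => v _ /=; case: (v \in _).
Qed.

Definition demands (l : seq nat) :=
  forall i, i < t -> \sum_(a <- l) dig D i a = #|of_type setT i|.

(** The blocks are the fibres of [lab]. Only attained labels are listed, which keeps the number of
    blocks at most [n]. *)
Lemma labels_to_types (X : finType) (lab : 'I_n -> X) :
  (forall x, #|[set v | lab v == x]| <= h) ->
  exists l, [/\ all (is_type D h t) l, size l <= n, demands l &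
    \sum_(a <- l) block_weight a = 2 * #|within_labels lab|].
Proof.
move=> hsz; pose blk x := [set v | lab v == x].
pose code B := enc D t (fun i => #|of_type B i|).
have ltD x i : i < t -> #|of_type (blk x) i| < D.
  move=> hi; apply: leq_ltn_trans hD; apply: leq_trans (hsz x).
  by apply: subset_leq_card; apply/subsetP => v; rewrite inE => /andP[].
have digE x i : i < t -> dig D i (code (blk x)) = #|of_type (blk x) i|.
  by move=> hi; rewrite dig_enc // => j hj; apply: ltD.
exists [seq code (blk x) | x <- enum [set lab u | u in 'I_n]]; split.
- apply/allP => _ /mapP[x _ ->]; apply/andP; split.
    by apply: enc_lt => // i; apply: ltD.
  apply: leq_trans (hsz x); rewrite (card_by_type (blk x)).
  by apply: leq_sum => i _; rewrite digE.
- by rewrite size_map -cardE -[X in _ <= X]card_ord leq_imset_card.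
- move=> i hi; rewrite big_map big_enum /=.
  under eq_bigr => x _ do rewrite digE //.
  rewrite -sum1_card (partition_big lab (mem [set lab u | u in 'I_n])) /=; last first.
    by move=> u _; apply: imset_f.
  apply: eq_bigr => x _; rewrite -sum1_card; apply: eq_bigl => v.
  by rewrite !inE andbC.
- rewrite big_map big_enum /=.
  under eq_bigr => x _ do rewrite (block_weightE (digE x)).
  rewrite sum_same_label -double_count; last by apply/subsetP => e; rewrite inE => /andP[].
  apply: eq_bigr => u _; apply: eq_bigr => v _.
  by rewrite within_labelsE andbC mulnb.
Qed.

Lemma choose_block (U : {set 'I_n}) a :
  (forall i, i < t -> dig D i a <= #|of_type U i|) ->
  exists2 S : {set 'I_n}, S \subset U & forall i, i < t -> #|of_type S i| = dig D i a.
Proof.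
move=> ha.
exists [set v in U | v \in take (dig D (ty v) a) (enum (of_type U (ty v)))].
  by apply/subsetP => v; rewrite inE => /andP[].
move=> i hi.
have -> : of_type [set v in U | v \in take (dig D (ty v) a) (enum (of_type U (ty v)))] i =
  [set v in take (dig D i a) (enum (of_type U i))].
  apply/setP => v; rewrite !inE; case: (ty v =P i) => [->|ne]; rewrite ?andbT ?andbF.
    apply/andP/idP => [[]//|hv]; split=> //.
    by move: (mem_take hv); rewrite mem_enum inE => /andP[].
  by apply/esym/negP => /mem_take; rewrite mem_enum inE => /andP[_ /eqP].
rewrite cardsE (card_uniqP _) ?take_uniq ?enum_uniq // size_takel //.
by rewrite -cardE ha.
Qed.

(** Greedy choice: the first block takes any vertices of the prescribed classes, and what remains of
    [U] meets the remaining demand exactly. Labels outside [U] are arbitrary. *)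
Lemma types_to_labels (l : seq nat) (U : {set 'I_n}) :
  (forall i, i < t -> \sum_(a <- l) dig D i a = #|of_type U i|) ->
  exists lab : 'I_n -> nat, forall j, j < size l -> forall i, i < t ->
    #|of_type [set v in U | lab v == j] i| = dig D i (nth 0 l j) /\
    (forall v, v \in U -> lab v < size l).
Proof.
elim: l U => [|a l IH] U hU; first by exists (fun=> 0).
have [|S sS hS] := @choose_block U a.
  by move=> i hi; rewrite -hU // big_cons leq_addr.
have ofD i : of_type (U :\: S) i = of_type U i :\: of_type S i.
  by apply/setP => v; rewrite !inE; case: (v \in S); case: (v \in U); case: (ty v == i).
have ofS i : of_type S i \subset of_type U i.
  by apply/subsetP => v; rewrite !inE => /andP[/(subsetP sS)-> ->].
have [|lab hlab] := IH (U :\: S).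
  move=> i hi; rewrite ofD cardsDS // -hU // big_cons hS //; lia.
exists (fun v => if v \in S then 0 else (lab v).+1).
move=> j hj i hi; split.
  case: j hj => [_|j hj].
    rewrite /= -hS //; congr #|pred_of_set _|; apply/setP => v; rewrite !inE.
    by case: ifP => vS; rewrite ?(subsetP sS _ vS) ?andbF.
  have [e _] := hlab j hj i hi; rewrite /= -e; congr #|pred_of_set _|.
  by apply/setP => v; rewrite !inE; case: ifP => vS; rewrite ?andbF.
move=> v vU; case: ifP => // vS; rewrite ltnS.
(* If no type is left, then the first block exhausts [U], so a vertex of [U] outside it cannot
   exist. *)
case: l hU IH hlab {hj} => [|a' l] hU _ hlab; last first.
  by apply: (hlab 0 isT _ hi).2; rewrite inE vS vU.
have : v \in of_type U (ty v) by rewrite inE vU eqxx.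
have -> : of_type U (ty v) = of_type S (ty v).
  by apply/eqP; rewrite eq_sym eqEcard ofS /= hS ?ty_lt // -hU ?ty_lt // big_seq1.
by rewrite inE vS.
Qed.

Lemma adj_sym (E : {set {set 'I_n}}) : connect_sym (adj E).
Proof. by apply: sym_connect_sym => u v; rewrite /adj /= setUC. Qed.

Lemma singleton_types : 0 < h -> exists l, [/\ all (is_type D h t) l, size l <= n & demands l].
Proof.
move=> h0; have [|l [l1 l2 l3 _]] := @labels_to_types _ (id : 'I_n -> 'I_n); last by exists l.
by move=> x; rewrite (eq_card (B := pred1 x)) ?card1 // => v; rewrite !inE.
Qed.

(** The blocks are the components after deletion. A surviving edge stays within one component, so
    only deleted edges can cross between blocks. *)
Lemma deletion_to_types k : T_free_edge_deletion G k h ->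
  exists l, [/\ all (is_type D h t) l, size l <= n, demands l &
    2 * #|edges G| <= 2 * k + \sum_(a <- l) block_weight a].
Proof.
move=> [F [sF cF hF]]; set E := edges G :\: F in hF.
have compP u v : (component E u == component E v) = connect (adj E) u v.
  apply/eqP/idP => [/setP/(_ v)|]; rewrite ?inE ?connect0 // => huv.
  by apply/setP => w; rewrite !inE (same_connect (@adj_sym E) huv).
have [|l [l1 l2 l3 l4]] := @labels_to_types _ (component E).
  move=> x; case: (pickP (fun u => component E u == x)) => [u /eqP<-|none].
    apply: leq_trans (hF u); apply: subset_leq_card; apply/subsetP => v.
    by rewrite !inE eq_sym compP.
  by rewrite (eq_card (B := pred0)) ?card0 // => u; rewrite !inE none.
exists l; split=> //; rewrite l4 -mulnDr leq_mul2l /=.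
rewrite -(cardsID F (edges G)); apply: leq_add.
  by apply: leq_trans cF; apply: subset_leq_card; apply: subsetIr.
apply: subset_leq_card; apply/subsetP => e eE.
have /andP[_ eG] : (e \notin F) && (e \in edges G) by rewrite -in_setD.
have /eqP/cards2P[u [v [_ ev]]] := edges_card2 eG.
rewrite ev in eE eG *; rewrite within_labelsE eG compP /=.
exact: connect1.
Qed.

(** All edges between different blocks are deleted; labels are then constant along paths, so a
    component stays inside one block. *)
Lemma types_to_deletion k l : all (is_type D h t) l -> demands l ->
  2 * #|edges G| <= 2 * k + \sum_(a <- l) block_weight a ->
  T_free_edge_deletion G k h.
Proof.
move=> l1 l2 l3.
have [lab hlab] := types_to_labels l2.
have lab_lt v : lab v < size l.
  case: l hlab l2 {l1 l3} => [|a l] hlab l2; last first.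
    by apply: (hlab 0 isT (ty v) (ty_lt v)).2.
  have := l2 _ (ty_lt v); rewrite big_nil => /esym/eqP; rewrite cards_eq0 => /eqP/setP/(_ v).
  by rewrite !inE eqxx.
have dE j i : j < size l -> i < t -> dig D i (nth 0 l j) = #|of_type [set v | lab v == j] i|.
  move=> hj hi; rewrite -(hlab j hj i hi).1; congr #|pred_of_set _|.
  by apply/setP => v; rewrite !inE.
pose labo v := Ordinal (lab_lt v).
have card_lab j : j < size l -> #|[set v | lab v == j]| <= h.
  move=> hj; rewrite card_by_type.
  have /andP[_] := allP l1 _ (mem_nth 0 hj); apply: leq_trans.
  by apply: leq_sum => i _; rewrite dE.
have wE : \sum_(a <- l) block_weight a = 2 * #|within_labels lab|.
  rewrite (big_nth 0) big_mkord.
  transitivity (\sum_(j in 'I_(size l)) \sum_(u in [set u | lab u == j])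
     \sum_(v in [set v | lab v == j]) ([set u; v] \in edges G)).
    by apply: eq_bigr => j _; rewrite (block_weightE (fun i => dE j i (ltn_ord j))).
  rewrite -double_count; last by apply/subsetP => e; rewrite inE => /andP[].
  rewrite [RHS](partition_big labo xpredT) //=.
  apply: eq_bigr => j _; apply: eq_big => [u|u]; rewrite inE -?val_eqE //= => /eqP eu.
  rewrite big_mkcond /=; apply: eq_bigr => v _; rewrite within_labelsE inE eu eq_sym.
  by case: eqP; rewrite ?andbT ?andbF.
rewrite wE -mulnDr leq_mul2l /= in l3.
have sub : within_labels lab \subset edges G by apply/subsetP => e; rewrite inE => /andP[].
exists (edges G :\: within_labels lab); split.
- exact: subsetDl.
- by rewrite cardsDS // leq_subLR addnC.
- rewrite setDDr setDv set0U (setIidPr sub) => u.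
  apply: leq_trans (card_lab _ (lab_lt u)); apply: subset_leq_card; apply/subsetP => v.
  rewrite !inE => /connectP[p hp ->] {v}.
  elim: p u hp => //= w p IH u /andP[].
  rewrite /adj /= within_labelsE => /andP[_ /eqP->]; exact: IH.
Qed.

End Blocks.

(** * Graphs of bounded neighbourhood diversity *)

Section TwinTypes.

Variables (n : nat) (G : sgraph n) (s : seq ('I_n * 'I_n)).
Hypothesis s_edges : edge_listing G s.

Definition nat_edges : seq (nat * nat) := [seq (val p.1, val p.2) | p <- s].
Local Notation es := nat_edges.
Local Notation E := (edges G).

Lemma size_nat_edges : size es = #|E|.
Proof.
by rewrite size_map -(size_map (fun p => [set p.1; p.2])) (perm_size s_edges) -cardE.
Qed.

Lemma nat_edges_lt p : p \in es -> p.1 < n /\ p.2 < n.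
Proof. by case/mapP => q _ -> /=; split. Qed.

Lemma loopless p : p \in s -> p.1 != p.2.
Proof.
move=> hp; have : [set p.1; p.2] \in [seq [set q.1; q.2] | q <- s] by apply: map_f.
rewrite (perm_mem s_edges) mem_enum => /edges_card2; apply: contra_eqN => /eqP->.
by rewrite setUid cards1.
Qed.

Lemma edgeC u v : ([set u; v] \in E) = ([set v; u] \in E).
Proof. by rewrite setUC. Qed.

(** The listing has neither repeated edges nor loops, so a neighbour occurs in the row once,
    whichever way round its edge is listed. *)
Lemma count_neighbours (u v : 'I_n) :
  count_mem (val v) (behead (row es u)) = ([set u; v] \in E).
Proof.
rewrite -mem_enum -(perm_mem s_edges) -count_uniq_mem; last first.
  by rewrite (perm_uniq s_edges) enum_uniq.
rewrite /row /= count_flatten -!map_comp /nat_edges count_map.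
have: {in s, forall p, p.1 != p.2} by exact: loopless.
elim: s => //= p r IH hr; rewrite IH; last by move=> q hq; apply: hr; rewrite inE hq orbT.
congr (_ + _); have := hr _ (mem_head _ _); case: p {hr} => x y /= nxy.
have -> : count_mem (val v) (nbrs u (val x, val y)) =
    (x == u) && (y == v) + (y == u) && (x == v).
  rewrite /nbrs count_cat /= !val_eqE.
  by case: (x == u); case: (y == u); rewrite /= ?val_eqE ?addn0.
have -> : ([set x; y] == [set u; v]) = (x == u) && (y == v) || (y == u) && (x == v).
  apply/eqP/orP => [e|[]/andP[/eqP<- /eqP<-] //]; last by rewrite setUC.
  have : x \in [set u; v] by rewrite -e set21.
  have : y \in [set u; v] by rewrite -e set22.
  rewrite !inE => /orP[]/eqP ey /orP[]/eqP ex; subst; rewrite ?eqxx ?andbT in nxy *.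
  - by [].
  - by right.
  - by left.
  - by [].
have : ~~ [&& (x == u) && (y == v) & (y == u) && (x == v)].
  by apply/negP => /andP[/andP[/eqP xu _] /andP[/eqP yu _]]; rewrite xu yu eqxx in nxy.
by case: (x == u); case: (y == v); case: (y == u); case: (x == v).
Qed.

Lemma mem_row_lt u x : u < n -> x \in row es u -> x < n.
Proof.
move=> hu; rewrite inE => /predU1P[->//|/flattenP[r /mapP[p hp ->]]].
have [h1 h2] := nat_edges_lt hp.
by rewrite /nbrs mem_cat => /orP[]; case: ifP => _ //; rewrite inE => /eqP->.
Qed.

Lemma mem_neighbours (u v : 'I_n) : (val v \in behead (row es u)) = ([set u; v] \in E).
Proof. by rewrite -has_pred1 has_count count_neighbours lt0b. Qed.

Lemma uniq_neighbours u : u < n -> uniq (behead (row es u)).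
Proof.
move=> hu; apply: count_mem_uniq => x.
case: (ltnP x n) => hx.
  by rewrite (count_neighbours (Ordinal hu) (Ordinal hx))
             (mem_neighbours (Ordinal hu) (Ordinal hx)).
have nx : x \notin behead (row es u).
  by apply/negP => /mem_behead/(mem_row_lt hu); rewrite ltnNge hx.
by rewrite (negPf nx); apply/count_memPn.
Qed.

Lemma uniq_row u : u < n -> uniq (row es u).
Proof.
move=> hu; have := uniq_neighbours hu; rewrite /= => ->; rewrite andbT.
by have := mem_neighbours (Ordinal hu) (Ordinal hu); rewrite /= edge_irrefl => ->.
Qed.

Lemma sum_size_rows : \sum_(u < n) size (row es u) = n + 2 * size es.
Proof.
have sz u : size (row es u) = 1 + \sum_(p <- es) ((p.1 == u) + (p.2 == u)).
  rewrite /row /= add1n size_flatten /shape -map_comp sumnE big_map; congr _.+1.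
  by apply: eq_bigr => p _; rewrite /= /nbrs size_cat; do 2! case: ifP.
under eq_bigr => u _ do rewrite sz.
rewrite big_split sum_nat_const card_ord muln1 exchange_big; congr (_ + _) => /=.
rewrite -sum1_size big_distrr !big_seq; apply: eq_bigr => p /nat_edges_lt[h1 h2].
rewrite big_split /= (bigD1 (Ordinal h1)) //= eqxx big1; last first.
  by move=> u; rewrite -val_eqE /= eq_sym => /negPf->.
rewrite (bigD1 (Ordinal h2)) //= eqxx big1 // => u.
by rewrite -val_eqE /= eq_sym => /negPf->.
Qed.

Definition twin_like u v :=
  (closed_nbh G u == closed_nbh G v) || (open_nbh G u == open_nbh G v).

(** The two kinds of twins cannot meet at a vertex: [u] is adjacent to [v], hence to [w]; then [w]
    lies in the closed neighbourhood of [v], so it is adjacent to [v]; and then [v] would be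
    adjacent to itself. This makes the union of both relations transitive. *)
Lemma open_closed_eq u v w : u != v -> v != w ->
  closed_nbh G u = closed_nbh G v -> open_nbh G v = open_nbh G w -> False.
Proof.
move=> nuv nvw hc ho.
have uv : [set u; v] \in E.
  by have /setP/(_ v) := hc; rewrite !inE !eqxx /= eq_sym (negPf nuv).
have wu : [set w; u] \in E.
  by have /setP/(_ u) := ho; rewrite !inE /adj /= => <-; rewrite edgeC.
have wv : [set w; v] \in E.
  have /setP/(_ w) := hc; rewrite !inE /adj /= edgeC wu orbT.
  by rewrite eq_sym (negPf nvw) /= edgeC => /esym.
by have /setP/(_ v) := ho; rewrite !inE /adj /= wv edge_irrefl.
Qed.

Lemma twin_like_trans u v w : twin_like u v -> twin_like v w -> twin_like u w.
Proof.
case: (eqVneq u v) => [->//|nuv]; case: (eqVneq v w) => [->//|nvw].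
move=> /orP[]/eqP h1 /orP[]/eqP h2; rewrite /twin_like.
- by rewrite h1 h2 eqxx.
- by case: (open_closed_eq nuv nvw h1 h2).
- by case: (@open_closed_eq w v u) => //; rewrite // eq_sym.
- by rewrite h1 h2 eqxx orbT.
Qed.

Lemma twin_like_sym u v : twin_like u v = twin_like v u.
Proof. by rewrite /twin_like eq_sym (eq_sym (open_nbh _ _)). Qed.

Lemma twin_like_adj x u y : twin_like x u -> y != x -> y != u ->
  ([set x; y] \in E) = ([set u; y] \in E).
Proof.
move=> /orP[]/eqP/setP/(_ y); rewrite !inE /adj //= => e nx nu.
by move: e; rewrite (negPf nx) (negPf nu).
Qed.

(** Endpoints are exchanged one at a time. The delicate case is [y = u], where the intermediate pair
    would collapse to a single vertex. *)
Lemma twin_like_edge x y u v : twin_like x u -> twin_like y v -> x != y -> u != v ->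
  [set x; y] \in E -> [set u; v] \in E.
Proof.
move=> xu yv nxy nuv hxy.
case: (eqVneq y u) => [yu|nyu]; last first.
  have uy : [set u; y] \in E by rewrite -(twin_like_adj xu) // eq_sym.
  by rewrite edgeC -(twin_like_adj yv) ?(eq_sym u) // 1?eq_sym // edgeC.
subst y; case: (eqVneq x v) => [<-|nxv]; first by rewrite edgeC.
have vx : [set v; x] \in E by rewrite -(twin_like_adj yv) // edgeC.
by rewrite edgeC (twin_like_adj (u := x)) // 1?twin_like_sym 1?(twin_like_trans xu) ?(eq_sym u) // edgeC.
Qed.

Lemma labels_twin_like (lo lc : nat -> nat) :
  (forall u v, lo u = lo v <-> forall w, w < n ->
     (u \in drop 1 (row es w)) = (v \in drop 1 (row es w))) ->
  (forall u v, lc u = lc v <-> forall w, w < n ->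
     (u \in drop 0 (row es w)) = (v \in drop 0 (row es w))) ->
  forall u v : 'I_n, same_label lo lc u v = twin_like u v.
Proof.
move=> ho hc u v; rewrite /same_label /twin_like; congr (_ || _).
  have mem (x w : 'I_n) : ((x : nat) \in drop 0 (row es w)) = (w \in closed_nbh G x).
    rewrite drop0 inE mem_neighbours !inE /adj /= edgeC val_eqE eq_sym //.
  apply/eqP/eqP => [/hc h|h].
    by apply/setP => w; rewrite -(mem u w) -(mem v w) h.
  by apply/hc => w hw; rewrite (mem u (Ordinal hw)) (mem v (Ordinal hw)) h.
have mem (x w : 'I_n) : ((x : nat) \in drop 1 (row es w)) = (w \in open_nbh G x).
  by rewrite drop1 mem_neighbours !inE /adj /= edgeC.
apply/eqP/eqP => [/ho h|h].
  by apply/setP => w; rewrite -(mem u w) -(mem v w) h.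
by apply/ho => w hw; rewrite (mem u (Ordinal hw)) (mem v (Ordinal hw)) h.
Qed.

Lemma type_edgeE (ty : nat -> nat) :
  (forall u v : 'I_n, (ty u == ty v) = twin_like u v) ->
  forall u v : 'I_n, u != v ->
    type_edge ty es (ty u) (ty v) = ([set u; v] \in E).
Proof.
move=> hty u v nuv; apply/hasP/idP => [[p /mapP[[x y] hp ->]]|] /=.
  have hxy : [set x; y] \in E.
    by rewrite -mem_enum -(perm_mem s_edges); apply/mapP; exists (x, y).
  have nxy := loopless hp; rewrite /= !hty in nxy *.
  case/orP => /andP[h1 h2]; first exact: twin_like_edge hxy.
  by apply: (@twin_like_edge y x) => //; rewrite 1?eq_sym // edgeC.
rewrite -mem_enum -(perm_mem s_edges) => /mapP[[x y] hp e].
exists (val x, val y); first by apply/mapP; exists (x, y).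
have nxy := loopless hp; rewrite /= in nxy *.
have : x \in [set u; v] by rewrite e set21.
have : y \in [set u; v] by rewrite e set22.
rewrite !inE => /orP[]/eqP ey /orP[]/eqP ex; subst; rewrite ?eqxx ?orbT // in nxy *.
Qed.

(** Representatives of different twin classes lie in different blocks of any partition into sets of
    twins. *)
Lemma types_le_diversity (ty : nat -> nat) (t d : nat) :
  (forall u v : 'I_n, (ty u == ty v) = twin_like u v) ->
  (forall j, j < t -> exists2 u, u < n & ty u = j) ->
  nbh_diversity_at_most G d -> t <= d.
Proof.
move=> hty onto [Q [/and3P[/eqP covQ trivQ _] cQ hQ]].
apply: leq_trans cQ.
have ex (j : 'I_t) : exists u : 'I_n, ty u == j.
  by have [u hu e] := onto j (ltn_ord j); exists (Ordinal hu); apply/eqP.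
pose f j := pblock Q (xchoose (ex j)).
have inj : injective f.
  move=> j j' e; apply/val_inj => /=.
  rewrite -(eqP (xchooseP (ex j))) -(eqP (xchooseP (ex j'))); apply/eqP; rewrite hty.
  set u := xchoose _; set v := xchoose _.
  case: (eqVneq u v) => [->|/eqP nuv]; first by rewrite /twin_like eqxx.
  have uQ : u \in cover Q by rewrite covQ inE.
  have vQ : v \in cover Q by rewrite covQ inE.
  have uB : u \in pblock Q u by rewrite mem_pblock.
  have vB : v \in pblock Q u by rewrite -/(f j) e mem_pblock.
  have [_] := hQ _ (pblock_mem uQ) u v uB vB nuv.
  by rewrite /twin_like => -[->|->]; rewrite eqxx ?orbT.
rewrite -(card_ord t) -(card_imset predT inj); apply: subset_leq_card.
apply/subsetP => _ /imsetP[j _ ->]; apply: pblock_mem.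
by rewrite covQ inE.
Qed.

End TwinTypes.

(** * Compilation to the word RAM *)

Section Compile.

Definition n_arrays := 16.

(* Array 0 is the read-only input, with out-of-range indices clamped to the
   unused cell [2m]; array [j.+1] is interleaved with the others above it. *)
Definition address j e :=
  Bin OpAdd (Bin OpAdd (Bin OpMul (Const 2) (Reg 1)) (Const j))
            (Bin OpMul e (Const n_arrays)).

(** With truncated subtraction, [e' - (e' - 2m)] is the minimum of [e'] and [2m], so clamping needs
    no branch. *)
Fixpoint compile_expr (e : aexpr) : expr :=
  match e with
  | Cst v => Const v
  | Rd r => Reg r
  | Get 0 e1 =>
      let e' := compile_expr e1 in
      Fetch (Bin OpSub e' (Bin OpSub e' (Bin OpMul (Const 2) (Reg 1))))
  | Get j e1 => Fetch (address j (compile_expr e1))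
  | Op o e1 e2 => Bin o (compile_expr e1) (compile_expr e2)
  end.

Fixpoint compile (c : acmd) : cmd :=
  match c with
  | ANop => Skip
  | ASet r e => Set_reg r (compile_expr e)
  | APut j e1 e2 => Store (address j (compile_expr e1)) (compile_expr e2)
  | ASeq c1 c2 => Seq (compile c1) (compile c2)
  | AIf e c1 c2 => If (compile_expr e) (compile c1) (compile c2)
  | AFor r l c1 =>
      Seq (Set_reg r (Const 0))
        (While (Bin OpLt (Reg r) (Reg l))
           (Seq (compile c1) (Set_reg r (Bin OpAdd (Reg r) (Const 1)))))
  end.

Fixpoint wf_expr (e : aexpr) : bool :=
  match e with
  | Get j e1 => (j <= n_arrays) && wf_expr e1
  | Op _ e1 e2 => wf_expr e1 && wf_expr e2
  | _ => true
  end.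

(** Register 1 must keep [m], the base of all addresses. A loop body may assign neither the counter
    nor the bound, so that the compiled [While] makes as many rounds as [AFor]. *)
Fixpoint wf_cmd (c : acmd) : bool :=
  match c with
  | ANop => true
  | ASet r e => (r != 1) && wf_expr e
  | APut j e1 e2 => [&& 0 < j, j <= n_arrays, wf_expr e1 & wf_expr e2]
  | ASeq c1 c2 => wf_cmd c1 && wf_cmd c2
  | AIf e c1 c2 => [&& wf_expr e, wf_cmd c1 & wf_cmd c2]
  | AFor r l c1 => [&& r != 1, l != r, ~~ wreg c1 r, ~~ wreg c1 l & wf_cmd c1]
  end.

Fixpoint expr_value (s : state) (e : expr) : nat :=
  match e with
  | Const v => v
  | Reg r => regs s r
  | Fetch e1 => cells s (expr_value s e1)
  | Bin o e1 e2 => binop_sem o (expr_value s e1) (expr_value s e2)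
  end.

(* If registers and cells are at most [M] then [e] evaluates to at most
   [M ^ degree e]. *)
Fixpoint degree (e : expr) : nat :=
  match e with
  | Const v => v.+1
  | Reg _ => 1
  | Fetch e1 => (degree e1).+1
  | Bin _ e1 e2 => (degree e1 + degree e2).+1
  end.

(** The 10 for a loop covers its test and its increment, of degrees 3 and 4. *)
Fixpoint cmd_degree (c : acmd) : nat :=
  match c with
  | ANop => 0
  | ASet _ e => degree (compile_expr e)
  | APut j e1 e2 => degree (address j (compile_expr e1)) + degree (compile_expr e2)
  | ASeq c1 c2 => cmd_degree c1 + cmd_degree c2
  | AIf e c1 c2 => degree (compile_expr e) + cmd_degree c1 + cmd_degree c2
  | AFor _ _ c1 => cmd_degree c1 + 10
  end.

(** The 8 for a loop pays for one round of control: a test with its step, 4, and an increment, 4. *)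
Fixpoint step_cost (c : acmd) : nat :=
  match c with
  | ANop => 1
  | ASet _ e => (ecost (compile_expr e)).+1
  | APut j e1 e2 => (ecost (address j (compile_expr e1)) + ecost (compile_expr e2)).+1
  | ASeq c1 c2 => step_cost c1 + step_cost c2
  | AIf e c1 c2 => (ecost (compile_expr e) + step_cost c1 + step_cost c2).+1
  | AFor _ _ c1 => step_cost c1 + 8
  end.

Variables (w M : nat).
Hypothesis M_ge2 : 2 <= M.

Lemma expn_le d d' : d <= d' -> M ^ d <= M ^ d'.
Proof. by move=> h; rewrite leq_pexp2l // ltnW. Qed.

Lemma evalE s e : (forall r, regs s r <= M) -> (forall x, cells s x <= M) ->
  M ^ degree e < 2 ^ w ->
  eval w s e = Some (expr_value s e) /\ expr_value s e <= M ^ degree e.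
Proof.
move=> hr hc; elim: e => [v|r|e IH|o e1 IH1 e2 IH2] /= hw.
- have hv : v <= M ^ v.+1.
    by apply: leq_trans (expn_le (leqnSn v)); apply/ltnW/ltn_expl.
  by rewrite /word (leq_ltn_trans hv hw).
- have hv : regs s r <= M ^ 1 by rewrite expn1.
  by rewrite /word (leq_ltn_trans hv hw).
- have [-> _] := IH (leq_ltn_trans (expn_le (leqnSn _)) hw).
  have hv : cells s (expr_value s e) <= M ^ (degree e).+1.
    by apply: leq_trans (hc _) _; rewrite -{1}[M]expn1 expn_le.
  by rewrite /word (leq_ltn_trans hv hw).
- have [-> h1] := IH1 (leq_ltn_trans (expn_le (leqW (leq_addr _ _))) hw).
  have [-> h2] := IH2 (leq_ltn_trans (expn_le (leqW (leq_addl _ _))) hw).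
  have p1 : 0 < M ^ degree e1 by rewrite expn_gt0 ltnW.
  have p2 : 0 < M ^ degree e2 by rewrite expn_gt0 ltnW.
  have hv : binop_sem o (expr_value s e1) (expr_value s e2) <=
            M ^ (degree e1 + degree e2).+1.
    rewrite expnS expnD; set x := expr_value _ _ in h1 *; set y := expr_value _ _ in h2 *.
    move: (M ^ degree e1) (M ^ degree e2) p1 p2 h1 h2 => X Y p1 p2 h1 h2.
    have hX' : X <= X * Y by rewrite leq_pmulr.
    have hY' : Y <= X * Y by rewrite leq_pmull.
    have hZ : 2 * (X * Y) <= M * (X * Y) by rewrite leq_mul2r M_ge2 orbT.
    have hX : X <= M * (X * Y) by lia.
    have hY : 1 <= M * (X * Y) by lia.
    case: o => /=.
    + by lia.
    + by apply: leq_trans hX; apply: leq_trans h1; apply: leq_subr.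
    + by apply: (@leq_trans (X * Y)); [apply: leq_mul | lia].
    + by apply: leq_trans hX; apply: leq_trans h1; apply: leq_div.
    + by apply: leq_trans hX; apply: leq_trans h1; apply: leq_mod.
    + by apply: leq_trans hY; apply: leq_b1.
    + by apply: leq_trans hY; apply: leq_b1.
  by rewrite /word (leq_ltn_trans hv hw).
Qed.

Definition simulates (a : astate) (s : state) : Prop :=
  [/\ forall r, regs s r = rg a r,
      forall i, cells s (minn i (2 * rg a 1)) = ar a 0 i
    & forall j i, 0 < j <= n_arrays ->
        cells s (2 * rg a 1 + j + i * n_arrays) = ar a j i].

(** Each cell above [2m] belongs to an interleaved array, so bounds on the arrays bound the whole
    memory. *)
Lemma simulates_small a s : simulates a s -> small M a ->
  (forall r, regs s r <= M) /\ (forall x, cells s x <= M).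
Proof.
move=> [h1 h2 h3] [hr ha]; split=> [r|x]; first by rewrite h1.
case: (leqP x (2 * rg a 1)) => hx.
  by have := h2 x; rewrite (minn_idPl hx) => ->.
have e : x = 2 * rg a 1 + ((x - (2 * rg a 1).+1) %% n_arrays).+1 +
             (x - (2 * rg a 1).+1) %/ n_arrays * n_arrays.
  by have := divn_eq (x - (2 * rg a 1).+1) n_arrays; lia.
by rewrite e h3 // ltn_pmod.
Qed.

Lemma compile_exprE a s e : simulates a s -> wf_expr e ->
  expr_value s (compile_expr e) = ev a e.
Proof.
move=> [h1 h2 h3]; elim: e => [v|r|[|j] e IH|o e1 IH1 e2 IH2] //=.
- move=> /IH ->; rewrite h1 -h2; congr (cells s _); lia.
- by move=> /andP[hj /IH ->]; rewrite h1 h3.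
- by move=> /andP[/IH1 -> /IH2 ->].
Qed.

Lemma simulates_setr a s r v : r != 1 -> simulates a s ->
  simulates (setr a r v) (set_reg s r v).
Proof.
move=> hr [h1 h2 h3]; have r1 : rg (setr a r v) 1 = rg a 1.
  by rewrite /= /upd eq_sym (negPf hr).
by split; rewrite ?r1 //= => x; rewrite /upd h1.
Qed.

Lemma simulates_seta a s j i v : 0 < j <= n_arrays -> simulates a s ->
  simulates (seta a j i v) (set_mem s (2 * rg a 1 + j + i * n_arrays) v).
Proof.
move=> hj [h1 h2 h3]; split=> //= [i'|j' i' hj'].
  rewrite /upd; have -> : (0 == j) = false by lia.
  rewrite -h2; case: eqP => // e; have := geq_minr i' (2 * rg a 1); lia.
have -> : (2 * rg a 1 + j' + i' * n_arrays == 2 * rg a 1 + j + i * n_arrays) =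
          (j' == j) && (i' == i).
  by move: hj hj'; rewrite /n_arrays; lia.
rewrite /upd; case: (j' =P j) => [->|_] /=; last exact: h3.
by case: eqP => // _; apply: h3.
Qed.

Lemma turn_reg r c i a x : ~~ wreg c x -> x != r -> rg (turn r c i a) x = rg a x.
Proof.
move=> hx /negPf nxr; rewrite /= /upd nxr; elim: i => // i IH.
by rewrite iteri_turn (run_same_outside c _).1 //= /upd nxr IH.
Qed.

Lemma turn_small r c n a : n <= M -> small M a ->
  (forall i, i < n -> within M c (turn r c i a)) ->
  forall i, i <= n -> small M (turn r c i a).
Proof.
move=> hn sm hw; elim=> [_|i IH hi]; first exact: small_setr.
apply: small_setr; last exact: leq_trans hn.
by rewrite iteri_turn; apply: small_run (hw _ hi); apply/IH/ltnW.
Qed.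

Lemma turnS r c i a : turn r c i.+1 a = setr (run c (turn r c i a)) r i.+1.
Proof. by []. Qed.

Theorem compile_exec c a s : wf_cmd c -> simulates a s -> small M a -> within M c a ->
  M ^ cmd_degree c < 2 ^ w ->
  exists T s', [/\ exec w s (compile c) T s', T <= step_cost c * cost c a &
    simulates (run c a) s'].
Proof.
elim: c a s => [|r e|j e1 e2|c1 IH1 c2 IH2|e c1 IH1 c2 IH2|r l c IH] a s.
- by move=> _ sim _ _ _; exists 1, s; split=> //; apply: ExecSkip.
- move=> /andP[hr he] sim sm _ hw; have [b1 b2] := simulates_small sim sm.
  have [ee _] := evalE b1 b2 hw; rewrite (compile_exprE sim he) in ee.
  exists (ecost (compile_expr e)).+1, (set_reg s r (ev a e)); split.
  + exact: ExecSet.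
  + by rewrite /= muln1.
  + exact: simulates_setr.
- move=> /and4P[j0 jA h1 h2] sim sm _ hw; have [b1 b2] := simulates_small sim sm.
  have [ee1 _] := evalE b1 b2 (leq_ltn_trans (expn_le (leq_addr _ _)) hw).
  have [ee2 _] := evalE b1 b2 (leq_ltn_trans (expn_le (leq_addl _ _)) hw).
  have hj : 0 < j <= n_arrays by rewrite j0 jA.
  rewrite (compile_exprE sim h2) in ee2.
  have ea : expr_value s (address j (compile_expr e1)) = 2 * rg a 1 + j + ev a e1 * n_arrays.
    by have [r1 _ _] := sim; rewrite /= (compile_exprE sim h1) r1.
  rewrite ea in ee1.
  exists (ecost (address j (compile_expr e1)) + ecost (compile_expr e2)).+1,
    (set_mem s (2 * rg a 1 + j + ev a e1 * n_arrays) (ev a e2)); split.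
  + exact: ExecStore.
  + by rewrite [cost _ _]/= muln1.
  + exact: simulates_seta.
- move=> /andP[h1 h2] sim sm [w1 w2] hw.
  have [T1 [s1 [x1 t1 sim1]]] := IH1 _ _ h1 sim sm w1 (leq_ltn_trans (expn_le (leq_addr _ _)) hw).
  have [T2 [s2 [x2 t2 sim2]]] := IH2 _ _ h2 sim1 (small_run sm w1) w2
    (leq_ltn_trans (expn_le (leq_addl _ _)) hw).
  exists (T1 + T2), s2; split=> //; first exact: ExecSeq x1 x2.
  by rewrite /=; nia.
- move=> /and3P[he h1 h2] sim sm hwi hw; have [b1 b2] := simulates_small sim sm.
  have [ee _] := evalE b1 b2
    (leq_ltn_trans (expn_le (leq_trans (leq_addr _ _) (leq_addr _ _))) hw).
  rewrite (compile_exprE sim he) in ee.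
  have d1 : M ^ cmd_degree c1 < 2 ^ w.
    by apply: leq_ltn_trans hw; apply: expn_le; rewrite /=; lia.
  have d2 : M ^ cmd_degree c2 < 2 ^ w.
    by apply: leq_ltn_trans hw; apply: expn_le; rewrite /=; lia.
  rewrite /= in hwi *.
  case: (ev a e =P 0) => [e0|e0].
    rewrite e0 /= in ee hwi *.
    have [T [s' [x t sim']]] := IH2 _ _ h2 sim sm hwi d2.
    exists (ecost (compile_expr e) + T).+1, s'; split=> //.
      exact: (@ExecIf w s s' _ 0 _ _ T ee x).
    by rewrite /=; nia.
  have /negPf/negbT ne : (ev a e == 0) = false by apply/eqP.
  rewrite ne in hwi *.
  have [T [s' [x t sim']]] := IH1 _ _ h1 sim sm hwi d1.
  exists (ecost (compile_expr e) + T).+1, s'; split=> //.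
    by apply: (@ExecIf w s s' _ (ev a e) _ _ T ee); rewrite ne.
  by rewrite /=; nia.
- move=> /and5P[hr1 hlr hcr hcl hc] sim sm hwi hw.
  set n := rg a l; set K := step_cost c.
  have nM : n <= M by exact: sm.1.
  have dc : M ^ cmd_degree c < 2 ^ w.
    by apply: leq_ltn_trans hw; apply: expn_le; rewrite /=; lia.
  have d10 : M ^ 10 < 2 ^ w by apply: leq_ltn_trans hw; apply: expn_le; rewrite /=; lia.
  have hsm := turn_small nM sm hwi.
  have rturn i : rg (turn r c i a) r = i by rewrite /= /upd eqxx.
  have lturn i : rg (turn r c i a) l = n by rewrite turn_reg.
  pose body := Seq (compile c) (Set_reg r (Bin OpAdd (Reg r) (Const 1))).
  pose test := Bin OpLt (Reg r) (Reg l).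
  have loop d : forall i s1, i + d = n -> simulates (turn r c i a) s1 ->
      exists T s', [/\ exec w s1 (While test body) T s',
        T <= \sum_(j < d) (K * cost c (turn r c (i + j) a) + 8) + 4
        & simulates (turn r c n a) s'].
    elim: d => [|d IHd] i s1 hi sim1.
      rewrite addn0 in hi; rewrite hi in sim1.
      have [b1 b2] := simulates_small sim1 (hsm _ (leqnn _)).
      have tw : M ^ degree test < 2 ^ w by apply: leq_ltn_trans d10; apply: expn_le.
      have [ee _] := evalE b1 b2 tw.
      have [r1 _ _] := sim1.
      have vt : expr_value s1 test = 0 by rewrite /= !r1 rturn lturn ltnn.
      rewrite vt in ee.
      exists 4, s1; split=> //; first exact: (@ExecWhileFalse w s1 test body ee).
      by rewrite big_ord0.
    have hin : i < n by lia.
    have smi := hsm i (ltnW hin).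
    have [b1 b2] := simulates_small sim1 smi.
    have tw : M ^ degree test < 2 ^ w by apply: leq_ltn_trans d10; apply: expn_le.
    have [ee _] := evalE b1 b2 tw.
    have [r1 _ _] := sim1.
    have vt : expr_value s1 test = 1 by rewrite /= !r1 rturn lturn hin.
    rewrite vt in ee.
    have [T1 [s2 [x1 t1 sim2]]] := IH _ _ hc sim1 smi (hwi _ hin) dc.
    have smr := small_run smi (hwi _ hin).
    have [b1' b2'] := simulates_small sim2 smr.
    have iw : M ^ degree (Bin OpAdd (Reg r) (Const 1)) < 2 ^ w.
      by apply: leq_ltn_trans d10; apply: expn_le.
    have [ei _] := evalE b1' b2' iw.
    have [r2 _ _] := sim2.
    have vi : expr_value s2 (Bin OpAdd (Reg r) (Const 1)) = i.+1.
      by rewrite /= r2 (run_same_outside c _).1 // rturn addn1.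
    rewrite vi in ei.
    have sim3 : simulates (turn r c i.+1 a) (set_reg s2 r i.+1).
      by rewrite turnS; apply: simulates_setr.
    have [|T2 [s3 [x2 t2 sim4]]] := IHd i.+1 _ _ sim3; first by lia.
    exists (3 + (T1 + 4) + T2).+1, s3; split=> //.
      apply: (@ExecWhileTrue w s1 (set_reg s2 r i.+1) s3 test 1 body (T1 + 4) T2 ee) => //.
      by apply: ExecSeq x1 _; apply: (ExecSet _ ei).
    rewrite big_ord_recl addn0.
    rewrite (eq_bigr (fun j : 'I_d => K * cost c (turn r c (i.+1 + j) a) + 8)); last first.
      by move=> j _; rewrite /= addSnnS.
    move: t1 t2; rewrite -/K.
    by move: (K * cost c (turn r c i a)) (\sum_(j < d) _) => A B; lia.
  have sim0 : simulates (turn r c 0 a) (set_reg s r 0) by apply: simulates_setr.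
  have [T [s' [x t sim']]] := loop n 0 _ (add0n n) sim0.
  exists (2 + T), s'; split=> //.
    apply: ExecSeq x; apply: (@ExecSet w s r (Const 0) 0).
    by rewrite /= /word expn_gt0.
  rewrite /= -/K -/n mulnS big_distrr /=.
  have -> : \sum_(i < n) (K + 8) * (cost c (turn r c i a)).+1 =
    \sum_(i < n) (K * cost c (turn r c i a) + 8) +
    \sum_(i < n) (8 * cost c (turn r c i a) + K).
    by rewrite -big_split; apply: eq_bigr => i _ /=; lia.
  by move: t; under eq_bigr => j _ do rewrite add0n; lia.
Qed.

End Compile.

(** * The algorithm *)

Definition find_types : acmd :=
  (build_rows ;; refine 1 aTrieO aLabO ;; refine 0 aTrieC aLabC ;;
   classify ;; link_types)%C.

Definition fill_tables : acmd :=
  (binomial_loop ;; radix_setup ;; digit_tables ;; weight_table ;; scale_loop)%C.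

(* If [n <= h] nothing has to be deleted; this also covers [n = 1], where the
   parameter term of the time bound vanishes. *)
Definition solve : acmd :=
  AIf (Rh < Rn)%A (ASeq find_types (ASeq fill_tables dynamic_program)) (Rn <-- #1)%C.

Lemma wf_solve : wf_cmd solve.
Proof. by []. Qed.

Definition start n (s : seq ('I_n * 'I_n)) k h : astate :=
  AState (nth 0 [:: n; size s; k; h])
    (fun j => if j == 0 then input_array (nat_edges s) else fun=> 0).

Lemma small_start n (G : sgraph n) (s : seq ('I_n * 'I_n)) k h M :
  edge_listing G s -> n + #|edges G| + k + h <= M -> small M (start s k h).
Proof.
move=> s_edges hM; have sz : size s = #|edges G|.
  by rewrite -(size_nat_edges s_edges) size_map.
split=> [r|j i] /=.
  by apply: leq_trans hM; rewrite sz; case: r => [|[|[|[|r]]]] /=; rewrite ?nth_nil; lia.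
case: eqP => // _; apply: (@leq_trans n); last by lia.
rewrite /input_array; set l := flatten _.
case: (ltnP i (size l)) => hi; last by rewrite nth_default.
have /flattenP[r /mapP[p hp ->]] := mem_nth 0 hi.
have [h1 h2] := nat_edges_lt hp.
by rewrite !inE => /orP[]/eqP->; apply: ltnW.
Qed.

Lemma solve_trivial n (G : sgraph n) (s : seq ('I_n * 'I_n)) k h M :
  n <= h -> 0 < M ->
  triple M solve (start s k h) 2 (fun s' => rg s' Rn != 0 <-> T_free_edge_deletion G k h).
Proof.
move=> nh M0; apply: triple_if => [|_]; first by rewrite /= ltnNge nh.
apply: triple_flat => //=; split=> // _.
exists set0; split; rewrite ?sub0set ?cards0 // => u.
by apply: leq_trans nh; rewrite -[X in _ <= X]card_ord max_card.
Qed.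

(** * Correctness and running time of the whole program *)

Section Solve.

Variables (n : nat) (G : sgraph n) (s : seq ('I_n * 'I_n)) (k h d : nat).
Hypotheses (n_gt0 : 0 < n) (h_gt0 : 0 < h).
Hypothesis s_edges : edge_listing G s.
Hypothesis G_nd : nbh_diversity_at_most G d.

Local Notation es := (nat_edges s).
Local Notation start := (start s k h).
Let m := #|edges G|.
Let radix t := 2 * (2 * ('C(h + t, t) * h) + 2).
Let P := radix d ^ d.
(** [Y] bounds each parameter and the table size. The fourth power admits products of four such
    numbers, as in the weight bound [t * t * (D * D)]. *)
Let Y := n + m + k + h + P + 3.
Let M := Y ^ 4.

Lemma diversity_gt0 : 0 < d.
Proof.
have [Q [/and3P[/eqP covQ _ _] cQ _]] := G_nd.
apply: leq_trans cQ; rewrite lt0n; apply: contraTneq (isT) => /eqP.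
rewrite cards_eq0 => /eqP Q0; move: covQ; rewrite Q0 /cover big_set0 => /setP/(_ (Ordinal n_gt0)).
by rewrite !inE.
Qed.

Lemma bin_mono t t' : t <= t' -> 'C(h + t, t) <= 'C(h + t', t').
Proof.
move=> ht; rewrite -[X in _ <= X]bin_sub ?leq_addl // -[X in X <= _]bin_sub ?leq_addl //.
by rewrite !addnK leq_bin2l // leq_add2l.
Qed.

Lemma radix_mono t t' : t <= t' -> radix t <= radix t'.
Proof. by move/bin_mono; rewrite /radix; nia. Qed.

Lemma pow_mono t : t <= d -> radix t ^ t <= P.
Proof.
move=> ht; apply: (@leq_trans (radix d ^ t)).
  by case: t ht => // t ht; rewrite leq_exp2r // radix_mono.
by rewrite leq_pexp2l // /radix; lia.
Qed.

Lemma radix_le t : t <= d -> radix t <= P.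
Proof.
move=> ht; apply: leq_trans (radix_mono ht) _.
rewrite -{1}[radix d]expn1 leq_pexp2l ?diversity_gt0 // /radix; lia.
Qed.

Lemma bin_le t : t <= d -> 'C(h + t, t) <= P.
Proof. by move=> ht; apply: leq_trans (radix_le ht); rewrite /radix; nia. Qed.

Lemma Y_le : Y <= M.
Proof. by rewrite /M -{1}[Y]expn1 leq_pexp2l // /Y; lia. Qed.

Lemma Y_mul_le a b c e : a <= Y -> b <= Y -> c <= Y -> e <= Y -> a * b * (c * e) <= M.
Proof.
move=> ha hb hc he; have -> : M = Y * Y * (Y * Y) by rewrite /M !expnS expn0 muln1 !mulnA.
by rewrite !leq_mul.
Qed.

Lemma Y3_le : 3 * Y <= M.
Proof.
have Y3 : 3 <= Y by rewrite /Y leq_addl.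
have Y1 : 1 <= Y by apply: leq_trans Y3.
by have := Y_mul_le Y3 (leqnn Y) Y1 Y1; rewrite !muln1.
Qed.

Lemma size_es : size es = m. Proof. exact: size_nat_edges. Qed.

Definition types_found (s' : astate) : Prop :=
  [/\ rg s' Rt <= d,
      forall u : 'I_n, ar s' aTy u < rg s' Rt,
      forall i, i < n -> forall l, l < n ->
        ar s' aTadj (i * n + l) = type_edge (ar s' aTy) es i l,
      forall u v : 'I_n, u != v ->
        ([set u; v] \in edges G) = type_edge (ar s' aTy) es (ar s' aTy u) (ar s' aTy v)
    & forall i, ar s' aSz i = \sum_(u < n) (ar s' aTy u == i)] /\ rg s' Rt <= n.

Lemma find_types_spec :
  triple M find_types start (13 + 40 * n + 40 * m) types_found.
Proof.
have YM := Y_le.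
have sm : small M start by apply: (small_start s_edges); apply: leq_trans YM; rewrite /Y; lia.
have sz : size s = m by rewrite -size_es size_map.
have M1 : 2 * m + n + 2 <= M.
  by have := Y3_le; rewrite {1}/Y; lia.
have sumE : \sum_(v < n) size (row es v) = n + 2 * m by rewrite sum_size_rows size_es.
have M2 : \sum_(v < n) size (row es v) + n + 2 <= M.
  by rewrite sumE; have := Y3_le; rewrite {1}/Y; lia.
have costE : \sum_(v < n) (3 + 7 * size (row es v)) = 3 * n + 7 * (n + 2 * m).
  by rewrite big_split /= sum_nat_const card_ord -big_distrr /= sumE mulnC.
apply: (@triple_seq _ _ _ _ _ (2 + 3 * n + 7 * m + 2) (9 + 37 * n + 33 * m)
  (fun s' => rg s' Rq = 2 * m + 2 /\ rows_ok (2 * m + 2) n (row es) s')) => //; try lia.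
  by apply: build_rows_spec => //; [exact: size_es | exact: nat_edges_lt].
move=> s1 sm1 [fr1 fa1] [q1 R1].
have n1 : rg s1 Rn = n by rewrite fr1.
apply: (@triple_seq _ _ _ _ _ (2 + (3 * n + 7 * (n + 2 * m))) (7 + 27 * n + 19 * m)
  (fun s' => exists fresh H, trie_ok n (visits 1 (row es) n) fresh
     (ar s' aTrieO) (ar s' aLabO) H)) => //; try lia.
  by rewrite -costE; apply: (@refine_spec _ _ (2 * m + 2) 1 aTrieO aLabO (row es)) => // x; rewrite fa1.
move=> s2 sm2 [fr2 fa2] [f2 [H2 T2]].
have n2 : rg s2 Rn = n by rewrite fr2.
apply: (@triple_seq _ _ _ _ _ (2 + (3 * n + 7 * (n + 2 * m))) (5 + 17 * n + 5 * m)
  (fun s' => exists fresh H, trie_ok n (visits 0 (row es) n) fresh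
     (ar s' aTrieC) (ar s' aLabC) H)) => //; try lia.
  rewrite -costE; apply: (@refine_spec _ _ (2 * m + 2) 0 aTrieC aLabC (row es)) => //.
  - by rewrite fr2.
  - by move=> u /R1; rewrite !fa2.
  - by move=> x; rewrite fa2 // fa1.
  - by move=> x; rewrite fa2 // fa1.
move=> s3 sm3 [fr3 fa3] [f3 [H3 T3]].
have n3 : rg s3 Rn = n by rewrite fr3.
have u1 w : w < n -> uniq (drop 1 (row es w)) by move=> hw; rewrite drop1; exact: uniq_neighbours s_edges _ hw.
have u0 w : w < n -> uniq (drop 0 (row es w)) by move=> hw; rewrite drop0; exact: uniq_row s_edges _ hw.
have slE := labels_twin_like s_edges (trie_labels T2 u1) (trie_labels T3 u0).
have trans u v w : u < n -> v < n -> w < n ->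
    same_label (ar s2 aLabO) (ar s3 aLabC) u v -> same_label (ar s2 aLabO) (ar s3 aLabC) v w ->
    same_label (ar s2 aLabO) (ar s3 aLabC) u w.
  move=> hu hv hw.
  rewrite (slE (Ordinal hu) (Ordinal hv)) (slE (Ordinal hv) (Ordinal hw)).
  rewrite (slE (Ordinal hu) (Ordinal hw)); exact: twin_like_trans.
apply: (@triple_seq _ _ _ _ _ (2 + 13 * n) (1 + 5 * m)
  (fun s' => exists ido idc, classes_ok (ar s2 aLabO) (ar s3 aLabC) n (rg s' Rt)
      (ar s' aTy) ido idc (ar s' aSz))) => //; try lia.
  apply: classify_spec => //; try by rewrite ?fa3.
  - by apply: leq_trans YM; rewrite /Y; lia.
  - by move=> x; rewrite fa3 // fa2 // fa1.
  - by move=> x; rewrite fa3 // fa2 // fa1.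
  - by move=> x; rewrite fa3 // fa2 // fa1.
move=> s4 sm4 [fr4 fa4] [ido [idc [c1 c2 c3 _ _ _ c7 c8]]].
have tyE (u v : 'I_n) : (ar s4 aTy u == ar s4 aTy v) = twin_like G u v.
  by rewrite c3 // slE.
have n4 : rg s4 Rn = n by rewrite fr4.
have n5 p : p \in es -> ar s4 aTy p.1 < n /\ ar s4 aTy p.2 < n.
  by move=> /nat_edges_lt[h1 h2]; split; apply: leq_trans (c2 _ _) c1.
have [|||x|w5 k5 q5] := @link_types_spec M n es s4 sm4 _ n4 _ _ n5.
- by apply: leq_trans Y3_le; rewrite /Y; lia.
- by rewrite fr4 // fr3 // fr2 // fr1 // size_map.
- by rewrite fa4 // fa3 // fa2 // fa1.
- by rewrite fa4 // fa3 // fa2 // fa1.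
have [fr5 fa5] := run_same_outside link_types s4.
split=> //; first by apply: leq_trans k5 _; rewrite size_es.
rewrite /types_found fr5 // (fa5 aTy) // (fa5 aSz) //; split=> //; split=> //.
- exact: types_le_diversity tyE c7 G_nd.
- by move=> u; apply: c2.
- by move=> i hi l hl; apply: q5.
- by move=> u v nuv; rewrite (type_edgeE s_edges tyE nuv).
Qed.

Lemma fill_tables_spec s1 t : small M s1 -> rg s1 Rt = t -> t <= d -> t <= n ->
  rg s1 Rn = n -> rg s1 Rh = h ->
  (forall j x, j \in [:: aPw; aVal; aDs; aWt] -> ar s1 j x = 0) ->
  (forall i l, i < t -> l < t -> ar s1 aTadj (i * n + l) <= 1) ->
  let N := 'C(h + t, t) in let D := radix t in let Pt := D ^ t in
  triple M fill_tables s1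
    (12 + 5 * t + 3 * Pt + (2 * t * t + 2 * t + 5) * Pt + 4 * n)
    (fun s' =>
      [/\ rg s' RP = Pt,
          forall i, i < t -> ar s' aPw i = D ^ i,
          forall c, c < Pt -> ar s' aVal c = digits_lt D (2 * (N * h) + 2) t c /\
                              ar s' aDs c = digsum D t c,
          forall c, c < Pt -> digsum D t c <= h ->
            ar s' aWt c = weight n t h N (ar s1 aTadj) c
        & exists2 L, [/\ rg s' Rpw = 2 ^ L, rg s' RL = L & n < 2 ^ L] &
            0 < L -> 2 ^ L.-1 <= n]).
Proof.
move=> sm1 t1 td tn n1 h1 zero adj1 N D Pt.
have Pt_le : Pt <= P by apply: pow_mono.
have P_Y : P <= Y by rewrite /Y; lia.
have Y_1 : 1 <= Y by rewrite /Y; lia.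
have D_le : D <= P by apply: radix_le.
have D_Y := leq_trans D_le P_Y.
have n_Y : n <= Y by rewrite /Y; lia.
have t_Y := leq_trans tn n_Y.
have YM := Y_le.
have D_M := leq_trans D_Y YM.
have tD_M : t * D <= M by have := Y_mul_le t_Y D_Y Y_1 Y_1; rewrite !muln1.
have ttDD_M : t * t * (D * D) <= M by apply: Y_mul_le.
set w := (2 * t * t + 2 * t + 5) * Pt.
apply: (@triple_seq _ _ _ _ _ (2 + 2 * t) (10 + 3 * t + 3 * Pt + w + 4 * n)
  (fun s' => rg s' RN = N)) => //; try lia.
  apply: binomial_loop_spec => // i hi.
  apply: leq_trans YM; apply: leq_trans P_Y; apply: bin_le; exact: leq_trans td.
move=> s2 sm2 [fr2 fa2] N2.
apply: (@triple_seq _ _ _ _ _ (4 + 3 * t) (6 + 3 * Pt + w + 4 * n)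
  (fun s' => [/\ rg s' RK = 2 * (N * h) + 2, rg s' RD = D, rg s' RP = Pt &
                 forall i, i < t -> ar s' aPw i = D ^ i])) => //; try lia.
  apply: radix_setup_spec => //; try by rewrite fr2.
  by apply: leq_trans Pt_le _; apply: leq_trans YM.
move=> s3 sm3 [fr3 fa3] [K3 D3 P3 pw3].
apply: (@triple_seq _ _ _ _ _ (2 + 3 * Pt) (4 + w + 4 * n)
  (fun s' => forall c, c < Pt -> ar s' aVal c = digits_lt D (2 * (N * h) + 2) t c /\
                              ar s' aDs c = digsum D t c)) => //; try lia.
  apply: digit_tables_spec => //.
  - by move=> x; rewrite fa3 // fa2 // zero.
  - by move=> x; rewrite fa3 // fa2 // zero.
  - exact: leq_trans YM.
move=> s4 sm4 [fr4 fa4] V4.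
apply: (@triple_seq _ _ _ _ _ (1 + w) (3 + 4 * n)
  (fun s' => forall c, c < Pt -> digsum D t c <= h ->
            ar s' aWt c = weight n t h N (ar s1 aTadj) c)) => //; try lia.
  apply: weight_table_spec => //.
  - by rewrite fr4 // fr3 // fr2.
  - by rewrite fr4 // fr3 // fr2.
  - by rewrite fr4 // fr3 // fr2.
  - by rewrite fr4.
  - by rewrite fr4.
  - by rewrite fa4 // fa3 // fa2.
  - by move=> i hi; rewrite fa4 // pw3.
  - by move=> c hc; have [] := V4 _ hc.
move=> s5 sm5 [fr5 fa5] W5.
have n5 : rg s5 Rn = n by rewrite fr5 // fr4 // fr3 // fr2.
have n2M : 2 * n + 1 <= M by apply: leq_trans Y3_le; rewrite /Y; lia.
have [w6 k6 [L L1 [_ L2]]] := scale_loop_spec sm5 n5 n2M.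
have [fr6 fa6] := run_same_outside scale_loop s5.
split=> //; split.
- by rewrite fr6 // fr5 // fr4.
- by move=> i hi; rewrite fa6 // fa5 // fa4 // pw3.
- by move=> c hc; rewrite !fa6 // !fa5 //; apply: V4.
- by move=> c hc hd; rewrite fa6 // W5.
- by exists L.
Qed.

(** Allows factors [t] and [t * t] in the costs to be absorbed into the square of the number of
    types. *)
Lemma bin_gt t : t < 'C(h + t, t).
Proof.
apply: (@leq_trans 'C(1 + t, t)); first by rewrite add1n binSn.
by rewrite leq_bin2l // leq_add2r.
Qed.

(** Of the 46, each level takes 29 and the tables 17. Constant terms go into the 72, as [n] is at
    least 2 when [h < n]. *)
Definition running_time :=
  72 * (n + m) + 46 * ((trunc_log 2 n).+1 * ('C(h + d, d) ^ 2 * P)).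

Lemma solve_spec : h < n -> small M start ->
  triple M solve start running_time
    (fun s' => rg s' Rn != 0 <-> T_free_edge_deletion G k h).
Proof.
move=> hn sm.
pose Z := 'C(h + d, d) ^ 2 * P.
pose lg := (trunc_log 2 n).+1.
have Z0 : 0 < Z by rewrite /Z muln_gt0 !expn_gt0 /radix; have := bin_gt d; lia.
have -> : running_time = (72 * (n + m) + 46 * (lg * Z) - 1).+1.
  by rewrite /running_time -/Z -/lg; lia.
apply: triple_if => [_|]; last by rewrite /= hn.
apply: (@triple_seq _ _ _ _ _ (13 + 40 * n + 40 * m) (15 + 4 * n + 46 * (lg * Z)) types_found) => //; try lia.
  exact: find_types_spec.
move=> s1 sm1 [fr1 fa1] [[td ty_lt tadj adjE szE] tn].
set t := rg s1 Rt in td ty_lt tn *.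
pose N := 'C(h + t, t); pose D := radix t; pose Pt := D ^ t; pose K := 2 * (N * h) + 2.
have tadj1 i l : i < t -> l < t -> ar s1 aTadj (i * n + l) <= 1.
  by move=> hi hl; rewrite tadj ?leq_b1 //; [apply: leq_trans hi tn | apply: leq_trans hl tn].
have NZ : N ^ 2 * Pt <= Z.
  by apply: leq_mul; [rewrite leq_exp2r // bin_mono | apply: pow_mono].
have tN : t < N by apply: bin_gt.
have Pt0 : 0 < Pt by rewrite expn_gt0 /D /radix; lia.
have N2 : N <= N ^ 2 by rewrite -{1}[N]expn1 leq_pexp2l //; lia.
have PtZ : Pt <= Z by apply: leq_trans NZ; rewrite leq_pmull // expn_gt0; lia.
have NPZ : N * Pt <= Z by apply: leq_trans NZ; rewrite leq_mul2r N2 orbT.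
have NZ' : N <= Z by apply: leq_trans NPZ; rewrite leq_pmulr.
have tPZ : t * Pt <= Z by apply: leq_trans NPZ; rewrite leq_mul2r ltnW ?orbT.
have ttPZ : t * t * Pt <= Z.
  by apply: leq_trans NZ; rewrite leq_mul2r expnS expn1 leq_mul ?orbT // ltnW.
have frn : rg s1 Rn = n by rewrite fr1.
have frh : rg s1 Rh = h by rewrite fr1.
have zero1 j x : j \in [:: aPw; aVal; aDs; aWt; aT] -> ar s1 j x = 0.
  by rewrite !inE => /or4P[/eqP->|/eqP->|/eqP->|/orP[]/eqP->]; rewrite fa1.
apply: (@triple_seq _ _ _ _ _ (12 + 5 * t + 3 * Pt + (2 * t * t + 2 * t + 5) * Pt + 4 * n)
  (3 + lg * level_cost D h t) _ _ sm1 _ (@fill_tables_spec s1 t sm1 erefl td tn frn frh _ tadj1)).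
- have h1 : level_cost D h t <= 29 * Z.
    by rewrite /level_cost -/Pt -/N mulnDr muln1 mulnCA; lia.
  have h2 : lg * level_cost D h t <= 29 * (lg * Z) by rewrite mulnCA leq_mul2l h1 orbT.
  have h3 : Z <= lg * Z by rewrite leq_pmull.
  have h4 : (2 * t * t + 2 * t + 5) * Pt <= 9 * Z.
    by rewrite !mulnDl -!mulnA; move: ttPZ tPZ; rewrite -mulnA; lia.
  by move: h2 h3 h4; lia.
- move=> j x hj; apply: zero1; move: hj; rewrite !inE => /or4P[]->; rewrite ?orbT //.
move=> s2 sm2 [fr2 fa2] [P2 pw2 tab2 wt2 [L [pwL rgL nL] Lb]].
have fr2t : rg s2 Rt = t by rewrite fr2.
have D1 : 1 < D by rewrite /D /radix; lia.
have hK : h < K by rewrite /K; nia.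
have hD : h < D by rewrite /D /radix -/N -/K; lia.
have DK : 2 * K <= D by [].
have Kb : 2 * (h * \sum_(a < D ^ t) (digsum D t a <= h)) + 2 <= K.
  by rewrite (count_digsum D1 t hD) [h * _]mulnC; apply: leqnn.
pose b i := ar s1 aSz i.
pose w := weight n t h N (ar s1 aTadj).
have ofE i : #|of_type (fun u : 'I_n => ar s1 aTy u) setT i| = b i.
  rewrite /b szE -sum1_card big_mkcond /=; apply: eq_bigr => u _.
  by rewrite inE in_setT /=; case: eqP.
have bsum : \sum_(i < t) b i <= n.
  under eq_bigr => i _ do rewrite -ofE.
  by rewrite -card_by_type // cardsT card_ord.
have w_le a : is_type D h t a -> w a <= h * digsum D t a.
  move=> /andP[_ ha]; apply: leq_trans (weight_le_digsum h N tadj1 a) _.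
  by rewrite leq_mul2r ha orbT.
have bwE a : w a = block_weight D t (type_edge (ar s1 aTy) es) a.
  apply: eq_bigr => i _; apply: eq_bigr => l _.
  by rewrite tadj ?(leq_trans (ltn_ord _) tn).
have E2 : env D K h t b w s2.
  split=> //.
  - by rewrite fr2.
  - by move=> c /tab2[].
  - by move=> c /tab2[].
  - by move=> c /andP[hc hd]; rewrite wt2.
  - by move=> i _; rewrite fa2.
have Y_1 : 1 <= Y by rewrite /Y; lia.
have hnM : h * n + 1 <= M.
  have hY : h <= Y by rewrite /Y; lia.
  have nY : n.+1 <= Y by rewrite /Y; lia.
  have := Y_mul_le hY nY Y_1 Y_1; rewrite !muln1 mulnS; lia.
have PM : D ^ t <= M.
  by apply: leq_trans (pow_mono td) _; apply: leq_trans Y_le; rewrite /Y; lia.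
have [l0 [l01 l02 l03]] := singleton_types D1 hD ty_lt adjE h_gt0.
have ex0 : exists l, [/\ all (is_type D h t) l, size l <= n &
    forall i, i < t -> \sum_(a <- l) dig D i a = b i].
  by exists l0; split=> // i hi; rewrite l03 // ofE.
have m2 : rg s2 Rm = m by rewrite fr2 // fr1 //= -size_es size_map.
have k2 : rg s2 Rk = k by rewrite fr2 // fr1.
have T2 x : ar s2 aT x = 0 by rewrite fa2 // zero1.
have Llg : L <= lg.
  case: L {pwL rgL nL} Lb => // L /(_ isT) /= hL; rewrite /lg ltnS.
  by apply: trunc_log_max.
have sumE l : \sum_(a <- l) w a = \sum_(a <- l) block_weight D t (type_edge (ar s1 aTy) es) a.
  by apply: eq_bigr.
apply: triple_weaken (dynamic_program_spec D1 DK hK Kb bsum w_le hnM PM sm2 E2 m2 k2 rgL pwL nL T2 ex0).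
  by rewrite leq_add2l leq_mul2r Llg orbT.
move=> s' [H1 H2]; split=> [/H1[l [l1 l2 l3]]|].
  apply: (types_to_deletion D1 hD ty_lt adjE l1 _ _); last by rewrite -sumE.
  by move=> i hi; rewrite l2 // ofE.
move=> /(deletion_to_types D1 hD ty_lt adjE)[l [l1 l2 l3 l4]].
apply: (H2 l) => //; last by rewrite sumE.
by move=> i hi; rewrite l3 // ofE.
Qed.

End Solve.

Lemma simulates_start n (s : seq ('I_n * 'I_n)) k h :
  simulates (start s k h) (input s k h).
Proof.
have sz : size (flatten [seq [:: val p.1; val p.2] | p <- s]) = 2 * size s.
  by elim: s => //= p r ->; rewrite mulnS.
have arr : input_array (nat_edges s) = nth 0 (flatten [seq [:: val p.1; val p.2] | p <- s]).
  by rewrite /input_array /nat_edges -map_comp.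
split=> //= [i|j i /andP[j0 _]].
  rewrite arr; case: (leqP i (2 * size s)) => // hi.
  by rewrite !nth_default ?sz // ltnW.
rewrite gtn_eqF // nth_default //.
by apply: (@leq_trans (2 * size s)); rewrite ?sz // -addnA leq_addr.
Qed.

Lemma solve_exec n (G : sgraph n) (s : seq ('I_n * 'I_n)) k h w M T :
  2 <= M -> small M (start s k h) -> M ^ cmd_degree solve < 2 ^ w ->
  triple M solve (start s k h) T (fun s' => rg s' Rn != 0 <-> T_free_edge_deletion G k h) ->
  exists T' final, [/\ exec w (input s k h) (compile solve) T' final,
    T' <= step_cost solve * T & accepts final <-> T_free_edge_deletion G k h].
Proof.
move=> M2 sm hw [wi ct acc].
have [T' [final [x t [r _ _]]]] := compile_exec M2 wf_solve (simulates_start s k h) sm wi hw.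
exists T', final; split=> //; last by rewrite /accepts r.
by apply: leq_trans t _; rewrite leq_mul2l ct orbT.
Qed.

(** If [c <= N], compare the bases; otherwise compare the exponents. It trades an exponential factor
    for a constant and an extra [N ^ N]. *)
Lemma expn_le_self c N : 0 < N -> c ^ N <= c ^ c * N ^ N.
Proof.
move=> N0; case: (posnP c) => [->|c0].
  by rewrite exp0n.
case: (leqP N c) => h.
  by apply: leq_trans (leq_pmulr _ _); rewrite ?expn_gt0 ?N0 // leq_pexp2l.
apply: leq_trans (leq_pmull _ _); rewrite ?expn_gt0 ?c0 //.
by rewrite leq_exp2r // ltnW.
Qed.

(** Squaring keeps the exponent [5 / 2] integral. The spare factor [N ^ N] on the right absorbs
    [16 ^ N], at the cost of the constant [16 ^ 16]. *)
Lemma table_size_le h d : 0 < h -> 0 < d ->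
  ('C(h + d, d) ^ 2 * (2 * (2 * ('C(h + d, d) * h) + 2)) ^ d) ^ 2 <=
  (4 ^ 2) ^ (4 ^ 2) * 'C(h + d, d) ^ (5 * 'C(h + d, d)).
Proof.
move=> h0 d0; set N := 'C(h + d, d).
have dN : d < N by apply: bin_gt.
have hN : h < N.
  by rewrite /N -[X in _ < X]bin_sub ?leq_addl // addnK addnC; apply: bin_gt.
have le1 : 2 * (2 * (N * h) + 2) <= 4 * N ^ 2.
  have : N * h + 1 <= N ^ 2 by rewrite expnS expn1; nia.
  by lia.
have le2 : N ^ 2 * (2 * (2 * (N * h) + 2)) ^ d <= 4 ^ N * N ^ (2 * N).
  apply: (@leq_trans (N ^ 2 * (4 * N ^ 2) ^ N.-1)).
    rewrite leq_mul2l; apply/orP; right; apply: (@leq_trans ((4 * N ^ 2) ^ d)).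
      by rewrite leq_exp2r.
    by rewrite leq_pexp2l ?muln_gt0 ?expn_gt0 //; lia.
  rewrite expnMn -expnM mulnCA -expnD; apply: leq_mul.
    by rewrite leq_pexp2l //; lia.
  by rewrite leq_pexp2l //; lia.
have le3 : (4 ^ N * N ^ (2 * N)) ^ 2 = (4 ^ 2) ^ N * N ^ (4 * N).
  by rewrite expnMn -!expnM [N * 2]mulnC; congr (_ * _ ^ _); lia.
apply: (@leq_trans ((4 ^ N * N ^ (2 * N)) ^ 2)); first by rewrite leq_exp2r.
rewrite le3; have -> : 5 * N = N + 4 * N by lia.
rewrite expnD mulnA leq_mul2r; apply/orP; right.
by apply: expn_le_self; lia.
Qed.

From mathcomp Require Import all_boot all_order all_algebra.
From mathcomp Require Import all_classical all_reals all_analysis.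
From mathcomp Require Import ring lra.
Import Order.TTheory GRing.Theory Num.Theory.
Import numFieldNormedType.Exports.
Local Open Scope classical_set_scope.
Local Open Scope ring_scope.

(** * Real bounds *)

Section RealBounds.

Variable R : realType.

Let ln2_gt0 : 0 < ln 2%:R :> R.
Proof. by rewrite ln_gt0 // ltr1n. Qed.

Lemma ln_nat_pow (x : nat) (e : nat) : (0 < x)%N -> ln ((x ^ e)%N%:R : R) = e%:R * ln x%:R.
Proof. by move=> x0; rewrite natrX lnXn ?ltr0n // mulr_natl. Qed.

Lemma trunc_log_ln (x : nat) : (0 < x)%N -> (trunc_log 2 x)%:R * ln 2%:R <= ln x%:R :> R.
Proof.
move=> x0; rewrite -ln_nat_pow // ler_ln ?posrE ?ltr0n ?expn_gt0 // ler_nat.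
exact: trunc_logP.
Qed.

(** For [X >= 3] one has [X + 3 <= X ^ 2], so [ln Y] is at most [2 * ln X]; with the exponent
    [4 * K] this gives the 8. The 1 pays for rounding up, as [ln 2 <= ln X]. *)
Lemma word_length_le (Y K : nat) (X : R) : (0 < Y)%N -> 3 <= X -> Y%:R <= X + 3 ->
  (trunc_log 2 ((Y ^ 4) ^ K)).+1%:R <= (1 + 8 * K%:R) / ln 2%:R * ln X.
Proof.
move=> Y0 X3 YX.
have X0 : 0 < X by lra.
have l2X : ln 2%:R <= ln X :> R by rewrite ler_ln ?posrE //; lra.
have lYX : ln Y%:R <= 2 * ln X :> R.
  have -> : 2 * ln X = ln (X ^+ 2) by rewrite lnXn // mulr_natl.
  by rewrite ler_ln ?posrE ?exprn_gt0 ?ltr0n // expr2; nra.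
have := @trunc_log_ln ((Y ^ 4) ^ K); rewrite -expnM expn_gt0 Y0 /= => /(_ isT).
rewrite ln_nat_pow // natrM => h.
rewrite mulrAC ler_pdivlMr // -addn1 natrD mulrDl mul1r.
have K0 : 0 <= K%:R :> R by [].
have : 4%:R * K%:R * ln Y%:R <= 4%:R * K%:R * (2 * ln X) by rewrite ler_wpM2l // mulr_ge0.
by lra.
Qed.

(** Both [trunc_log 2 n * ln 2] and [ln 2] are at most [ln n], so each of the two summands costs at
    most one square. *)
Lemma log_le_ln_sq (n : nat) : (1 < n)%N ->
  (trunc_log 2 n).+1%:R <= 2 / ln 2%:R ^+ 2 * ln n%:R ^+ 2 :> R.
Proof.
move=> n1; have n0 : (0 < n)%N by apply: ltnW.
have h1 := trunc_log_ln n0.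
have h2 : ln 2%:R <= ln n%:R :> R by rewrite ler_ln ?posrE ?ltr0n // ler_nat.
rewrite mulrAC ler_pdivlMr ?exprn_gt0 // -addn1 natrD mulrDl mul1r !expr2.
set a := ln 2%:R in h1 h2 *; set b := ln n%:R in h1 h2 *; set l := _%:R in h1 *.
have a0 : 0 < a by [].
have l0 : 0 <= l by rewrite /l.
have : l * a * a <= b * a by rewrite ler_wpM2r // ltW.
have : b * a <= b * b by rewrite ler_wpM2l //; lra.
have : a * a <= b * b by nra.
rewrite mulrA; lra.
Qed.

Lemma table_size_real (h d : nat) : (0 < h)%N -> (0 < d)%N ->
  (('C(h + d, d) ^ 2 * (2 * (2 * ('C(h + d, d) * h) + 2)) ^ d)%N%:R : R) <=
  4%:R ^+ (4 ^ 2) * param_factor (fun=> 0) d h.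
Proof.
move=> h0 d0; set N := 'C(h + d, d); rewrite /param_factor -/N addr0.
have := table_size_le h0 d0; rewrite -/N.
set A := (_ * _)%N; move=> hA.
set B := N%:R `^ _.
have B0 : 0 <= B by apply: powR_ge0.
have B2 : B ^+ 2 = (N ^ (5 * N))%N%:R.
  rewrite natrX -powR_mulrn // /B -powRrM -powR_mulrn //; congr (_ `^ _).
  by rewrite natrM; field.
have c0 : 0 <= 4%:R ^+ (4 ^ 2) :> R by rewrite exprn_ge0.
apply: (@le_trans _ _ (4%:R ^+ (4 ^ 2) * B)).
  rewrite -(@ler_pXn2r _ 2) ?nnegrE ?mulr_ge0 // exprMn B2 -exprM mulnC exprM.
  by rewrite -!natrX -natrM ler_nat.
by rewrite ler_wpM2l // ler_peMl // ler1n.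
Qed.

Lemma zero_littleo : ((fun=> 0) : nat -> R^o) =o_\oo (fun N : nat => N%:R : R^o).
Proof.
apply/eqoP => e e0; near=> x.
by rewrite normr0 mulr_ge0 // ltW.
Unshelve. all: by end_near.
Qed.

End RealBounds.

Theorem theorem4 (R : realType) :
  exists (P : cmd) (C c : R) (g : nat -> R),
    (g : nat -> R^o) =o_\oo (fun N : nat => N%:R : R^o) /\
    forall (n : nat) (G : sgraph n) (s : seq ('I_n * 'I_n)) (k h t : nat),
      (0 < n)%N -> (0 < k)%N -> (0 < h)%N ->
      edge_listing G s ->
      nbh_diversity_at_most G t ->
      let m := #|edges G| in
      let bound := time_bound C g t h n m in
      exists (w T : nat) (final : state),
        [/\ word_length_ok c bound n m k h w,
            exec w (input s k h) P T final,
            T%:R <= bound &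
            accepts final <-> T_free_edge_deletion G k h].
Proof.
pose E : R := (step_cost solve)%:R.
pose F : R := 46 * (2 / ln 2%:R ^+ 2 * 4%:R ^+ (4 ^ 2)).
exists (compile solve), (E * (72 + F) + F + 1),
  ((1 + 8 * (cmd_degree solve)%:R) / ln 2%:R), (fun=> 0).
split; first exact: zero_littleo.
move=> n G s k h t n0 k0 h0 hs ht m bound.
have t0 := diversity_gt0 n0 ht.
have ln2 : 0 < ln 2%:R :> R by rewrite ln_gt0 // ltr1n.
have E0 : 0 <= E by [].
have F0 : 0 <= F by rewrite /F !mulr_ge0 ?invr_ge0 ?exprn_ge0 // ltW.
set Q := param_factor (fun=> 0 : R) t h * ln n%:R ^+ 2.
have Q0 : 0 <= Q.
  by apply: mulr_ge0 (sqr_ge0 _); rewrite /param_factor mulr_ge0 ?powR_ge0.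
have boundE : bound = (E * (72 + F) + F + 1) * (Q + n%:R + m%:R) by [].
have n0' : 1 <= n%:R :> R by rewrite ler1n.
have m0' : 0 <= m%:R :> R by [].
have h0' : 1 <= h%:R :> R by rewrite ler1n.
have k0' : 1 <= k%:R :> R by rewrite ler1n.
have EF0 : 0 <= E * (72 + F) by rewrite mulr_ge0 // addr_ge0.
have bound0 : 0 <= bound by rewrite boundE mulr_ge0 ?addr_ge0.
case: (leqP n h) => nh.
  pose Y := (n + m + k + h + 3)%N.
  pose w := (trunc_log 2 ((Y ^ 4) ^ cmd_degree solve)).+1.
  have sm : small (Y ^ 4) (start s k h).
    apply: (small_start hs); apply: (@leq_trans Y); first by rewrite /Y leq_addr.
    by rewrite -{1}[Y]expn1 leq_pexp2l // /Y addn3.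
  have Y2 : (2 <= Y ^ 4)%N.
    by apply: (@leq_trans (2 ^ 4)); rewrite // leq_exp2r // /Y addn3.
  have hw : ((Y ^ 4) ^ cmd_degree solve < 2 ^ w)%N by apply: trunc_log_ltn.
  have [T [final [x hT acc]]] := solve_exec Y2 sm hw (solve_trivial G s k nh (ltnW Y2)).
  exists w, T, final; split=> //.
    apply: word_length_le; [by rewrite /Y addn3 | by lra | by rewrite /Y !natrD; lra].
  apply: (@le_trans _ _ (step_cost solve * 2)%N%:R); first by rewrite ler_nat.
  by rewrite natrM -/E boundE; nra.
pose Pt := ((2 * (2 * ('C(h + t, t) * h) + 2)) ^ t)%N.
pose Y := (n + m + k + h + Pt + 3)%N.
pose w := (trunc_log 2 ((Y ^ 4) ^ cmd_degree solve)).+1.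
have YM : (Y <= Y ^ 4)%N by rewrite -{1}[Y]expn1 leq_pexp2l // /Y addn3.
have sm : small (Y ^ 4) (start s k h).
  by apply: (small_start hs); apply: leq_trans YM; rewrite /Y; lia.
have Y2 : (2 <= Y ^ 4)%N.
  by apply: (@leq_trans (2 ^ 4)); rewrite // leq_exp2r // /Y addn3.
have hw : ((Y ^ 4) ^ cmd_degree solve < 2 ^ w)%N by apply: trunc_log_ltn.
have [T [final [x hT acc]]] := solve_exec Y2 sm hw (solve_spec n0 h0 hs ht nh sm).
have n1 : (1 < n)%N by apply: leq_ltn_trans nh.
have tbl : (46 * ((trunc_log 2 n).+1 * ('C(h + t, t) ^ 2 * Pt)))%N%:R <= F * Q.
  have h1 := log_le_ln_sq R n1.
  have h2 := table_size_real R h0 t0.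
  have -> : (46 * ((trunc_log 2 n).+1 * ('C(h + t, t) ^ 2 * Pt)))%N%:R =
      46 * ((trunc_log 2 n).+1%:R * ('C(h + t, t) ^ 2 * Pt)%N%:R) :> R.
    by rewrite !natrM.
  have -> : F * Q = 46 * ((2 / ln 2%:R ^+ 2 * ln n%:R ^+ 2) *
      (4%:R ^+ (4 ^ 2) * param_factor (fun=> 0) t h)).
    have shuffle (e a b c f : R) : e * (a * b) * (c * f) = e * (a * f * (b * c)) by ring.
    exact: shuffle.
  by rewrite ler_wpM2l // ler_pM.
have PQ : Pt%:R <= F * Q.
  apply: le_trans tbl; rewrite ler_nat.
  have b0 : (0 < 'C(h + t, t))%N by rewrite bin_gt0 leq_addl.
  have b1 : (Pt <= 'C(h + t, t) ^ 2 * Pt)%N by rewrite leq_pmull // expn_gt0 b0.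
  by apply: leq_trans b1 _; rewrite mulnA leq_pmull.
exists w, T, final; split=> //.
  have FQ : F * Q <= bound by rewrite boundE; nra.
  apply: word_length_le; [by rewrite /Y addn3 | by lra | by rewrite /Y !natrD; lra].
apply: (@le_trans _ _ (step_cost solve * running_time G h t)%N%:R); first by rewrite ler_nat.
rewrite natrM -/E /running_time natrD.
have -> : (72 * (n + #|edges G|))%N%:R = 72 * (n%:R + m%:R) :> R by rewrite natrM natrD.
rewrite boundE; have : E * (46 * ((trunc_log 2 n).+1 * ('C(h + t, t) ^ 2 * Pt)))%N%:R <= E * (F * Q).
  by rewrite ler_wpM2l.
rewrite mulrDr -/Pt; move: (_%:R) => Z hZ.
have EQ : 0 <= E * Q by rewrite mulr_ge0.
have FQ : 0 <= F * Q by rewrite mulr_ge0.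
have EFn : 0 <= E * F * n%:R by rewrite (mulr_ge0 (mulr_ge0 E0 F0)).
have EFm : 0 <= E * F * m%:R by rewrite (mulr_ge0 (mulr_ge0 E0 F0)).
have Fn : 0 <= F * n%:R by rewrite mulr_ge0.
have Fm : 0 <= F * m%:R by rewrite mulr_ge0.
by lra.
Qed.
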